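(* Let $E$ be a finite dimensional operator system and $\omega$ a faithful state on $E$. The following are equivalent: (i) if $\varepsilon>0$ and $\varphi:E\to\mathcal S/\mathcal J$ is a completely positive map for an operator system $\mathcal S$ and a kernel $\mathcal J$ in $\mathcal S$, then there exists a self-adjoint lifting $\tilde\varphi:E\to\mathcal S$ of $\varphi$ such that $\tilde\varphi+\varepsilon\,\omega 1_{\mathcal S}$ is completely positive; (ii) $E$ is unitally completely order isomorphic to a direct sum of matrix algebras.
   Context: Operator systems are abstract (Choi–Effros) operator systems, not assumed complete. A kernel $\mathcal J$ in an operator system $\mathcal S$ is a subspace that is the kernel of a unital completely positive map from $\mathcal S$ to another operator system. The quotient operator system $\mathcal S/\mathcal J$ has order unit $1_{\mathcal S}+\mathcal J$ and cones $M_n(\mathcal S/\mathcal J)^+=\{[x_{i,j}+\mathcal J]:\forall\varepsilon>0\ \exists k_{i,j}\in\mathcal J,\ \varepsilon I_n\otimes1_{\mathcal S}+[x_{i,j}+k_{i,j}]\in M_n(\mathcal S)^+\}$. A self-adjoint lifting of $\varphi$ is a $*$-preserving linear map $\tilde\varphi:E\to\mathcal S$ whose composition with the quotient map $\mathcal S\to\mathcal S/\mathcal J$ is $\varphi$. The map $\omega1_{\mathcal S}:E\to\mathcal S$ is $x\mapsto\omega(x)1_{\mathcal S}$. A state $\omega$ is faithful if $\omega(x)>0$ for every nonzero positive $x$. The direct sum of matrix algebras is finite: $\oplus_{i=1}^nM_{k_i}$. *)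

(* Defs.v *)
From HB Require Import structures.
From mathcomp Require Import all_boot all_order all_algebra.
From mathcomp Require Import generic_quotient ring_quotient.
From mathcomp Require Import complex boolp reals ring lra.

Set Implicit Arguments.
Unset Strict Implicit.
Unset Printing Implicit Defensive.

Import Order.TTheory GRing.Theory Num.Theory.

(* [ring_scope] is opened last, so that [z^*] is [Num.conj z]. *)
Local Open Scope sesquilinear_scope.
Local Open Scope complex_scope.
Local Open Scope ring_scope.

Definition mxstar (V : Type) (star : V -> V) n (X : 'M[V]_n) : 'M[V]_n :=
  \matrix_(i, j) star (X j i).

(* A^* X A for X in M_n(V) and a scalar matrix A. *)
Definition mxcompress (R : realType) (V : lmodType R[i]) m n
    (A : 'M[R[i]]_(n, m)) (X : 'M[V]_n) : 'M[V]_m :=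
  \matrix_(i, j) \sum_k \sum_l ((A k i)^* * A l j) *: X k l.

(* Choi-Effros operator systems: [mpos X] is X \in M_n(V)^+, and
   [v%:M : 'M[V]_n] is the library's diagonal matrix I_n \otimes v. *)
HB.mixin Record isOpSystem (R : realType) V of GRing.Lmodule R[i] V := {
  ostar : V -> V;
  ounit : V;
  mpos : forall n, 'M[V]_n -> Prop;
  ostarD : {morph ostar : x y / x + y};
  ostarZ : forall (a : R[i]) x, ostar (a *: x) = a^* *: ostar x;
  ostarK : involutive ostar;
  ostar_unit : ostar ounit = ounit;
  mpos_star : forall n (X : 'M[V]_n), mpos n X -> mxstar ostar X = X;
  mposD : forall n (X Y : 'M[V]_n), mpos n X -> mpos n Y -> mpos n (X + Y);
  mpos_compress : forall m n (A : 'M[R[i]]_(n, m)) (X : 'M[V]_n),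
    mpos n X -> mpos m (mxcompress A X);
  mpos_proper : forall n (X : 'M[V]_n), mpos n X -> mpos n (- X) -> X = 0;
  ounit_order : forall n (X : 'M[V]_n), mxstar ostar X = X ->
    exists2 t : R, 0 < t & mpos n ((t%:C *: ounit)%:M + X);
  ounit_archi : forall n (X : 'M[V]_n),
    (forall e : R, 0 < e -> mpos n ((e%:C *: ounit)%:M + X)) -> mpos n X
}.

#[short(type="opSystemType")]
HB.structure Definition OpSystem (R : realType) :=
  { V of isOpSystem R V & GRing.Lmodule R[i] V }.

Arguments ostar {R s} _ : rename.
Arguments ounit {R s} : rename.
Arguments mpos {R s n} _ : rename.

#[short(type="finOpSystemType")]
HB.structure Definition FinOpSystem (R : realType) :=
  { V of OpSystem R V & Vector R[i] V }.

Arguments ostarZ {R s} a x : rename.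
Arguments mpos_star {R s n X} : rename.
Arguments mposD {R s n X Y} : rename.
Arguments mpos_compress {R s m n} A {X} : rename.
Arguments mpos_proper {R s n X} : rename.
Arguments ounit_order {R s n X} : rename.
Arguments ounit_archi {R s n X} : rename.

Definition positive (R : realType) (V : opSystemType R) (x : V) : Prop :=
  mpos (x%:M : 'M[V]_1).

Definition completely_positive (R : realType) (V W : opSystemType R)
    (f : V -> W) : Prop :=
  forall n (X : 'M[V]_n), mpos X -> mpos (map_mx f X).

Definition unital (R : realType) (V W : opSystemType R) (f : V -> W) : Prop :=
  f ounit = ounit.

Definition star_preserving (R : realType) (V W : opSystemType R)
    (f : V -> W) : Prop :=
  forall x, f (ostar x) = ostar (f x).

Definition state (R : realType) (V : opSystemType R)
    (omega : {scalar V}) : Prop :=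
  omega ounit = 1 /\ forall x : V, positive x -> 0 <= omega x.

Definition faithful (R : realType) (V : opSystemType R)
    (omega : {scalar V}) : Prop :=
  forall x : V, positive x -> x != 0 -> 0 < omega x.

Definition unit_map (R : realType) (V W : opSystemType R)
    (omega : {scalar V}) (x : V) : W :=
  omega x *: ounit.

Definition unital_complete_order_iso (R : realType)
    (V W : opSystemType R) : Prop :=
  exists (f : {linear V -> W}) (g : {linear W -> V}),
    [/\ cancel f g, cancel g f, unital f,
        completely_positive f & completely_positive g].

Record kernel (R : realType) (S : opSystemType R) := Kernel {
  kernel_pred : {pred S};
  kernelP : exists (T : opSystemType R) (psi : {linear S -> T}),
    [/\ unital psi, completely_positive psi
      & forall x, (x \in kernel_pred) = (psi x == 0)]
}.

Section OpSystemTheory.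
Variables (R : realType) (V : opSystemType R).
Implicit Types (x y : V) (n : nat) (t e : R).

Lemma ostar0 : ostar (0 : V) = 0.
Proof. by have := ostarZ 0 (0 : V); rewrite !scale0r raddf0 scale0r. Qed.

Lemma ostarN x : ostar (- x) = - ostar x.
Proof. by rewrite -scaleN1r ostarZ rmorphN rmorph1 scaleN1r. Qed.

Lemma ostarB x y : ostar (x - y) = ostar x - ostar y.
Proof. by rewrite ostarD ostarN. Qed.

Lemma ostar_sum I (r : seq I) (P : pred I) (F : I -> V) :
  ostar (\sum_(i <- r | P i) F i) = \sum_(i <- r | P i) ostar (F i).
Proof. by apply: (big_morph _ (@ostarD _ _)); exact: ostar0. Qed.

Lemma conjRC t : (t%:C)^* = t%:C.
Proof. by apply: conj_Creal; apply/complex_realP; exists t. Qed.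

Lemma mpos_scale n t (X : 'M[V]_n) : 0 <= t -> mpos X ->
  mpos (map_mx ( *:%R t%:C) X).
Proof.
move=> t0 pX; have := mpos_compress ((Num.sqrt t)%:C)%:M pX.
congr mpos; apply/matrixP => i j; rewrite !mxE (bigD1 i) //=.
rewrite [X in _ + X]big1 ?addr0 => [|k ki]; last first.
  by apply: big1 => l _; rewrite !mxE (negPf ki) mulr0n rmorph0 mul0r scale0r.
rewrite (bigD1 j) //= big1 ?addr0 => [|l lj]; last first.
  by rewrite !mxE (negPf lj) mulr0n mulr0 scale0r.
by rewrite !mxE !eqxx !mulr1n conjRC -rmorphM -expr2 sqr_sqrtr.
Qed.

Lemma mpos_unit n t : 0 <= t -> mpos ((t%:C *: ounit)%:M : 'M[V]_n).
Proof.
move=> t0; have s0 : mxstar (@ostar R V) (0 : 'M[V]_n) = 0.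
  by apply/matrixP => i j; rewrite !mxE ostar0.
have [s s_gt0] := ounit_order s0; rewrite addr0 => ps.
have := mpos_scale (divr_ge0 t0 (ltW s_gt0)) ps.
congr mpos; apply/matrixP => i j; rewrite !mxE.
by rewrite -scalerMnr scalerA -rmorphM /= divfK ?(gt_eqF s_gt0).
Qed.

Lemma mpos0 n : mpos (0 : 'M[V]_n).
Proof. by have := mpos_unit n (lexx 0); rewrite scale0r raddf0. Qed.

Lemma scalemx_unit t n :
  map_mx ( *:%R t%:C) ((ounit : V)%:M) = (t%:C *: ounit)%:M :> 'M[V]_n.
Proof. by apply/matrixP => i j; rewrite !mxE scalerMnr. Qed.

Lemma mpos_sum I (r : seq I) (P : pred I) n (F : I -> 'M[V]_n) :
  (forall i, P i -> mpos (F i)) -> mpos (\sum_(i <- r | P i) F i).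
Proof.
move=> pF; apply: (big_ind (@mpos R V n)) => //; first exact: mpos0.
by move=> X Y; apply: mposD.
Qed.

Lemma mxcompressD m n (A : 'M[R[i]]_(n, m)) (X Y : 'M[V]_n) :
  mxcompress A (X + Y) = mxcompress A X + mxcompress A Y.
Proof.
apply/matrixP => i j; rewrite !mxE -big_split; apply: eq_bigr => k _.
by rewrite -big_split; apply: eq_bigr => l _; rewrite !mxE scalerDr.
Qed.

Lemma mxcompress_unitZ m n (A : 'M[R[i]]_(n, m)) (a : R[i]) :
  mxcompress A ((a *: ounit)%:M : 'M[V]_n) =
  map_mx ( *:%R a) (mxcompress A ounit%:M).
Proof.
apply/matrixP => i j; rewrite !mxE scaler_sumr; apply: eq_bigr => k _.
rewrite scaler_sumr; apply: eq_bigr => l _.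
by rewrite !mxE scalerMnr !scalerA mulrC.
Qed.

Lemma mxcompress_unit_star m n (A : 'M[R[i]]_(n, m)) :
  mxstar (@ostar R V) (mxcompress A ounit%:M) = mxcompress A ounit%:M.
Proof.
apply/matrixP => i j; rewrite !mxE ostar_sum [RHS]exchange_big /=.
apply: eq_bigr => k _; rewrite ostar_sum; apply: eq_bigr => l _.
rewrite ostarZ !mxE rmorphM /= conjCK mulrC [l == k]eq_sym.
by case: eqP => _; rewrite ?mulr1n ?ostar_unit // mulr0n ostar0.
Qed.

End OpSystemTheory.

Section LinearMaps.
Variables (R : realType) (V W : opSystemType R) (f : {linear V -> W}).

Lemma map_mxcompress m n (A : 'M[R[i]]_(n, m)) (X : 'M[V]_n) :
  map_mx f (mxcompress A X) = mxcompress A (map_mx f X).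
Proof.
apply/matrixP => i j; rewrite !mxE linear_sum; apply: eq_bigr => k _.
by rewrite linear_sum; apply: eq_bigr => l _; rewrite linearZ !mxE.
Qed.

Lemma map_unit_mx n t : unital f ->
  map_mx f ((t *: ounit)%:M : 'M[V]_n) = (t *: ounit)%:M.
Proof.
move=> f1; apply/matrixP => i j.
by rewrite !mxE linearMn linearZ /= f1.
Qed.

Hypothesis f_cp : completely_positive f.

Lemma cp_selfadjoint n (X : 'M[V]_n) : mxstar ostar X = X ->
  mxstar ostar (map_mx f X) = map_mx f X.
Proof.
move=> sX; have [t t0 pX] := ounit_order sX.
have := mpos_star (f_cp pX); rewrite map_mxD => /matrixP E.
have /mpos_star/matrixP E1 := f_cp (mpos_unit V n (ltW t0)).
apply/matrixP => i j; have := E i j; have := E1 i j.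
by rewrite !mxE ostarD => ->; apply: addrI.
Qed.

Lemma cp_star_preserving : star_preserving f.
Proof.
have sa x : ostar x = x -> ostar (f x) = f x.
  move=> sx; have /cp_selfadjoint/matrixP/(_ 0 0) : mxstar ostar (x%:M : 'M_1) = x%:M.
    by apply/matrixP => i j; rewrite !mxE !ord1 eqxx mulr1n.
  by rewrite !mxE eqxx mulr1n.
have ni : ('i : R[i])^* = - 'i by exact: conjCi.
move=> x; have hs : ostar (x + ostar x) = x + ostar x.
  by rewrite ostarD ostarK addrC.
have hi : ostar ('i *: (x - ostar x)) = 'i *: (x - ostar x).
  by rewrite ostarZ ni ostarB ostarK scaleNr -scalerN opprB.
have h2 : ostar (f (ostar x)) + ostar (f x) = f x + f (ostar x).
  by rewrite addrC -ostarD -linearD sa.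
have h1 : ostar (f (ostar x)) - ostar (f x) = f x - f (ostar x).
  apply: (scalerI (neq0Ci R[i])); rewrite -linearB -linearZ -(sa _ hi).
  by rewrite linearZ ostarZ ni [f (x - _)]linearB ostarB scaleNr -scalerN opprB.
have h : 2%:R *: ostar (f (ostar x)) = 2%:R *: f x :> W.
  rewrite !scaler_nat !mulr2n -[LHS](subrKA (ostar (f x)))
      -[RHS](subrKA (f (ostar x))) h1.
  by rewrite [f (ostar x) + _]addrC -h2 [ostar (f x) + _]addrC.
have /scalerI/(_ _ _ h) <- : (2%:R : R[i]) != 0 by rewrite pnatr_eq0.
by rewrite ostarK.
Qed.

End LinearMaps.

Section KernelTheory.
Variables (R : realType) (S : opSystemType R) (J : kernel S).

Lemma kernel_zmod_closed : zmod_closed (kernel_pred J).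
Proof.
have [T [psi [_ _ kerE]]] := kernelP J.
split=> [|x y]; rewrite !kerE ?linear0 // => /eqP px /eqP py.
by rewrite linearB /= px py subr0.
Qed.

HB.instance Definition _ :=
  GRing.isZmodClosed.Build S (kernel_pred J) kernel_zmod_closed.

Lemma kernelZ a x : x \in kernel_pred J -> a *: x \in kernel_pred J.
Proof.
have [T [psi [_ _ kerE]]] := kernelP J.
by rewrite !kerE linearZ /= => /eqP ->; rewrite scaler0.
Qed.

Lemma kernel_star x : x \in kernel_pred J -> ostar x \in kernel_pred J.
Proof.
have [T [psi [_ psi_cp kerE]]] := kernelP J.
by rewrite !kerE (cp_star_preserving psi_cp) => /eqP ->; rewrite ostar0.
Qed.

End KernelTheory.

Definition quotient_sys (R : realType) (S : opSystemType R) (J : kernel S) :=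
  Quotient.quot (kernel_pred J).

Section Quotient.
Variables (R : realType) (S : opSystemType R) (J : kernel S).
Local Notation Q := (quotient_sys J).
Implicit Types (p q : Q) (n : nat).

HB.instance Definition _ := GRing.Zmodule.on Q.

Definition quotient_map (x : S) : Q := (\pi_(Quotient.quot (kernel_pred J)) x)%qT.
Local Notation pi := quotient_map.

Lemma quotient_mapP x y : pi x = pi y <-> x - y \in kernel_pred J.
Proof. by rewrite Quotient.idealrBE; split=> [/eqP|/eqP]. Qed.

Lemma quotient_mapK p : pi (repr (p : Quotient.quot (kernel_pred J))) = p.
Proof. exact: reprK. Qed.

Let rp (p : Q) : S := repr (p : Quotient.quot (kernel_pred J)).

Lemma quotient_map_is_zmod_morphism : zmod_morphism pi.
Proof. by move=> x y; rewrite /pi raddfB. Qed.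

HB.instance Definition _ :=
  GRing.isZmodMorphism.Build S Q pi quotient_map_is_zmod_morphism.

Definition quotient_scale (a : R[i]) p : Q := pi (a *: rp p).

Lemma quotient_scaleE a x : quotient_scale a (pi x) = pi (a *: x).
Proof.
by apply/quotient_mapP; rewrite -scalerBr kernelZ //; apply/quotient_mapP/reprK.
Qed.

Fact quotient_scaleA a b p :
  quotient_scale a (quotient_scale b p) = quotient_scale (a * b) p.
Proof. by rewrite -[p]quotient_mapK !quotient_scaleE scalerA. Qed.

Fact quotient_scale1 : left_id 1 quotient_scale.
Proof. by move=> p; rewrite -[p]quotient_mapK quotient_scaleE scale1r. Qed.

Fact quotient_scaleDr : right_distributive quotient_scale +%R.
Proof.
move=> a p q; rewrite -[p]quotient_mapK -[q]quotient_mapK -raddfD.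
by rewrite !quotient_scaleE scalerDr raddfD.
Qed.

Fact quotient_scaleDl p :
  {morph quotient_scale^~ p : a b / a + b >-> a + b}.
Proof.
move=> a b; rewrite -[p]quotient_mapK !quotient_scaleE.
by rewrite scalerDl raddfD.
Qed.

HB.instance Definition _ := GRing.Zmodule_isLmodule.Build R[i] Q
  quotient_scaleA quotient_scale1 quotient_scaleDr quotient_scaleDl.

Lemma quotient_map_is_scalable : scalable pi.
Proof. by move=> a x; rewrite -quotient_scaleE. Qed.

HB.instance Definition _ :=
  GRing.isScalable.Build R[i] S Q *:%R pi quotient_map_is_scalable.

Definition quotient_star p : Q := pi (ostar (rp p)).

Lemma quotient_starE x : quotient_star (pi x) = pi (ostar x).
Proof.
by apply/quotient_mapP; rewrite -ostarB kernel_star //; apply/quotient_mapP/reprK.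
Qed.

Definition quotient_unit : Q := pi ounit.

Definition quotient_mpos n (P : 'M[Q]_n) : Prop :=
  exists2 X : 'M[S]_n, P = map_mx pi X &
    forall e : R, 0 < e -> exists2 K : 'M[S]_n,
      forall i j, K i j \in kernel_pred J &
      mpos ((e%:C *: ounit)%:M + (X + K)).

Lemma map_quotient_mxP n (X Y : 'M[S]_n) : map_mx pi X = map_mx pi Y <->
  forall i j, (X - Y) i j \in kernel_pred J.
Proof.
split=> [/matrixP E i j|E]; first by have := E i j; rewrite !mxE => /quotient_mapP.
by apply/matrixP => i j; have := E i j; rewrite !mxE => /quotient_mapP.
Qed.

Lemma map_quotient_mxK n (P : 'M[Q]_n) : map_mx pi (map_mx rp P) = P.
Proof. by apply/matrixP => i j; rewrite !mxE; exact: reprK. Qed.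

Lemma quotient_mposE n (X : 'M[S]_n) : quotient_mpos (map_mx pi X) <->
  forall e : R, 0 < e -> exists2 K : 'M[S]_n,
      forall i j, K i j \in kernel_pred J &
      mpos ((e%:C *: ounit)%:M + (X + K)).
Proof.
split=> [[Y /map_quotient_mxP XY pY] e /pY [K KJ pK]|pX]; last by exists X.
exists (Y - X + K); last by rewrite (addrA X) subrKC.
by move=> i j; rewrite -opprB !mxE rpredD ?rpredN //; have := XY i j; rewrite !mxE.
Qed.

Fact quotient_starD : {morph quotient_star : p q / p + q}.
Proof.
move=> p q; rewrite -[p]quotient_mapK -[q]quotient_mapK -raddfD.
by rewrite !quotient_starE ostarD raddfD.
Qed.

Fact quotient_starZ a p : quotient_star (a *: p) = a^* *: quotient_star p.
Proof.
rewrite -[p]quotient_mapK -linearZ !quotient_starE ostarZ.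
by rewrite linearZ.
Qed.

Fact quotient_starK : involutive quotient_star.
Proof. by move=> p; rewrite -[p]quotient_mapK !quotient_starE ostarK. Qed.

Fact quotient_star_unit : quotient_star quotient_unit = quotient_unit.
Proof. by rewrite quotient_starE ostar_unit. Qed.

Lemma map_quotient_mxstar n (X : 'M[S]_n) :
  mxstar quotient_star (map_mx pi X) = map_mx pi (mxstar ostar X).
Proof. by apply/matrixP => i j; rewrite !mxE quotient_starE. Qed.

Lemma map_quotient_compress m n (A : 'M[R[i]]_(n, m)) (X : 'M[S]_n) :
  mxcompress A (map_mx pi X) = map_mx pi (mxcompress A X).
Proof.
apply/matrixP => i j; rewrite !mxE linear_sum; apply: eq_bigr => k _.
by rewrite linear_sum; apply: eq_bigr => l _; rewrite linearZ !mxE.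
Qed.

Lemma map_quotient_unit n (a : R[i]) :
  (a *: quotient_unit)%:M = map_mx pi ((a *: ounit)%:M : 'M[S]_n).
Proof. by apply/matrixP => i j; rewrite !mxE linearMn linearZ. Qed.

Fact quotient_mpos_star n (P : 'M[Q]_n) :
  quotient_mpos P -> mxstar quotient_star P = P.
Proof.
move=> [X -> pX]; have [K KJ /mpos_star sXK] := pX 1 ltr01.
have KE : map_mx pi (X + K) = map_mx pi X.
  by apply/map_quotient_mxP => i j; rewrite addrAC subrr add0r.
rewrite -KE map_quotient_mxstar; congr map_mx.
have := mpos_star (mpos_unit S n ler01).
move: sXK => /matrixP E /matrixP E1; apply/matrixP => i j.
have := E i j; have := E1 i j; rewrite !mxE ostarD => ->.
exact: addrI.
Qed.

Lemma splitunit n (a b : R) (V : opSystemType R) :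
  ((a + b)%:C *: ounit)%:M =
  (a%:C *: ounit)%:M + (b%:C *: ounit)%:M :> 'M[V]_n.
Proof. by rewrite rmorphD scalerDl raddfD. Qed.

Fact quotient_mposD n (P P' : 'M[Q]_n) :
  quotient_mpos P -> quotient_mpos P' -> quotient_mpos (P + P').
Proof.
move=> [X -> pX] [Y -> pY]; rewrite -map_mxD; apply/quotient_mposE => e e0.
have e2 : 0 < e / 2%:R by rewrite divr_gt0 ?ltr0n.
have [K KJ pK] := pX _ e2; have [L LJ pL] := pY _ e2.
exists (K + L); first by move=> i j; rewrite mxE rpredD.
by rewrite [e]splitr splitunit (addrACA X) (addrACA _%:M); exact: (mposD pK pL).
Qed.

Fact quotient_mpos_compress m n (A : 'M[R[i]]_(n, m)) (P : 'M[Q]_n) :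
  quotient_mpos P -> quotient_mpos (mxcompress A P).
Proof.
move=> [X -> pX]; rewrite map_quotient_compress.
apply/quotient_mposE => e e0.
have sA : mxstar ostar (- mxcompress A (ounit%:M : 'M[S]_n)) =
    - mxcompress A ounit%:M.
  rewrite -[in RHS]mxcompress_unit_star.
  by apply/matrixP => i j; rewrite !mxE ostarN.
have [t t0 pt] := ounit_order sA.
have d0 : 0 < e / t by rewrite divr_gt0.
have [K KJ /(mpos_compress A) pK] := pX _ d0.
exists (mxcompress A K).
  by move=> i j; rewrite mxE rpred_sum // => k _; rewrite rpred_sum // => l _; exact: kernelZ.
have := mposD pK (mpos_scale (ltW d0) pt); congr mpos.
have -> : map_mx ( *:%R (e / t)%:C)
      ((t%:C *: ounit)%:M - mxcompress A ounit%:M) =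
    (e%:C *: ounit)%:M - mxcompress A ((e / t)%:C *: ounit)%:M :> 'M[S]_m.
  rewrite mxcompress_unitZ map_mxB; congr (_ - _); apply/matrixP => i j.
  by rewrite !mxE /= -scalerMnr scalerA -rmorphM /= divfK ?(gt_eqF t0).
by rewrite !mxcompressD addrC -!addrA addKr.
Qed.

Fact quotient_mpos_proper n (P : 'M[Q]_n) :
  quotient_mpos P -> quotient_mpos (- P) -> P = 0.
Proof.
have [T [psi [psi1 psi_cp kerE]]] := kernelP J.
have key (X : 'M[S]_n) : quotient_mpos (map_mx pi X) -> mpos (map_mx psi X).
  move=> /quotient_mposE pX; apply: ounit_archi => e /pX [K KJ /psi_cp].
  rewrite !map_mxD (map_unit_mx _ _ psi1).
  suff -> : map_mx psi K = 0 by rewrite addr0.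
  by apply/matrixP => i j; rewrite !mxE; apply/eqP; rewrite -kerE.
rewrite -[P]map_quotient_mxK -map_mxN => /key pP /key.
rewrite map_mxN => /(mpos_proper pP) /matrixP E.
rewrite -(map_mx0 pi); apply/map_quotient_mxP => i j.
by rewrite subr0 kerE; have := E i j; rewrite !mxE => ->.
Qed.

Fact quotient_unit_order n (P : 'M[Q]_n) : mxstar quotient_star P = P ->
  exists2 t : R, 0 < t & quotient_mpos ((t%:C *: quotient_unit)%:M + P).
Proof.
move=> sP; pose X := map_mx rp P.
pose h : R[i] := 2%:R^-1.
have hC : h^* = h by apply: conj_Creal; rewrite realV realn.
pose Y := map_mx ( *:%R h) (X + mxstar ostar X).
have sY : mxstar ostar Y = Y.
  by apply/matrixP => i j; rewrite !mxE ostarZ hC ostarD ostarK addrC.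
have PY : P = map_mx pi Y.
  apply/matrixP => i j; move: sP => /matrixP/(_ i j).
  rewrite -[P]map_quotient_mxK -/X map_quotient_mxstar !mxE linearZ linearD /=.
  move=> ->; rewrite -mulr2n -scaler_nat scalerA mulVf ?scale1r //.
  by rewrite pnatr_eq0.
have [t t0 pY] := ounit_order sY; exists t => //.
rewrite PY map_quotient_unit -map_mxD; apply/quotient_mposE => e e0.
exists 0; first by move=> i j; rewrite mxE rpred0.
by rewrite addr0; apply: mposD pY; apply: mpos_unit; apply: ltW.
Qed.

Fact quotient_unit_archi n (P : 'M[Q]_n) :
  (forall e : R, 0 < e -> quotient_mpos ((e%:C *: quotient_unit)%:M + P)) ->
  quotient_mpos P.
Proof.
rewrite -[P]map_quotient_mxK; set X := map_mx rp P => pX.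
apply/quotient_mposE => e e0.
have e2 : 0 < e / 2%:R by rewrite divr_gt0 ?ltr0n.
have := pX _ e2; rewrite map_quotient_unit -map_mxD => /quotient_mposE.
by move=> /(_ _ e2) [K KJ]; rewrite -(addrA _ X) (addrA _%:M) -splitunit -splitr; exists K.
Qed.

HB.instance Definition _ := isOpSystem.Build R Q
  quotient_starD quotient_starZ quotient_starK quotient_star_unit
  quotient_mpos_star quotient_mposD quotient_mpos_compress
  quotient_mpos_proper quotient_unit_order quotient_unit_archi.

End Quotient.

(* The direct sum, as functions i |-> (x i \in V i), with componentwise
   operations and cones. *)
Definition dirsum (R : realType) n (V : 'I_n -> opSystemType R) :=
  {dffun forall i : 'I_n, V i}.

Section DirectSum.
Variables (R : realType) (N : nat) (V : 'I_N -> opSystemType R).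
Local Notation D := (dirsum V).
Implicit Types (x y z : D) (n : nat).

HB.instance Definition _ := Choice.on D.

Definition dirsum_of (f : forall i, V i) : D := [ffun i => f i].

Lemma dirsumP x y : (forall i, x i = y i) -> x = y.
Proof. by move=> E; apply/ffunP. Qed.

Definition dirsum_add x y := dirsum_of (fun i => x i + y i).
Definition dirsum_opp x := dirsum_of (fun i => - x i).
Definition dirsum_zero := dirsum_of (fun i => 0).
Definition dirsum_scale (a : R[i]) x := dirsum_of (fun i => a *: x i).

Fact dirsum_addA : associative dirsum_add.
Proof. by move=> x y z; apply: dirsumP => i; rewrite !ffunE addrA. Qed.
Fact dirsum_addC : commutative dirsum_add.
Proof. by move=> x y; apply: dirsumP => i; rewrite !ffunE addrC. Qed.
Fact dirsum_add0 : left_id dirsum_zero dirsum_add.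
Proof. by move=> x; apply: dirsumP => i; rewrite !ffunE add0r. Qed.
Fact dirsum_addN : left_inverse dirsum_zero dirsum_opp dirsum_add.
Proof. by move=> x; apply: dirsumP => i; rewrite !ffunE addNr. Qed.

HB.instance Definition _ := GRing.isZmodule.Build D
  dirsum_addA dirsum_addC dirsum_add0 dirsum_addN.

Fact dirsum_scaleA a b x :
  dirsum_scale a (dirsum_scale b x) = dirsum_scale (a * b) x.
Proof. by apply: dirsumP => i; rewrite !ffunE scalerA. Qed.
Fact dirsum_scale1 : left_id 1 dirsum_scale.
Proof. by move=> x; apply: dirsumP => i; rewrite !ffunE scale1r. Qed.
Fact dirsum_scaleDr : right_distributive dirsum_scale +%R.
Proof. by move=> a x y; apply: dirsumP => i; rewrite !ffunE scalerDr. Qed.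
Fact dirsum_scaleDl x : {morph dirsum_scale^~ x : a b / a + b >-> a + b}.
Proof. by move=> a b; apply: dirsumP => i; rewrite !ffunE scalerDl. Qed.

HB.instance Definition _ := GRing.Zmodule_isLmodule.Build R[i] D
  dirsum_scaleA dirsum_scale1 dirsum_scaleDr dirsum_scaleDl.

Definition dirsum_proj (i : 'I_N) (x : D) : V i := x i.

Fact dirsum_proj_is_linear i : linear (dirsum_proj i).
Proof. by move=> a x y; rewrite /dirsum_proj !ffunE. Qed.

HB.instance Definition _ i := GRing.isLinear.Build R[i] D (V i) *:%R
  (dirsum_proj i) (dirsum_proj_is_linear i).

Definition dirsum_star x : D := dirsum_of (fun i => ostar (x i)).
Definition dirsum_unit : D := dirsum_of (fun i => ounit).
Definition dirsum_mpos n (X : 'M[D]_n) : Prop :=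
  forall i, mpos (map_mx (dirsum_proj i) X).

Lemma dirsum_mxP n (X Y : 'M[D]_n) :
  (forall i, map_mx (dirsum_proj i) X = map_mx (dirsum_proj i) Y) -> X = Y.
Proof.
move=> E; apply/matrixP => j k; apply: dirsumP => i.
by have /matrixP/(_ j k) := E i; rewrite !mxE.
Qed.

Lemma dirsum_proj_mxstar i n (X : 'M[D]_n) :
  map_mx (dirsum_proj i) (mxstar dirsum_star X) =
  mxstar ostar (map_mx (dirsum_proj i) X).
Proof. by apply/matrixP => j k; rewrite !mxE /dirsum_proj ffunE. Qed.

Lemma dirsum_proj_compress i m n (A : 'M[R[i]]_(n, m)) (X : 'M[D]_n) :
  map_mx (dirsum_proj i) (mxcompress A X) =
  mxcompress A (map_mx (dirsum_proj i) X).
Proof.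
apply/matrixP => j l; rewrite !mxE linear_sum; apply: eq_bigr => k _.
by rewrite linear_sum; apply: eq_bigr => h _; rewrite linearZ !mxE.
Qed.

Lemma dirsum_proj_unit i n (a : R[i]) :
  map_mx (dirsum_proj i) ((a *: dirsum_unit)%:M : 'M[D]_n) =
  (a *: ounit)%:M.
Proof.
apply/matrixP => j k; rewrite !mxE linearMn linearZ /=.
by rewrite /dirsum_proj ffunE.
Qed.

Fact dirsum_starD : {morph dirsum_star : x y / x + y}.
Proof. by move=> x y; apply: dirsumP => i; rewrite !ffunE ostarD. Qed.
Fact dirsum_starZ a x : dirsum_star (a *: x) = a^* *: dirsum_star x.
Proof. by apply: dirsumP => i; rewrite !ffunE ostarZ. Qed.
Fact dirsum_starK : involutive dirsum_star.
Proof. by move=> x; apply: dirsumP => i; rewrite !ffunE ostarK. Qed.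
Fact dirsum_star_unit : dirsum_star dirsum_unit = dirsum_unit.
Proof. by apply: dirsumP => i; rewrite !ffunE ostar_unit. Qed.

Fact dirsum_mpos_star n (X : 'M[D]_n) :
  dirsum_mpos X -> mxstar dirsum_star X = X.
Proof.
move=> pX; apply: dirsum_mxP => i.
by rewrite dirsum_proj_mxstar; exact: mpos_star (pX i).
Qed.

Fact dirsum_mposD n (X Y : 'M[D]_n) :
  dirsum_mpos X -> dirsum_mpos Y -> dirsum_mpos (X + Y).
Proof. by move=> pX pY i; rewrite map_mxD; exact: mposD (pX i) (pY i). Qed.

Fact dirsum_mpos_compress m n (A : 'M[R[i]]_(n, m)) (X : 'M[D]_n) :
  dirsum_mpos X -> dirsum_mpos (mxcompress A X).
Proof.
by move=> pX i; rewrite dirsum_proj_compress; exact: mpos_compress (pX i).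
Qed.

Fact dirsum_mpos_proper n (X : 'M[D]_n) :
  dirsum_mpos X -> dirsum_mpos (- X) -> X = 0.
Proof.
move=> pX nX; apply: dirsum_mxP => i; rewrite map_mx0.
by apply: mpos_proper (pX i) _; rewrite -map_mxN; exact: nX.
Qed.

Fact dirsum_unit_order n (X : 'M[D]_n) : mxstar dirsum_star X = X ->
  exists2 t : R, 0 < t & dirsum_mpos ((t%:C *: dirsum_unit)%:M + X).
Proof.
move=> sX.
have bound i : exists t : R, 0 < t /\
    mpos ((t%:C *: ounit)%:M + map_mx (dirsum_proj i) X).
  have [|t t0 pt] := @ounit_order _ _ _ (map_mx (dirsum_proj i) X).
    by rewrite -dirsum_proj_mxstar sX.
  by exists t.
have [t tP] := choice bound.
have t0 i : 0 <= t i by case: (tP i) => /ltW.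
exists (1 + \sum_i t i).
  by apply: ltr_wpDr; [apply: sumr_ge0 | exact: ltr01].
move=> i; rewrite map_mxD dirsum_proj_unit (bigD1 i) //= addrCA splitunit addrAC.
apply: mposD; first by case: (tP i).
by apply: mpos_unit; rewrite addr_ge0 ?ler01 // sumr_ge0.
Qed.

Fact dirsum_unit_archi n (X : 'M[D]_n) :
  (forall e : R, 0 < e -> dirsum_mpos ((e%:C *: dirsum_unit)%:M + X)) ->
  dirsum_mpos X.
Proof.
move=> pX i; apply: ounit_archi => e e0.
by have := pX e e0 i; rewrite map_mxD dirsum_proj_unit.
Qed.

HB.instance Definition _ := isOpSystem.Build R D
  dirsum_starD dirsum_starZ dirsum_starK dirsum_star_unit
  dirsum_mpos_star dirsum_mposD dirsum_mpos_compress
  dirsum_mpos_proper dirsum_unit_order dirsum_unit_archi.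

End DirectSum.

(* M_k as the operators on C^k: X \in M_n(M_k) is positive when it is a
   positive operator on the direct sum of n copies of C^k. *)
Definition matrix_mpos (R : realType) k n (X : 'M['M[R[i]]_k]_n) : Prop :=
  forall v : 'I_n -> 'cV[R[i]]_k,
    0 <= \sum_i \sum_j ((v i)^t* *m X i j *m v j) 0 0.

Section QuadraticForm.
Variables (R : realType) (T : finType).
Local Notation C := R[i].
Implicit Types (M : T -> T -> C) (v w : T -> C).

Let qf M v := \sum_p \sum_q (v p)^* * M p q * v q.

Lemma qf_eq0 M : (forall v, qf M v = 0) -> forall p q, M p q = 0.
Proof.
move=> qM p q.
have pol (c d : C) :
    c^* * c * M p p + c^* * d * M p q + (d^* * c * M q p + d^* * d * M q q) = 0.
  pose v (r : T) := c *+ (r == p) + d *+ (r == q).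
  have sumv (F : T -> C) : \sum_r F r * v r = F p * c + F q * d.
    under eq_bigr => r _ do rewrite /v mulrDr.
    rewrite big_split /= (bigD1 p) //= eqxx mulr1n.
    rewrite big1 ?addr0 => [|r /negPf ->]; last by rewrite mulr0n mulr0.
    rewrite (bigD1 q) //= eqxx mulr1n.
    by rewrite big1 ?addr0 // => r /negPf ->; rewrite mulr0n mulr0.
  have sumcv (F : T -> C) : \sum_r (v r)^* * F r = c^* * F p + d^* * F q.
    rewrite -[LHS]conjCK rmorph_sum /=.
    under eq_bigr => r _ do rewrite rmorphM /= conjCK mulrC.
    by rewrite sumv rmorphD !rmorphM /= !conjCK ![F _ * _]mulrC.
  rewrite -(qM v) /qf.
  under eq_bigr => r _ do (under eq_bigr => s _ do rewrite -mulrA;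
    rewrite -mulr_sumr sumv).
  rewrite sumcv; ring.
have pp : M p p = 0.
  by have := pol 1 0; rewrite rmorph1 rmorph0 !mul0r !mulr0 !mul0r !mul1r !addr0.
have qq : M q q = 0.
  by have := pol 0 1; rewrite rmorph1 rmorph0 !mul0r !mulr0 !mul0r !mul1r !add0r.
have h1 : M p q + M q p = 0.
  by have := pol 1 1; rewrite rmorph1 !mul1r pp qq add0r addr0.
have h2 : M p q - M q p = 0.
  have := pol 1 'i; rewrite rmorph1 conjCi pp qq !mul1r !mulr1 !mulr0 add0r addr0.
  by rewrite mulNr -mulrBr => /eqP; rewrite mulf_eq0 (negPf (neq0Ci _)) => /eqP.
have : M p q *+ 2 = 0.
  have -> : M p q *+ 2 = (M p q + M q p) + (M p q - M q p) by ring.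
  by rewrite h1 h2 addr0.
by move/eqP; rewrite mulrn_eq0 /= => /eqP.
Qed.

Lemma qf_bound M : exists2 t : R, 0 < t & forall v,
  `|qf M v| <= t%:C * \sum_p (v p)^* * v p.
Proof.
pose m := \sum_p \sum_q complex.Re `|M p q|.
have mE : m%:C = \sum_p \sum_q `|M p q|.
  rewrite rmorph_sum; apply: eq_bigr => p _; rewrite rmorph_sum.
  by apply: eq_bigr.
have m0 : 0 <= m.
  by rewrite -lecR mE; apply: sumr_ge0 => p _; apply: sumr_ge0.
exists (m * 2%:R * #|T|%:R + 1).
  by rewrite ltr_wpDl ?ltr01 // !mulr_ge0 // ler0n.
move=> v; pose N := \sum_p (v p)^* * v p.
have vN p : (v p)^* * v p = `|v p| ^+ 2 by rewrite mulrC -normCK.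
have N0 : 0 <= N by apply: sumr_ge0 => p _; rewrite vN exprn_ge0.
apply: (@le_trans _ _ (m%:C * 2%:R * #|T|%:R * N)); last first.
  rewrite ler_wpM2r // rmorphD !rmorphM !rmorph_nat /= rmorph1.
  by rewrite lerDl ler01.
apply: le_trans (ler_norm_sum _ _ _) _.
apply: (@le_trans _ _ (\sum_p \sum_q m%:C * (`|v p| ^+ 2 + `|v q| ^+ 2))).
  apply: ler_sum => p _; apply: le_trans (ler_norm_sum _ _ _) _.
  apply: ler_sum => q _.
  rewrite !normrM norm_conjC mulrAC mulrC; apply: ler_pM => //.
  - by rewrite mulr_ge0.
  - rewrite mE (bigD1 p) //= (bigD1 q) //= -addrA lerDl addr_ge0 //.
      by apply: sumr_ge0.
    by apply: sumr_ge0 => r _; apply: sumr_ge0.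
  - set a := `|v p|; set b := `|v q|.
    have a0 : 0 <= a by exact: normr_ge0.
    have b0 : 0 <= b by exact: normr_ge0.
    rewrite -subr_ge0; have -> : a ^+ 2 + b ^+ 2 - a * b = a * b + (a - b) ^+ 2.
      by ring.
    apply: addr_ge0; first exact: mulr_ge0.
    by rewrite real_exprn_even_ge0 // rpredB // ger0_real.
under eq_bigr => p _ do rewrite -mulr_sumr big_split /= sumr_const.
rewrite -mulr_sumr big_split /= sumr_const.
have -> : \sum_i `|v i| ^+ 2 = N by apply: eq_bigr => p _; rewrite vN.
rewrite sumrMnl.
have -> : \sum_i `|v i| ^+ 2 = N by apply: eq_bigr => p _; rewrite vN.
by rewrite -mulrnDl -mulr2n -!mulrA ler_wpM2l ?ler0c // -!mulrnA -[N *+ _]mulr_natl natrM !mulrA lexx.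
Qed.

End QuadraticForm.

Section MatrixAlgebra.
Variables (R : realType) (k : nat).
Local Notation C := R[i].
Local Notation Mk := 'M[C]_k.
Implicit Types (A B : Mk) (u w : 'cV[C]_k) (n : nat).

Let sw A u w : C := (u^t* *m A *m w) 0 0.
Let mq n (X : 'M[Mk]_n) (v : 'I_n -> 'cV[C]_k) : C :=
  \sum_i \sum_j sw (X i j) (v i) (v j).

Let swE A u w : sw A u w = \sum_a \sum_b (u a 0)^* * A a b * w b 0.
Proof.
rewrite /sw mxE exchange_big /=; apply: eq_bigr => b _.
by rewrite mxE mulr_suml; apply: eq_bigr => a _; rewrite !mxE.
Qed.

Let swD A B u w : sw (A + B) u w = sw A u w + sw B u w.
Proof. by rewrite /sw mulmxDr mulmxDl mxE. Qed.

Let swZ c A u w : sw (c *: A) u w = c * sw A u w.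
Proof. by rewrite /sw -scalemxAr -scalemxAl mxE. Qed.

Let sw0 u w : sw 0 u w = 0.
Proof. by rewrite /sw mulmx0 mul0mx mxE. Qed.

Let sw_star A u w : sw (A^t*) u w = (sw A w u)^*.
Proof.
rewrite !swE rmorph_sum exchange_big; apply: eq_bigr => b _.
rewrite /= rmorph_sum; apply: eq_bigr => a _.
by rewrite !mxE !rmorphM /= conjCK; ring.
Qed.

Let mqE n (X : 'M[Mk]_n) v : mq X v =
  \sum_p \sum_q ((v p.1 p.2 0)^* * X p.1 q.1 p.2 q.2 * v q.1 q.2 0).
Proof.
rewrite -(pair_bigA _ (fun i a => \sum_q ((v i a 0)^* * X i q.1 a q.2 * v q.1 q.2 0))).
apply: eq_bigr => i _ /=; under [RHS]eq_bigr => a _.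
  rewrite -(pair_bigA _ (fun j b => (v i a 0)^* * X i j a b * v j b 0)) /=; over.
by rewrite exchange_big; apply: eq_bigr => j _; rewrite swE.
Qed.

Let mqD n (X Y : 'M[Mk]_n) v : mq (X + Y) v = mq X v + mq Y v.
Proof.
rewrite /mq -big_split; apply: eq_bigr => i _.
by rewrite -big_split; apply: eq_bigr => j _; rewrite mxE swD.
Qed.

Let mq_star n (X : 'M[Mk]_n) v :
  mq (mxstar (fun A => A^t*) X) v = (mq X v)^*.
Proof.
rewrite /mq rmorph_sum exchange_big; apply: eq_bigr => j _.
by rewrite rmorph_sum; apply: eq_bigr => i _; rewrite mxE sw_star.
Qed.

Let mq_unit n (t : C) v : mq ((t *: 1%:M)%:M : 'M[Mk]_n) v =
  t * \sum_p ((v p.1 p.2 0)^* * v p.1 p.2 0).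
Proof.
rewrite -(pair_bigA _ (fun i a => (v i a 0)^* * v i a 0)) mulr_sumr.
apply: eq_bigr => i _; rewrite (bigD1 i) //= mxE eqxx mulr1n.
rewrite big1 ?addr0 => [|j ji]; last by rewrite mxE eq_sym (negPf ji) sw0.
rewrite swZ /sw mulmx1 mxE; congr (_ * _).
by apply: eq_bigr => a _; rewrite !mxE.
Qed.

Let mq_eq0 n (X : 'M[Mk]_n) : (forall v, mq X v = 0) -> X = 0.
Proof.
move=> X0; apply/matrixP => i j; apply/matrixP => a b; rewrite !mxE.
apply: (@qf_eq0 R _ (fun p q : 'I_n * 'I_k => X p.1 q.1 p.2 q.2) _ (i, a) (j, b)).
move=> v; have := X0 (fun i => \col_a v (i, a)); rewrite mqE => E.
rewrite -[RHS]E; apply: eq_bigr => -[i1 a1] _; apply: eq_bigr => -[j1 b1] _.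
by rewrite !mxE.
Qed.

Let mq_ext n (X Y : 'M[Mk]_n) : (forall v, mq X v = mq Y v) -> X = Y.
Proof.
move=> XY; apply/eqP; rewrite -subr_eq0; apply/eqP/mq_eq0 => v.
have := XY v; rewrite -{1}(subrK Y X) mqD => /(canRL (addrK _)).
by rewrite subrr.
Qed.

Let sw_suml (I : finType) A (F : I -> 'cV[C]_k) (c : I -> C) w :
  sw A (\sum_i c i *: F i) w = \sum_i (c i)^* * sw A (F i) w.
Proof.
rewrite swE.
have -> : \sum_i (c i)^* * sw A (F i) w = \sum_i \sum_a \sum_b
    (c i)^* * ((F i a 0)^* * A a b * w b 0).
  by apply: eq_bigr => i _; rewrite swE mulr_sumr; apply: eq_bigr => a _; rewrite mulr_sumr.
rewrite [RHS]exchange_big; apply: eq_bigr => a _ /=.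
rewrite [RHS]exchange_big; apply: eq_bigr => b _ /=; rewrite summxE rmorph_sum !mulr_suml.
by apply: eq_bigr => i _; rewrite mxE rmorphM; ring.
Qed.

Let sw_sumr (I : finType) A (F : I -> 'cV[C]_k) (c : I -> C) u :
  sw A u (\sum_i c i *: F i) = \sum_i c i * sw A u (F i).
Proof.
rewrite /sw mulmx_sumr summxE; apply: eq_bigr => i _.
by rewrite -scalemxAr mxE.
Qed.

Let sw_sum (I : finType) (F : I -> Mk) u w :
  sw (\sum_i F i) u w = \sum_i sw (F i) u w.
Proof. by rewrite /sw mulmx_sumr mulmx_suml summxE. Qed.

Let mq_compress m n (A : 'M[C]_(n, m)) (X : 'M[Mk]_n) v :
  mq (mxcompress A X) v = mq X (fun h => \sum_i A h i *: v i).
Proof.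
transitivity (\sum_i \sum_j \sum_h \sum_l
    (A h i)^* * A l j * sw (X h l) (v i) (v j)).
  apply: eq_bigr => i _; apply: eq_bigr => j _; rewrite mxE sw_sum.
  by apply: eq_bigr => h _; rewrite sw_sum; apply: eq_bigr => l _; rewrite swZ.
under eq_bigr => i _ do rewrite exchange_big /=.
rewrite exchange_big; apply: eq_bigr => h _ /=.
under eq_bigr => i _ do rewrite exchange_big /=.
rewrite exchange_big; apply: eq_bigr => l _ /=.
rewrite sw_suml; apply: eq_bigr => i _; rewrite sw_sumr mulr_sumr.
by apply: eq_bigr => j _; rewrite mulrA.
Qed.

Let star A : Mk := A^t*.

Fact matrix_starD : {morph star : A B / A + B}.
Proof. by move=> A B; apply/matrixP => i j; rewrite !mxE rmorphD. Qed.
Fact matrix_starZ (a : C) A : star (a *: A) = a^* *: star A.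
Proof. by apply/matrixP => i j; rewrite !mxE rmorphM. Qed.
Fact matrix_starK : involutive star.
Proof. exact: trmxCK. Qed.
Fact matrix_star_unit : star 1%:M = 1%:M.
Proof. by apply/matrixP => i j; rewrite !mxE eq_sym conjC_nat. Qed.

Fact matrix_mpos_star n (X : 'M[Mk]_n) : matrix_mpos X -> mxstar star X = X.
Proof.
move=> pX; apply: mq_ext => v; rewrite mq_star.
by apply: conj_Creal; apply: ger0_real; exact: pX.
Qed.

Fact matrix_mposD n (X Y : 'M[Mk]_n) :
  matrix_mpos X -> matrix_mpos Y -> matrix_mpos (X + Y).
Proof. by move=> pX pY v; rewrite -/(mq _ v) mqD addr_ge0 ?pX ?pY. Qed.

Fact matrix_mpos_compress m n (A : 'M[C]_(n, m)) (X : 'M[Mk]_n) :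
  matrix_mpos X -> matrix_mpos (mxcompress A X).
Proof. by move=> pX v; rewrite -/(mq _ v) mq_compress; exact: pX. Qed.

Let mqN n (X : 'M[Mk]_n) v : mq (- X) v = - mq X v.
Proof.
apply/eqP; rewrite -addr_eq0 -mqD addNr; apply/eqP.
by apply: big1 => i _; apply: big1 => j _; rewrite mxE sw0.
Qed.

Fact matrix_mpos_proper n (X : 'M[Mk]_n) :
  matrix_mpos X -> matrix_mpos (- X) -> X = 0.
Proof.
move=> pX nX; apply: mq_eq0 => v; apply/eqP; rewrite eq_le [0 <= _]pX andbT.
by have := nX v; rewrite -/(mq _ v) mqN oppr_ge0.
Qed.

Fact matrix_unit_order n (X : 'M[Mk]_n) : mxstar star X = X ->
  exists2 t : R, 0 < t & matrix_mpos ((t%:C *: 1%:M)%:M + X).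
Proof.
move=> sX; have [t t0 qt] :=
  @qf_bound R _ (fun p q : 'I_n * 'I_k => X p.1 q.1 p.2 q.2).
exists t => // v; rewrite -/(mq _ v) mqD mq_unit.
have Xr : mq X v \is Num.real by apply/CrealP; rewrite -mq_star sX.
rewrite addrC -[_ * _]opprK subr_ge0 lerNl.
have := qt (fun p => v p.1 p.2 0); rewrite -mqE.
by apply: le_trans; rewrite -normrN real_ler_norm // rpredN.
Qed.

Fact matrix_unit_archi n (X : 'M[Mk]_n) :
  (forall e : R, 0 < e -> matrix_mpos ((e%:C *: 1%:M)%:M + X)) ->
  matrix_mpos X.
Proof.
move=> pX v; pose N : C := \sum_p ((v p.1 p.2 0)^* * v p.1 p.2 0).
have N0 : 0 <= N by apply: sumr_ge0 => p _; rewrite mulrC mul_conjC_ge0.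
have qe (e : R) : 0 < e -> 0 <= e%:C * N + mq X v.
  by move=> e0; have := pX e e0 v; rewrite -/(mq _ v) mqD mq_unit.
rewrite -/(mq X v); case: (mq X v) qe => a b qe.
have /complex_realP [r Nr] : N \is Num.real by exact: ger0_real.
have r0 : 0 <= r by rewrite -lecR -Nr.
rewrite Nr in qe.
have E (e : R) : e%:C * r%:C + (a +i* b) = (e * r + a) +i* b.
  by rewrite -rmorphM /=; simpc.
have := qe 1 ltr01; rewrite E lecE /= => /andP[b0 _].
rewrite lecE /= b0 /=; apply/ler_addgt0Pl => e e0.
have e1 : 0 < e / (r + 1) by rewrite divr_gt0 // ltr_wpDl.
have := qe _ e1; rewrite E lecE /= => /andP[_] /le_trans; apply.
rewrite lerD2r mulrAC ler_pdivrMr ?ltr_wpDl //.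
by rewrite ler_wpM2l ?ltW // ltrDl ltr01.
Qed.

HB.instance Definition _ := isOpSystem.Build R 'M[C]_k
  matrix_starD matrix_starZ matrix_starK matrix_star_unit
  matrix_mpos_star matrix_mposD matrix_mpos_compress
  matrix_mpos_proper matrix_unit_order matrix_unit_archi.

End MatrixAlgebra.

(* Main.v *)
(* If E is a sum of matrix algebras, a completely positive map on a block is a
   positive Choi matrix over S/J; it lifts to a self-adjoint matrix over S that is
   positive up to an arbitrarily small multiple of the unit, and this multiple is
   absorbed by eps omega since the density matrix of omega is positive definite.

   Conversely, let S be the system of eventually scalar sequences of matrices.
   Choosing for the n-th entry the Choi map of the n-th element of a dense
   sequence of positive matrices over E, scaled to be summable, one presents E as
   a quotient of S. Lifting the identity of E shows that id + eps omega 1 factors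
   as Ps o Th, with Th and Ps completely positive, through the algebra S, in which
   h = Th 1 can be made invertible. In the limit eps -> 0, taken along an
   ultrafilter, x y := lim Ps (Th x h^-1 Th y) is a product on E, and
   lim Ps (b^* h^-1 b) - (lim Ps b)^* (lim Ps b) >= 0 vanishes at b = Th x, so that
   Cauchy-Schwarz gives lim Ps (Th x h^-1 b) = x (lim Ps b) and hence
   associativity (the Choi-Effros argument). As W^* X W stays positive for
   positive X, it remains to decompose the finite-dimensional algebra E: an
   orthonormal basis x_a of a minimal left ideal gives matrix units x_a x_b^*, and
   sum_a x_a x_a^* is a central projection. *)
Require Import Defs.
From HB Require Import structures.
From mathcomp Require Import all_boot all_order all_algebra.
From mathcomp Require Import complex boolp classical_sets reals filter topology.
From mathcomp Require Import normedtype ring lra.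

Set Implicit Arguments.
Unset Strict Implicit.
Unset Printing Implicit Defensive.

Import Order.TTheory GRing.Theory Num.Theory.
Import numFieldNormedType.Exports.

Local Open Scope classical_set_scope.
Local Open Scope sesquilinear_scope.
Local Open Scope complex_scope.
Local Open Scope ring_scope.

(** * Positive matrices and Choi maps *)

(** The hypothesis only lifts maps into quotients, so E itself has to be written as S/J with S an
    algebra. Positivity in M_n(S/J) asks for lifts up to every eps > 0; hence it is enough that Psi
    lifts a countable set of positive matrices exactly, those with rational coefficients, while the
    remaining error is sent through a linear section of Psi. As operator systems need not be
    complete, S can consist of eventually scalar sequences, for which all sums are finite; the
    scalar tail is what makes Psi unital.

    The perturbed lift is not unital, and h = Th 1 is bounded below only by a multiple of eps. This
    is why the product is twisted by h^-1 and why sequences are bounded in terms of h and not of the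
    unit of S. Boundedness and limits are expressed by positivity of 2x2 matrices; limits exist
    because this order norm controls coordinates in a finite dimensional E. *)

Section Positivity.
Variable R : realType.
Local Notation C := R[i].

Lemma matrix_mposE k n (X : 'M['M[C]_k]_n) : mpos X = matrix_mpos X.
Proof. by []. Qed.

Lemma matrix_ostarE k (A : 'M[C]_k) : ostar A = A^t*.
Proof. by []. Qed.

Lemma matrix_ounitE k : ounit = 1%:M :> 'M[C]_k.
Proof. by []. Qed.

Lemma matrix_mposP k n (X : 'M['M[C]_k]_n) : mpos X <->
  forall v : 'I_n * 'I_k -> C,
    0 <= \sum_p \sum_q (v p)^* * X p.1 q.1 p.2 q.2 * v q.
Proof.
have E (v : 'I_n -> 'cV[C]_k) :
    \sum_i \sum_j ((v i)^t* *m X i j *m v j) 0 0 =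
    \sum_(p : 'I_n * 'I_k) \sum_(q : 'I_n * 'I_k)
      (v p.1 p.2 0)^* * X p.1 q.1 p.2 q.2 * v q.1 q.2 0.
  rewrite -(pair_bigA _ (fun i a => \sum_(q : 'I_n * 'I_k)
    (v i a 0)^* * X i q.1 a q.2 * v q.1 q.2 0)) /=.
  apply: eq_bigr => i _; under [RHS]eq_bigr => a _ do
    rewrite -(pair_bigA _ (fun j b => (v i a 0)^* * X i j a b * v j b 0)) /=.
  rewrite exchange_big /=; apply: eq_bigr => j _.
  rewrite mxE [RHS]exchange_big /=; apply: eq_bigr => b _.
  by rewrite mxE mulr_suml; apply: eq_bigr => a _; rewrite !mxE.
rewrite matrix_mposE; split=> pX v.
  have := pX (fun i => \col_a v (i, a)); rewrite E; congr (0 <= _).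
  by apply: eq_bigr => -[i a] _; apply: eq_bigr => -[j b] _; rewrite !mxE.
by rewrite E; exact: (pX (fun p => v p.1 p.2 0)).
Qed.

Lemma diag_mx_form k (d : 'rV[C]_k) (w : 'cV[C]_k) :
  (w^t* *m diag_mx d *m w) 0 0 = \sum_j d 0 j * `|w j 0| ^+ 2.
Proof.
rewrite mul_mx_diag mxE; apply: eq_bigr => j _; rewrite !mxE.
by rewrite mulrAC mulrC normCKC.
Qed.

(** Each eigenvalue is returned as a value of the form at a nonzero vector, so that nonnegativity
    and strict positivity of the form both pass to the spectrum. *)
Lemma psd_spectral k (A : 'M[C]_k) :
  (forall v : 'cV[C]_k, 0 <= (v^t* *m A *m v) 0 0) ->
  exists (P : 'M[C]_k) (d : 'rV[C]_k),
    [/\ P *m P^t* = 1%:M, A = P^t* *m diag_mx d *m P &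
     forall j, exists2 v : 'cV[C]_k, v != 0 & d 0 j = (v^t* *m A *m v) 0 0].
Proof.
move=> pA.
have hA : A^t* = A.
  have A11 : (A%:M : 'M['M[C]_k]_1) 0 0 = A by rewrite mxE eqxx.
  have pA1 : mpos (A%:M : 'M['M[C]_k]_1).
    by rewrite matrix_mposE => v; rewrite !big_ord1 A11; exact: pA.
  by have /matrixP/(_ 0 0) := mpos_star pA1; rewrite mxE A11 matrix_ostarE.
have /orthomx_spectralP : A \is normalmx by apply/normalmxP; rewrite hA.
set P := spectralmx A; set d := spectral_diag A.
have uP : P \is unitarymx := spectral_unitarymx A.
rewrite invmx_unitary // => AE.
have PP := unitarymxP uP; exists P, d; split=> // j.
exists (P^t* *m delta_mx j 0).
  apply/negP => /eqP /(congr1 (mulmx P)); rewrite mulmx0 mulmxA PP mul1mx.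
  by move=> /matrixP/(_ j 0); rewrite !mxE !eqxx => /eqP; rewrite oner_eq0.
rewrite [in RHS]AE trmx_mul map_mxM trmxCK -!mulmxA [P *m (P^t* *m _)]mulmxA PP.
rewrite mul1mx [P *m (P^t* *m _)]mulmxA PP mul1mx mulmxA diag_mx_form.
rewrite (bigD1 j) //= big1 ?addr0 => [|i /negPf ij]; last first.
  by rewrite mxE ij normr0 expr0n mulr0.
by rewrite mxE !eqxx normr1 expr1n mulr1.
Qed.

Lemma psd_mx_factor k (A : 'M[C]_k) :
  (forall v : 'cV[C]_k, 0 <= (v^t* *m A *m v) 0 0) ->
  exists B : 'M[C]_k, A = B^t* *m B.
Proof.
move=> pA; have [P [d [_ AE dE]]] := psd_spectral pA.
exists (diag_mx (map_mx sqrtC d) *m P).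
rewrite trmx_mul map_mxM tr_diag_mx map_diag_mx -!mulmxA [diag_mx _ *m (_ *m P)]mulmxA.
rewrite mulmx_diag [LHS]AE -mulmxA; congr (_ *m (diag_mx _ *m _)).
have d0 j : 0 <= d 0 j by have [v _ ->] := dE j.
apply/rowP => j; rewrite !mxE /= conj_Creal ?ger0_real ?sqrtC_ge0 //.
by rewrite -expr2 sqrtCK.
Qed.

Lemma psd_factor (T : finType) (M : T -> T -> C) :
  (forall v : T -> C, 0 <= \sum_p \sum_q (v p)^* * M p q * v q) ->
  exists B : T -> T -> C, forall p q, M p q = \sum_r (B r p)^* * B r q.
Proof.
move=> pM; pose A := \matrix_(i < #|T|, j < #|T|) M (enum_val i) (enum_val j).
have [v|B AE] := @psd_mx_factor _ A.
  have := pM (fun p => v (enum_rank p) 0); congr (0 <= _).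
  rewrite mxE (reindex _ (onW_bij _ (@enum_val_bij T))) /=.
  under eq_bigr => i _ do
    rewrite (reindex _ (onW_bij _ (@enum_val_bij T))) /=.
  rewrite exchange_big /=; apply: eq_bigr => j _; rewrite mxE mulr_suml.
  by apply: eq_bigr => i _; rewrite !mxE !enum_valK.
exists (fun r p => B (enum_rank r) (enum_rank p)) => p q.
have /matrixP/(_ (enum_rank p) (enum_rank q)) := AE; rewrite mxE !enum_rankK => ->.
rewrite mxE (reindex _ (onW_bij _ (@enum_rank_bij T))) /=.
by apply: eq_bigr => r _; rewrite !mxE.
Qed.

Variable V : opSystemType R.

(** The linear map M_k -> V with Choi matrix [Y]: it sends the matrix unit E_ab to [Y a b]. *)
Definition choi k (Y : 'M[V]_k) (A : 'M[C]_k) : V :=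
  \sum_a \sum_b A a b *: Y a b.

Fact choi_is_linear k (Y : 'M[V]_k) : linear (choi Y).
Proof.
move=> c A B; rewrite /choi scaler_sumr -big_split; apply: eq_bigr => a _.
rewrite scaler_sumr -big_split; apply: eq_bigr => b _.
by rewrite !mxE scalerDl scalerA.
Qed.

HB.instance Definition _ k (Y : 'M[V]_k) :=
  GRing.isLinear.Build C 'M[C]_k V *:%R (choi Y) (choi_is_linear Y).

Lemma choiDr k (Y Z : 'M[V]_k) A : choi (Y + Z) A = choi Y A + choi Z A.
Proof.
rewrite /choi -big_split; apply: eq_bigr => a _; rewrite -big_split.
by apply: eq_bigr => b _; rewrite mxE scalerDr.
Qed.

Lemma choi_delta k (Y : 'M[V]_k) a b : choi Y (delta_mx a b) = Y a b.
Proof.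
rewrite /choi (bigD1 a) //= (bigD1 b) //= !mxE !eqxx scale1r.
rewrite big1 ?addr0 => [|j /negPf jb]; last by rewrite mxE jb andbF scale0r.
rewrite big1 ?addr0 // => i /negPf ia.
by apply: big1 => j _; rewrite mxE ia scale0r.
Qed.

(* A positive X in M_n(M_k) is a sum of rank-one Gram matrices, and each of
   them turns the Choi matrix into one of its compressions. *)
Lemma choi_cp k (Y : 'M[V]_k) : mpos Y -> completely_positive (choi Y).
Proof.
move=> pY n X /matrix_mposP pX.
have [B XE] := @psd_factor _ (fun p q : 'I_n * 'I_k => X p.1 q.1 p.2 q.2) pX.
have -> : map_mx (choi Y) X =
    \sum_r mxcompress (\matrix_(a, i) B r (i, a)) Y.
  apply/matrixP => i j; rewrite mxE summxE /choi.
  under [RHS]eq_bigr => r _ do rewrite mxE.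
  rewrite [RHS]exchange_big; apply: eq_bigr => a _ /=.
  rewrite [RHS]exchange_big; apply: eq_bigr => b _ /=.
  rewrite (XE (i, a) (j, b)) scaler_suml; apply: eq_bigr => r _.
  by rewrite !mxE.
by apply: mpos_sum => r _; apply: mpos_compress.
Qed.

(** For A = B^* B, the matrix A (x) 1 is the compression of I (x) 1 by B. *)
Lemma psd_unit_mpos k (A : 'M[C]_k) :
  (forall v : 'cV[C]_k, 0 <= (v^t* *m A *m v) 0 0) ->
  mpos (map_mx ( *:%R^~ (ounit : V)) A).
Proof.
move=> /psd_mx_factor [B ->].
have := mpos_compress B (mpos_unit V k ler01); congr mpos.
apply/matrixP => i j; rewrite !mxE scaler_suml; apply: eq_bigr => r _.
rewrite (bigD1 r) //= big1 ?addr0 => [|l lr]; last first.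
  by rewrite !mxE eq_sym (negPf lr) mulr0n scaler0.
by rewrite !mxE eqxx mulr1n scale1r.
Qed.

Lemma psd_gap k (A : 'M[C]_k) :
  (forall v : 'cV[C]_k, v != 0 -> 0 < (v^t* *m A *m v) 0 0) ->
  exists2 d : R, 0 < d &
    forall v : 'cV[C]_k, 0 <= (v^t* *m (A - (d%:C)%:M) *m v) 0 0.
Proof.
move=> pA.
have [|P [d [PP AE dE]]] := @psd_spectral _ A.
  move=> v; have [->|v0] := eqVneq v 0; last exact/ltW/pA.
  by rewrite mulmx0 mxE.
have iP : P^t* *m P = 1%:M by exact: mulmx1C.
have d0 j : 0 < d 0 j by have [v v0 ->] := dE j; exact: pA.
have Re_d j : (complex.Re (d 0 j))%:C = d 0 j.
  by have /complex_realP[r ->] := gtr0_real (d0 j).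
(* [e] is at most the least eigenvalue; the default 1 keeps it positive when k = 0. *)
pose e := \big[Num.min/1]_j complex.Re (d 0 j).
have ed j : e%:C <= d 0 j by rewrite -Re_d lecR; exact: bigmin_le_cond.
exists e.
  rewrite /e; apply: (big_ind (fun x : R => is_true (0 < x))) => [|x y x0 y0|j _] //.
    by rewrite lt_min x0.
  by rewrite -ltcR Re_d.
move=> v; pose w := P *m v.
have -> : A - (e%:C)%:M = P^t* *m (diag_mx d - (e%:C)%:M) *m P.
  rewrite mulmxBr mulmxBl [in LHS]AE; congr (_ - _).
  by rewrite -mulmxA mul_scalar_mx -scalemxAr iP scalemx1.
have -> : v^t* *m (P^t* *m (diag_mx d - (e%:C)%:M) *m P) *m v =
    w^t* *m (diag_mx d - (e%:C)%:M) *m w.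
  by rewrite /w trmx_mul map_mxM !mulmxA.
have -> : diag_mx d - (e%:C)%:M = diag_mx (d - const_mx e%:C).
  by rewrite raddfB /= diag_const_mx.
rewrite diag_mx_form; apply: sumr_ge0 => j _.
by rewrite !mxE mulr_ge0 ?subr_ge0 // exprn_ge0.
Qed.

End Positivity.

(** * Lifting from a direct sum of matrix algebras *)

Section Lifting.
Variable R : realType.
Local Notation C := R[i].

(** This is the Choi matrix of the identity of M_k; its quadratic form at v is |sum_i v_i(i)|^2. *)
Lemma delta_mx_mpos k :
  mpos (\matrix_(a, b) delta_mx a b : 'M['M[C]_k]_k).
Proof.
rewrite matrix_mposE => v.
have -> : \sum_i \sum_j ((v i)^t* *m (\matrix_(a, b) delta_mx a b :
    'M['M[C]_k]_k) i j *m v j) 0 0 = (\sum_i v i i 0)^* * \sum_j v j j 0.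
  rewrite rmorph_sum mulr_suml; apply: eq_bigr => i _.
  rewrite mulr_sumr; apply: eq_bigr => j _; rewrite mxE.
  rewrite mxE (bigD1 j) //= big1 ?addr0 => [|l /negPf lj].
    rewrite mxE (bigD1 i) //= big1 ?addr0 => [|l /negPf li].
      by rewrite !mxE !eqxx mulr1.
    by rewrite !mxE li mulr0.
  by rewrite mxE big1 ?mul0r // => p _; rewrite !mxE lj andbF mulr0.
by rewrite mulrC mul_conjC_ge0.
Qed.

Lemma mpos1E (V : opSystemType R) (X : 'M[V]_1) : mpos X <-> positive (X 0 0).
Proof.
rewrite /positive; suff -> : X = (X 0 0)%:M :> 'M_1 by rewrite mxE.
by apply/matrixP => i j; rewrite !ord1 mxE eqxx.
Qed.

(** Quadratic forms of [map_mx omega X] become values of omega at compressions of X, which turns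
    positivity or faithfulness of omega into definiteness of matrices. *)
Lemma functional_form (V : opSystemType R) (omega : {scalar V}) n (X : 'M[V]_n)
    (v : 'cV[C]_n) :
  (v^t* *m map_mx omega X *m v) 0 0 = omega (mxcompress v X 0 0).
Proof.
rewrite [mxcompress _ _ _ _]mxE linear_sum mxE /=.
under [RHS]eq_bigr => a _ do rewrite linear_sum /=.
rewrite [RHS]exchange_big; apply: eq_bigr => b _ /=.
rewrite mxE mulr_suml; apply: eq_bigr => a _.
by rewrite linearZ !mxE /=; ring.
Qed.

Lemma mpos_add_unit_star (V : opSystemType R) n (t : R) (X : 'M[V]_n) :
  0 <= t -> mpos ((t%:C *: ounit)%:M + X) -> mxstar ostar X = X.
Proof.
move=> t0 /mpos_star/matrixP E; have /matrixP E1 := mpos_star (mpos_unit V n t0).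
apply/matrixP => i j; have := E i j; have := E1 i j.
by rewrite !mxE ostarD => ->; apply: addrI.
Qed.

Lemma choi_star (V : opSystemType R) k (Y : 'M[V]_k) A :
  mxstar ostar Y = Y -> choi Y (A^t*) = ostar (choi Y A).
Proof.
move=> /matrixP sY; rewrite /choi ostar_sum exchange_big; apply: eq_bigr => b _.
rewrite ostar_sum; apply: eq_bigr => a _.
by rewrite ostarZ !mxE -sY mxE.
Qed.

Variables (n : nat) (k : 'I_n -> nat).
Local Notation D := (dirsum (fun j => 'M[C]_(k j) : opSystemType R)).

(** The indices are compared as natural numbers because [p] and [a] have different types until i = j
    is known. *)
Definition dirsum_unit_mx j (a b : 'I_(k j)) : D :=
  dirsum_of (V := fun j => 'M[C]_(k j) : opSystemType R)
    (fun i => \matrix_(p, q)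
      ((i == j) && (p == a :> nat) && (q == b :> nat))%:R).

Lemma dirsum_unit_mx_diag j (a b : 'I_(k j)) :
  dirsum_proj j (dirsum_unit_mx a b) = delta_mx a b.
Proof. by rewrite /dirsum_proj ffunE; apply/matrixP => p q; rewrite !mxE eqxx. Qed.

Lemma dirsum_unit_mx_off i j (a b : 'I_(k j)) : i != j ->
  dirsum_proj i (dirsum_unit_mx a b) = 0.
Proof.
move=> /negPf ij; rewrite /dirsum_proj ffunE; apply/matrixP => p q.
by rewrite !mxE ij.
Qed.

Lemma dirsum_unit_mx_mpos j : mpos (\matrix_(a, b) dirsum_unit_mx a b : 'M[D]_(k j)).
Proof.
move=> i; have [->|ij] := eqVneq i j.
  have := @delta_mx_mpos (k j); congr mpos.
  by apply/matrixP => a b; rewrite !mxE dirsum_unit_mx_diag.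
have := @mpos0 R ('M[C]_(k i) : opSystemType R) (k j); congr mpos.
by apply/matrixP => a b; rewrite !mxE dirsum_unit_mx_off.
Qed.

Lemma dirsum_expand (x : D) :
  x = \sum_j choi (\matrix_(a, b) dirsum_unit_mx a b) (dirsum_proj j x).
Proof.
apply: dirsumP => i; rewrite -[LHS]/(dirsum_proj i x) -[RHS]/(dirsum_proj i _).
rewrite linear_sum (bigD1 i) //= big1 ?addr0 => [|j ij]; last first.
  rewrite /choi linear_sum big1 // => a _; rewrite linear_sum big1 // => b _.
  by rewrite linearZ mxE /= dirsum_unit_mx_off ?scaler0 // eq_sym.
rewrite /choi linear_sum [LHS]matrix_sum_delta; apply: eq_bigr => a _.
rewrite linear_sum; apply: eq_bigr => b _.
by rewrite linearZ mxE /= dirsum_unit_mx_diag.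
Qed.

Variables (E : finOpSystemType R) (omega : {scalar E}).
Hypotheses (omega_faithful : faithful omega).
Variables (f : {linear E -> D}) (g : {linear D -> E}).
Hypotheses (fK : cancel f g) (gK : cancel g f).
Hypotheses (f_cp : completely_positive f) (g_cp : completely_positive g).

Let U j : 'M[E]_(k j) := \matrix_(a, b) g (dirsum_unit_mx a b).

Let U_mpos j : mpos (U j).
Proof.
have := g_cp (@dirsum_unit_mx_mpos j); congr mpos.
by apply/matrixP => a b; rewrite !mxE.
Qed.

Let expand x : x = \sum_j choi (U j) (dirsum_proj j (f x)).
Proof.
rewrite -{1}[x]fK {1}[f x]dirsum_expand linear_sum; apply: eq_bigr => j _.
rewrite /choi linear_sum; apply: eq_bigr => a _; rewrite linear_sum.
by apply: eq_bigr => b _; rewrite linearZ !mxE.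
Qed.

Let rho j : 'M[C]_(k j) := map_mx omega (U j).

(** The value is omega y for the compression y of [U j] by v. Block j of f y is a rank-one matrix
    with diagonal entries |v_a|^2, so y is nonzero with v and faithfulness applies. *)
Let rho_pos j (v : 'cV[C]_(k j)) : v != 0 -> 0 < (v^t* *m rho j *m v) 0 0.
Proof.
move=> v0; pose y := mxcompress v (U j) 0 0.
rewrite functional_form -/y.
apply: omega_faithful; first by rewrite -mpos1E; exact: mpos_compress.
apply: contra v0 => /eqP y0; apply/eqP/matrixP => a c; rewrite ord1 {c}.
have : \sum_p \sum_q ((v p 0)^* * v q 0) *: delta_mx p q = 0 :> 'M[C]_(k j).
  transitivity (dirsum_proj j (f y)); last by rewrite y0 !linear0.
  rewrite /y [mxcompress _ _ _ _]mxE !linear_sum; apply: eq_bigr => p _.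
  rewrite !linear_sum; apply: eq_bigr => q _.
  by rewrite !linearZ mxE /= gK dirsum_unit_mx_diag.
move=> /matrixP/(_ a a); rewrite [RHS]mxE.
rewrite summxE (bigD1 a) //= [X in _ + X]big1 ?addr0 => [|p /negPf pa]; last first.
  by rewrite summxE big1 // => q _; rewrite !mxE eq_sym pa mulr0.
rewrite summxE (bigD1 a) //= [X in _ + X]big1 ?addr0 => [|q /negPf qa]; last first.
  by rewrite !mxE [a == q]eq_sym qa andbF mulr0.
rewrite !mxE !eqxx mulr1 => /eqP; rewrite mulf_eq0 conjC_eq0 orbb.
by move/eqP.
Qed.

Lemma dirsum_lifting (S : opSystemType R) (J : kernel S) (eps : R)
    (phi : {linear E -> quotient_sys J}) :
  0 < eps -> completely_positive phi ->
  exists lift : {linear E -> S},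
    [/\ star_preserving lift,
        forall x, quotient_map J (lift x) = phi x
      & completely_positive
          (fun x => lift x + eps%:C *: unit_map S omega x)].
Proof.
move=> e0 phi_cp.
have blk j : exists Y : 'M[S]_(k j),
    [/\ mxstar ostar Y = Y, map_mx (quotient_map J) Y = map_mx phi (U j)
      & mpos (Y + map_mx ( *:%R^~ ounit) (eps%:C *: rho j))].
  have [d d0 gap] := psd_gap (@rho_pos j).
  have ed0 : 0 < eps * d by rewrite mulr_gt0.
  (* The slack granted by the quotient cone is taken to be eps d, where rho_j - d >= 0: adding eps
     (rho_j - d) (x) 1 cancels it and leaves the lift plus eps rho_j (x) 1. *)
  have [X XE /(_ _ ed0)[K KJ pK]] := phi_cp _ _ (U_mpos j).
  exists (X + K); split; first exact: mpos_add_unit_star (ltW ed0) pK.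
    rewrite XE; apply/map_quotient_mxP => a b.
    by rewrite addrAC subrr add0r.
  have := mposD pK (mpos_scale (ltW e0) (psd_unit_mpos S gap)); congr mpos.
  apply/matrixP => a b; rewrite !mxE rmorphM /=.
  rewrite [X in X + _ = _]addrC -[LHS]addrA; congr (_ + _).
  by rewrite scalerA mulrBr scalerBl mulrnAr scalerMnl addrC subrK.
pose Y j := projT1 (cid (blk j)); have YP j := projT2 (cid (blk j)).
pose l x := \sum_j choi (Y j) (dirsum_proj j (f x)).
have l_lin : linear l.
  move=> a x y; rewrite /l scaler_sumr -big_split; apply: eq_bigr => j _.
  by rewrite !linearP.
pose L : {linear E -> S} := HB.pack l (GRing.isLinear.Build C E S *:%R l l_lin).
exists L; split=> [x|x|m X pX].
- rewrite /= /l ostar_sum; apply: eq_bigr => j _.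
  have [sY _ _] := YP j; rewrite -choi_star // (cp_star_preserving f_cp).
  by congr choi; rewrite /dirsum_proj ffunE.
- rewrite [in RHS](expand x) [RHS]linear_sum [LHS]linear_sum; apply: eq_bigr => j _.
  have [_ /matrixP YE _] := YP j; rewrite /choi !linear_sum.
  apply: eq_bigr => a _; rewrite !linear_sum; apply: eq_bigr => b _.
  by rewrite [LHS]linearZ [RHS]linearZ /=; have := YE a b; rewrite !mxE => ->.
(* [Z j] is the Choi matrix of the perturbed lift on block j. *)
pose Z j := Y j + map_mx ( *:%R^~ (ounit : S)) (eps%:C *: rho j).
have -> : map_mx (fun x => L x + eps%:C *: unit_map S omega x) X =
    \sum_j map_mx (choi (Z j)) (map_mx (dirsum_proj j) (map_mx f X)).
  apply/matrixP => p q; rewrite summxE !mxE /= /l /unit_map.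
  rewrite [in omega _](expand (X p q)) linear_sum scaler_suml scaler_sumr.
  rewrite -big_split; apply: eq_bigr => j _; rewrite !mxE choiDr; congr (_ + _).
  rewrite /choi linear_sum scaler_suml scaler_sumr; apply: eq_bigr => a _.
  rewrite linear_sum scaler_suml scaler_sumr; apply: eq_bigr => b _.
  by rewrite !mxE /= [omega (_ *: _)]linearZ /= !scalerA mulrCA.
apply: mpos_sum => j _; apply: choi_cp; first by have [] := YP j.
have fX : dirsum_mpos (map_mx f X) := f_cp pX.
exact: fX.
Qed.

End Lifting.

(** * The matrix norm of an operator system *)

Lemma ord2P (i : 'I_2) : i = 0 \/ i = 1.
Proof. by case: i => -[|[|]] // p; [left|right]; apply/val_inj. Qed.

Section OrderNorm.
Variable R : realType.
Local Notation C := R[i].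

Section Gram.
Variable V : opSystemType R.
Implicit Types (a b c d y z : V) (s t : R).

Definition mx22 a b c d : 'M[V]_2 :=
  \matrix_(i, j) if i == 0 then if j == 0 then a else b
                 else if j == 0 then c else d.

Lemma mx22D a b c d a' b' c' d' :
  mx22 a b c d + mx22 a' b' c' d' = mx22 (a + a') (b + b') (c + c') (d + d').
Proof. by apply/matrixP => i j; rewrite !mxE; do 2 case: (_ == 0). Qed.

Lemma mxcompress22 n (A : 'M[C]_(2, n)) a b c d i j :
  mxcompress A (mx22 a b c d) i j =
  ((A 0 i)^* * A 0 j) *: a + ((A 0 i)^* * A 1 j) *: b +
  (((A 1 i)^* * A 0 j) *: c + ((A 1 i)^* * A 1 j) *: d).
Proof.
have o1 : lift ord0 ord0 = 1 :> 'I_2 by apply/val_inj.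
by rewrite mxE !big_ord_recl !big_ord0 !addr0 !mxE !o1.
Qed.

Lemma mx22_form (al be : C) a b c d : mpos (mx22 a b c d) ->
  positive ((al^* * al) *: a + (al^* * be) *: b +
    ((be^* * al) *: c + (be^* * be) *: d)).
Proof.
move=> /(mpos_compress (\matrix_(i < 2, j < 1) if i == 0 then al else be)).
by rewrite mpos1E mxcompress22 !mxE.
Qed.

Lemma mx22_diag (al be : C) a b c d : mpos (mx22 a b c d) ->
  mpos (mx22 ((al^* * al) *: a) ((al^* * be) *: b)
             ((be^* * al) *: c) ((be^* * be) *: d)).
Proof.
move=> /(mpos_compress (\matrix_(i < 2, j < 2)
  if i == j then if i == 0 then al else be else 0)); congr mpos.
apply/matrixP => i j; rewrite mxcompress22 !mxE.
by case: (ord2P i) => ->; case: (ord2P j) => -> /=;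
  rewrite !(rmorph0, mul0r, mulr0, scale0r, addr0, add0r).
Qed.

Lemma positive_scale t y : 0 <= t -> positive y -> positive (t%:C *: y).
Proof.
move=> t0 py; have := mpos_scale t0 py; congr mpos.
by apply/matrixP => i j; rewrite !mxE !ord1 eqxx.
Qed.

Lemma positiveD y z : positive y -> positive z -> positive (y + z).
Proof. by rewrite /positive raddfD; exact: mposD. Qed.

Lemma positive0 : positive (0 : V).
Proof. by rewrite /positive raddf0; exact: mpos0. Qed.

Lemma positive_sum I (r : seq I) (P : pred I) (F : I -> V) :
  (forall i, P i -> positive (F i)) -> positive (\sum_(i <- r | P i) F i).
Proof.
move=> pF; apply: (big_ind (@positive R V)) => //; first exact: positive0.
exact: positiveD.
Qed.

Lemma positive_unit t : 0 <= t -> positive (t%:C *: (ounit : V)).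
Proof. exact: mpos_unit. Qed.

Lemma positive_star y : positive y -> ostar y = y.
Proof.
by move=> /mpos_star/matrixP/(_ 0 0); rewrite !mxE eqxx mulr1n.
Qed.

Lemma positive_proper y : positive y -> positive (- y) -> y = 0.
Proof.
rewrite /positive raddfN => p q; have /matrixP/(_ 0 0) := mpos_proper p q.
by rewrite !mxE eqxx mulr1n.
Qed.

Lemma positive_archi y :
  (forall t, 0 < t -> positive (t%:C *: ounit + y)) -> positive y.
Proof. by move=> py; apply: ounit_archi => e e0; rewrite -raddfD; exact: py. Qed.

Lemma positive_order y : ostar y = y ->
  exists2 t, 0 < t & positive (t%:C *: ounit + y).
Proof.
move=> sy; have [|t t0] := @ounit_order _ _ _ (y%:M : 'M[V]_1).
  by apply/matrixP => i j; rewrite !mxE !ord1 eqxx.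
by rewrite -raddfD; exists t.
Qed.

Lemma mx22_diag_mpos a d : positive a -> positive d -> mpos (mx22 a 0 0 d).
Proof.
move=> pa pd.
have -> : mx22 a 0 0 d =
    mxcompress (\matrix_(i < 1, j < 2) (j == 0)%:R) (a%:M : 'M[V]_1) +
    mxcompress (\matrix_(i < 1, j < 2) (j == 1)%:R) (d%:M : 'M[V]_1).
  apply/matrixP => i j; rewrite !mxE !big_ord1 !mxE.
  by case: (ord2P i) => ->; case: (ord2P j) => -> /=;
    rewrite !conjC_nat ?(mulr0, mul0r, mulr1, scale0r, scale1r, addr0, add0r).
by apply: mposD; exact: mpos_compress.
Qed.

(* The order-unit matrix norm: [y] has norm at most [t]. *)
Definition norm_le t y := mpos (mx22 (t%:C *: ounit) y (ostar y) (t%:C *: ounit)).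

Lemma norm_leD s t y z : norm_le s y -> norm_le t z -> norm_le (s + t) (y + z).
Proof.
by move=> p q; have := mposD p q; rewrite mx22D -scalerDl -ostarD -rmorphD.
Qed.

Lemma norm_le0 t : 0 <= t -> norm_le t 0.
Proof.
by move=> t0; rewrite /norm_le ostar0; apply: mx22_diag_mpos; apply: positive_unit.
Qed.

Lemma norm_leW s t y : s <= t -> norm_le s y -> norm_le t y.
Proof.
rewrite -subr_ge0 => st /(norm_leD (norm_le0 st)).
by rewrite subrK add0r.
Qed.

Lemma norm_le_scale t (r : R) y :
  0 <= r -> norm_le t y -> norm_le (r * t) (r%:C *: y).
Proof.
move=> r0 /(mpos_scale r0); congr mpos; rewrite ostarZ conjRC.
by apply/matrixP => i j; rewrite !mxE; do 2 case: (_ == 0);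
  rewrite // scalerA -rmorphM.
Qed.

Lemma norm_leN t y : norm_le t y -> norm_le t (- y).
Proof.
move=> /(mx22_diag 1 (-1)); congr mpos.
by rewrite !rmorphN !rmorph1 mulrNN !mul1r mulr1 !scale1r ostarN !scaleN1r.
Qed.

Lemma norm_le_star t y : norm_le t y -> norm_le t (ostar y).
Proof.
move=> /(mpos_compress (\matrix_(i < 2, j < 2) (i != j)%:R)); congr mpos.
apply/matrixP => i j; rewrite mxcompress22 !mxE ostarK.
by case: (ord2P i) => ->; case: (ord2P j) => -> /=;
    rewrite !conjC_nat ?(mulr0, mul0r, mulr1, scale0r, scale1r, addr0, add0r).
Qed.

(** Compression by diag(1, c) gives the corners t and |c|^2 t; adding diag(|c|^2 t, t) makes them
    equal. What matters is that s = 1 + |c|^2 depends on c alone. *)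
Lemma norm_leZ (c : C) : exists2 s, 0 < s &
  forall t y, 0 <= t -> norm_le t y -> norm_le (s * t) (c *: y).
Proof.
have [r rE] : exists r : R, r%:C = c^* * c.
  have : c^* * c \is Num.real by rewrite ger0_real // mulrC mul_conjC_ge0.
  by move=> /complex_realP [r ->]; exists r.
have r0 : 0 <= r by rewrite -lecR rE mulrC mul_conjC_ge0.
exists (1 + r); first by rewrite ltr_wpDr.
move=> t y t0 /(mx22_diag 1 c) p.
have q : mpos (mx22 ((r * t)%:C *: (ounit : V)) 0 0 (t%:C *: ounit)).
  by apply: mx22_diag_mpos; apply: positive_unit => //; exact: mulr_ge0.
have := mposD p q; rewrite mx22D; congr mpos.
rewrite rmorph1 !mul1r !mulr1 -rE scale1r ostarZ !addr0.
by rewrite scalerA -scalerDl -rmorphM -rmorphD -scalerDl -rmorphD mulrDl mul1r addrC.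
Qed.

Lemma norm_le_ex y : exists2 t, 0 < t & norm_le t y.
Proof.
have [|t t0 p] := @ounit_order _ _ _ (mx22 0 y (ostar y) 0).
  apply/matrixP => i j; rewrite !mxE.
  by case: (ord2P i) => ->; case: (ord2P j) => -> /=; rewrite ?ostar0 ?ostarK.
exists t => //; have := p; congr mpos; apply/matrixP => i j; rewrite !mxE.
by case: (ord2P i) => ->; case: (ord2P j) => -> /=; rewrite ?mulr1n ?mulr0n ?addr0 ?add0r.
Qed.

(** By the Archimedean property the matrix with corners 0 and off-diagonal entries y, y^* is
    positive, and so is its negative. *)
Lemma norm_le_eq0 y : (forall t, 0 < t -> norm_le t y) -> y = 0.
Proof.
move=> py.
have p0 z : (forall t, 0 < t -> norm_le t z) -> mpos (mx22 0 z (ostar z) 0).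
  move=> pz; apply: ounit_archi => t /pz; congr mpos.
  apply/matrixP => i j; rewrite !mxE.
  by case: (ord2P i) => ->; case: (ord2P j) => -> /=;
    rewrite ?mulr1n ?mulr0n ?addr0 ?add0r.
have py' : mpos (- mx22 0 y (ostar y) 0).
  have := p0 (- y); have pN t : 0 < t -> norm_le t (- y) by move=> /py /norm_leN.
  move=> /(_ pN); congr mpos.
  by apply/matrixP => i j; rewrite !mxE ostarN; do 2 case: (_ == 0); rewrite ?oppr0.
have /matrixP/(_ 0 1) := mpos_proper (p0 _ py) py'.
by rewrite !mxE.
Qed.

Lemma norm_le_sum n (F : 'I_n -> V) (t : 'I_n -> R) :
  (forall i, norm_le (t i) (F i)) -> norm_le (\sum_i t i) (\sum_i F i).
Proof.
move=> h; apply: (big_ind2 norm_le) => //; first exact: norm_le0.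
by move=> *; exact: norm_leD.
Qed.

(* The compressions of the matrices (t, H_ij; H_ij^*, t) to the rows e_i, e_j
   sum up to 2 (n t + H). *)
Lemma mpos_norm_le n (H : 'M[V]_n) t : mxstar ostar H = H ->
  (forall i j, norm_le t (H i j)) ->
  mpos (((n%:R * t)%:C *: ounit)%:M + H).
Proof.
move=> /matrixP sH hH.
pose B i j : 'M[C]_(2, n) := \matrix_(k, p) ((if k == 0 then i else j) == p)%:R.
have h : mpos (\sum_i \sum_j mxcompress (B i j)
    (mx22 (t%:C *: ounit) (H i j) (ostar (H i j)) (t%:C *: ounit))).
  by apply: mpos_sum => i _; apply: mpos_sum => j _; exact/mpos_compress/hH.
have h2 : 0 <= (2^-1 : R) by rewrite invr_ge0.
have := mpos_scale h2 h; congr mpos.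
apply/matrixP => p q; rewrite [LHS]mxE.
have F (a : 'I_n) (G : 'I_n -> V) : \sum_i ((i == a)%:R : C) *: G i = G a.
  rewrite (bigD1 a) //= eqxx scale1r big1 ?addr0 // => i /negPf ->.
  by rewrite scale0r.
set T := t%:C *: ounit.
have -> : (\sum_i \sum_j mxcompress (B i j)
    (mx22 T (H i j) (ostar (H i j)) T)) p q =
    (T *+ (p == q) *+ n + H p q) + (H p q + T *+ (p == q) *+ n).
  rewrite summxE.
  under eq_bigr => i _ do rewrite summxE.
  under eq_bigr => i _ do under eq_bigr => j _ do
    rewrite mxcompress22 !mxE /= !conjC_nat -!scalerA.
  under eq_bigr => i _ do rewrite !big_split /=.
  rewrite !big_split /=; congr (_ + _ + (_ + _)).
  - under eq_bigr => i _ do rewrite sumr_const card_ord.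
    by rewrite sumrMnl F scaler_nat.
  - by under eq_bigr => i _ do rewrite -scaler_sumr F; rewrite F.
  - by under eq_bigr => i _ do rewrite F; rewrite F -[RHS]sH mxE.
  - by rewrite sumr_const card_ord F scaler_nat.
rewrite [H p q + _]addrC -mulr2n -[(_ + H p q) *+ 2]scaler_nat scalerA.
rewrite fmorphV rmorph_nat mulVf ?pnatr_eq0 // scale1r !mxE.
by rewrite rmorphM rmorph_nat /= -scalerA scaler_nat mulrnAC.
Qed.

End Gram.
End OrderNorm.

(** * Compactness in finite dimension *)

Section FiniteDimension.
Variable R : realType.
Local Notation C := R[i].

(** Compactness of the box yields a cluster point along U; for an ultrafilter, each neighbourhood of
    a cluster point contains U-almost all terms. *)
Lemma box_ultra (U : set_system nat) N (v : nat -> 'rV[R]_N) (M : R) :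
  UltraFilter U -> (forall n j, `|v n 0 j| <= M) ->
  exists p : 'rV[R]_N, forall e : R, 0 < e ->
    U [set n | forall j, `|v n 0 j - p 0 j| <= e].
Proof.
move=> UU vM; have PU : ProperFilter U by exact: ultra_proper.
have cK : compact [set w : 'rV[R]_N | forall j, w 0 j \in `[- M, M]].
  apply: (@rV_compact _ _ (fun=> `[- M, M]%classic)) => _.
  exact: segment_compact.
have FK : (v @ U) [set w : 'rV[R]_N | forall j, w 0 j \in `[- M, M]].
  by apply: (@filterE _ U) => n /= j; rewrite in_itv /= -ler_norml; exact: vM.
have [p [_ vp]] := cK _ _ FK.
exists p => e e0; pose B := [set w : 'rV[R]_N | forall j, `|w 0 j - p 0 j| <= e].
have [//|nB] := in_ultra_setVsetC (v @^-1` B) UU.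
have [w [/= nBw]] := vp (~` B) _ nB (nbhsx_ballx p e e0).
move=> b; exfalso; apply: nBw => j; rewrite distrC; apply: ltW.
by case: b => _ /(_ 0 j).
Qed.

Lemma free_ultrafilter : exists U : set_system nat,
  UltraFilter U /\ forall N : nat, U [set n | (N <= n)%N].
Proof.
have [U [UU sU]] := @ultraFilterLemma _ \oo _.
by exists U; split=> // N; apply: sU; exists N.
Qed.

Variable E : finOpSystemType R.

(** Compactness is used for real row vectors, so E is coordinatized over R, by a complex basis and
    its multiples by i. *)
Lemma real_basis : exists N (g : 'I_N -> E),
  (forall y, exists v : 'rV[R]_N, y = \sum_j (v 0 j)%:C *: g j) /\
  (forall v : 'rV[R]_N, \sum_j (v 0 j)%:C *: g j = 0 -> v = 0).
Proof.
pose d := \dim {:E}; pose e := vbasis {:E}.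
pose g (j : 'I_(d + d)) : E :=
  match split j with inl l => e`_l | inr l => 'i%C *: e`_l end.
have gE (v : 'rV[R]_(d + d)) : \sum_j (v 0 j)%:C *: g j =
    \sum_l ((v 0 (lshift d l))%:C + 'i%C * (v 0 (rshift d l))%:C) *: e`_l.
  under [RHS]eq_bigr => l _ do rewrite scalerDl [_ * _%:C]mulrC -scalerA.
  rewrite [RHS]big_split big_split_ord; congr (_ + _); apply: eq_bigr => l _ /=.
    by rewrite /g -[lshift d l]/(unsplit (inl l)) unsplitK.
  by rewrite /g -[rshift d l]/(unsplit (inr l)) unsplitK.
exists (d + d)%N, g; split=> [y|v].
  exists (row_mx (\row_l complex.Re (coord e l y)) (\row_l complex.Im (coord e l y))).
  rewrite gE [LHS](coord_vbasis (memvf y)); apply: eq_bigr => l _.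
  by rewrite row_mxEl row_mxEr !mxE -complexE.
rewrite gE => /freeP-/(_ (basis_free (vbasisP _))) h.
have hl l : v 0 (lshift d l) = 0 /\ v 0 (rshift d l) = 0.
  have := h l; rewrite -[X in _ + X]/(_ * _).
  move=> /eqP; rewrite eq_complex /=.
  rewrite !(mul0r, mul1r, addr0, add0r, subr0, mulr0, oppr0).
  by move=> /andP[/eqP -> /eqP ->].
apply/rowP => j; rewrite mxE -[j]splitK; case: split => l /=.
  by case: (hl l).
by case: (hl l).
Qed.

Lemma ulim_exists (U : set_system nat) (u : nat -> E) (M : R) :
  UltraFilter U -> 0 <= M -> (forall n, norm_le M (u n)) ->
  exists y, forall e : R, 0 < e -> U [set n | norm_le e (u n - y)].
Proof.
have [N [g [g_onto g_free]]] := real_basis.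
pose iota (v : 'rV[R]_N) := \sum_j (v 0 j)%:C *: g j.
have iotaB v w : iota (v - w) = iota v - iota w.
  rewrite /iota -sumrB; apply: eq_bigr => j _.
  by rewrite !mxE rmorphB scalerBl.
have iotaZ (a : R) v : iota (a *: v) = a%:C *: iota v.
  rewrite /iota scaler_sumr; apply: eq_bigr => j _.
  by rewrite !mxE rmorphM scalerA.
have [L L0 lip] : exists2 L : R, 0 < L & forall (v : 'rV[R]_N) (r : R), 0 <= r ->
    (forall j, `|v 0 j| <= r) -> norm_le (L * r) (iota v).
  pose t j := projT1 (cid2 (norm_le_ex (g j))).
  have t0 j : 0 < t j by rewrite /t; case: cid2.
  have tP j : norm_le (t j) (g j) by rewrite /t; case: cid2.
  exists (1 + \sum_j t j).
    by rewrite ltr_wpDr // sumr_ge0 // => j _; apply: ltW.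
  move=> v r r0 vr; apply: (@norm_leW _ _ (\sum_j r * t j)).
    by rewrite -mulr_sumr mulrC ler_wpM2r // lerDr ler01.
  apply: norm_le_sum => j; apply: (@norm_leW _ _ (`|v 0 j| * t j)).
    by rewrite ler_wpM2r // ltW.
  have [v0|v0] := leP 0 (v 0 j).
    by rewrite ger0_norm //; apply: norm_le_scale.
  rewrite ltr0_norm // -[v 0 j]opprK rmorphN scaleNr opprK; apply: norm_leN.
  by apply: norm_le_scale => //; rewrite oppr_ge0 ltW.
(* The order norm controls coordinates: otherwise there are w_n with sup norm 1 and order norm at
   most 1/(n+1); their limit p along a free ultrafilter has order norm 0, hence p = 0, which is too
   far from vectors of sup norm 1. *)
have [c c0 bnd] : exists2 c : R, 0 < c & forall (v : 'rV[R]_N) (t : R), 0 <= t ->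
    norm_le t (iota v) -> forall j, `|v 0 j| <= c * t.
  apply: contrapT => nc.
  have bad (n : nat) : exists w : 'rV[R]_N,
      [/\ norm_le n.+1%:R^-1 (iota w), forall j, `|w 0 j| <= 1
        & exists j, `|w 0 j| = 1].
    apply: contrapT => nw; apply: nc; exists n.+1%:R => // v t t0 vt j.
    have [i _ max_i] := @arg_maxP _ _ _ j xpredT (fun j => `|v 0 j|) isT.
    apply: (le_trans (max_i j isT)); rewrite leNgt; apply/negP => lt_i.
    have m0 : 0 < `|v 0 i| by apply: le_lt_trans lt_i; rewrite mulr_ge0.
    apply: nw; exists (`|v 0 i|^-1 *: v); split=> [|l|].
    - rewrite iotaZ; apply: (@norm_leW _ _ (`|v 0 i|^-1 * t)).
        by rewrite ler_pdivrMl // ler_pdivlMr // mulrC ltW.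
      by apply: norm_le_scale; rewrite ?invr_ge0.
    - rewrite mxE normrM normfV normr_id ler_pdivrMl // mulr1; exact: max_i.
    - by exists i; rewrite mxE normrM normfV normr_id mulVf ?gt_eqF.
  have [w wP] := choice bad.
  have [U0 [UU0 U0oo]] := free_ultrafilter.
  have PU0 : ProperFilter U0 by exact: ultra_proper.
  have [|p wp] := @box_ultra U0 N w 1 UU0; first by move=> n; case: (wP n).
  have p0 : p = 0.
    apply: g_free; apply: norm_le_eq0 => e e0.
    have e2 : 0 < e / 2 by rewrite divr_gt0.
    have [m m0] : exists m : nat, m.+1%:R^-1 < e / 2.
      exists (Num.trunc (e / 2)^-1); rewrite invf_plt ?posrE //.
      exact: truncnS_gt.
    have eL : 0 < e / 2 / L by rewrite divr_gt0.
    have [n [/= mn hn]] := filter_ex (filterI (U0oo m) (wp _ eL)).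
    have -> : \sum_j (p 0 j)%:C *: g j = iota (w n) - iota (w n - p).
      by rewrite iotaB subKr.
    rewrite [e]splitr; apply: norm_leD; last first.
      apply: norm_leN; rewrite -[e / 2](divfK (lt0r_neq0 L0)) mulrC.
      apply: lip; first exact: ltW.
      by move=> j; rewrite !mxE; apply: hn.
    apply: norm_leW (_ : norm_le n.+1%:R^-1 _); last by case: (wP n).
    by apply/(le_trans _ (ltW m0)); rewrite lef_pV2 ?posrE // ler_nat ltnS.
  have [|n /= hn] := filter_ex (wp (1 / 2) _); first by rewrite divr_gt0.
  have [_ _ [j wj]] := wP n; have := hn j.
  by rewrite p0 mxE subr0 wj; lra.
move=> UU M0 uM; have PU : ProperFilter U by exact: ultra_proper.
have [v vE] := choice (fun n => g_onto (u n)).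
have [|p vp] := @box_ultra U N v (c * M) UU.
  by move=> n; apply: bnd => //; rewrite -[iota _]vE.
exists (iota p) => e e0; have eL : 0 < e / L by rewrite divr_gt0.
apply: filterS (vp _ eL) => n /= hn.
rewrite vE -[X in X - _]/(iota (v n)) -iotaB -[e](divfK (lt0r_neq0 L0)) mulrC.
by apply: lip; [exact: ltW | move=> j; rewrite !mxE; apply: hn].
Qed.

End FiniteDimension.

(** * Products on an operator system *)

Section StarMul.
Variable R : realType.
Local Notation C := R[i].

(** This stands in for a C*-algebra structure: [star_mul_mpos] says that W^* X W is positive with X.
    The unit u is a parameter because in the approximating algebras it is Th 1 and not the order
    unit. *)
Record star_mul (V : opSystemType R) (u : V) (m : V -> V -> V) : Prop := StarMul {
  star_mul_linear : forall x, linear (m x);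
  star_mulA : associative m;
  star_mul1l : left_id u m;
  star_mul_star : forall x y, ostar (m x y) = m (ostar y) (ostar x);
  star_mul_mpos : forall n k (X : 'M[V]_n) (W : 'M[V]_(n, k)), mpos X ->
    mpos (\matrix_(i, j) \sum_p \sum_q m (m (ostar (W p i)) (X p q)) (W q j))
}.

Section Theory.
Variables (V : opSystemType R) (u : V) (m : V -> V -> V).
Hypothesis mP : star_mul u m.
Implicit Types (x y z : V) (a : C).

Lemma star_mulr1_star : right_id (ostar u) m.
Proof.
by move=> x; rewrite -[x]ostarK -(star_mul_star mP) (star_mul1l mP).
Qed.

Lemma star_mul_unit_star : ostar u = u.
Proof. by rewrite -[LHS](star_mul1l mP) star_mulr1_star. Qed.

Lemma star_mul1r : right_id u m.
Proof. by move=> x; rewrite -{1}star_mul_unit_star star_mulr1_star. Qed.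

Lemma star_mulDr x y z : m x (y + z) = m x y + m x z.
Proof. by have := star_mul_linear mP x 1 y z; rewrite !scale1r. Qed.

Lemma star_mul0r x : m x 0 = 0.
Proof.
have := star_mul_linear mP x 1 0 0; rewrite !scale1r addr0.
by rewrite -[X in X = _]addr0 => /addrI.
Qed.

Lemma star_mulZr a x y : m x (a *: y) = a *: m x y.
Proof. by have := star_mul_linear mP x a y 0; rewrite star_mul0r !addr0. Qed.

Lemma star_mulDl x y z : m (y + z) x = m y x + m z x.
Proof.
apply: (inv_inj (@ostarK R V)); rewrite ostarD !(star_mul_star mP).
by rewrite ostarD star_mulDr.
Qed.

Lemma star_mulZl a x y : m (a *: y) x = a *: m y x.
Proof.
apply: (inv_inj (@ostarK R V)); rewrite ostarZ !(star_mul_star mP).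
by rewrite ostarZ star_mulZr.
Qed.

Lemma star_mul0l x : m 0 x = 0.
Proof. by rewrite -[0](scale0r (0 : V)) star_mulZl !scale0r. Qed.

Lemma star_mulNr x y : m x (- y) = - m x y.
Proof. by rewrite -scaleN1r star_mulZr scaleN1r. Qed.

Lemma star_mulNl x y : m (- y) x = - m y x.
Proof. by rewrite -scaleN1r star_mulZl scaleN1r. Qed.

Lemma star_mulBr x y z : m x (y - z) = m x y - m x z.
Proof. by rewrite star_mulDr star_mulNr. Qed.

Lemma star_mulBl x y z : m (y - z) x = m y x - m z x.
Proof. by rewrite star_mulDl star_mulNl. Qed.

Lemma star_mul_sumr I (r : seq I) (P : pred I) (F : I -> V) x :
  m x (\sum_(i <- r | P i) F i) = \sum_(i <- r | P i) m x (F i).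
Proof. by apply: (big_morph (m x)) => [y z|]; rewrite ?star_mulDr ?star_mul0r. Qed.

Lemma star_mul_suml I (r : seq I) (P : pred I) (F : I -> V) x :
  m (\sum_(i <- r | P i) F i) x = \sum_(i <- r | P i) m (F i) x.
Proof.
by apply: (big_morph (fun y => m y x)) => [y z|]; rewrite ?star_mulDl ?star_mul0l.
Qed.

Lemma star_mul_gram n (w : 'I_n -> V) : positive u ->
  mpos (\matrix_(i, j) m (ostar (w i)) (w j)).
Proof.
move=> pu; have := star_mul_mpos mP (\row_j w j) pu; congr mpos.
apply/matrixP => i j; rewrite !mxE !big_ord1 !mxE eqxx.
by rewrite star_mul1r.
Qed.

Lemma star_mul_positive x : positive u -> positive (m (ostar x) x).
Proof.
by move=> /(star_mul_gram (fun _ : 'I_1 => x)); rewrite mpos1E mxE.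
Qed.

Lemma star_mul_gram2 x y : positive u ->
  mpos (mx22 (m (ostar x) x) (m (ostar x) y) (m (ostar y) x) (m (ostar y) y)).
Proof.
move=> /(star_mul_gram (fun i : 'I_2 => if i == 0 then x else y)); congr mpos.
by apply/matrixP => i j; rewrite !mxE; do 2 case: (_ == 0).
Qed.

(* Schur complement: compress by the column (- y, u). *)
Lemma star_mul_schur y z : mpos (mx22 u y (ostar y) z) ->
  positive (z - m (ostar y) y).
Proof.
move=> /(star_mul_mpos mP (\col_i if i == 0 then - y else u)).
rewrite mpos1E mxE !big_ord_recl !big_ord0 !mxE /= !addr0 star_mul_unit_star.
rewrite !(star_mul1l mP) !star_mul1r ostarN !(star_mulNl, star_mulNr) opprK.
by rewrite subrr add0r addrC.
Qed.

End Theory.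

(** With y <= s 1, the hypothesis at (s/t) a, rescaled by t/s, gives a d + (a d)^* + t 1 >= 0 for
    every t > 0. So a d + (a d)^* is positive for a and for -a, hence zero, and a = 1, a = i give d
    = 0. The Cauchy-Schwarz arguments below end here. *)
Lemma form_corner_eq0 (V : opSystemType R) (d y : V) :
  (forall a : C, positive (a *: d + ostar (a *: d) + y)) -> d = 0.
Proof.
move=> pd.
have [s s0 py] : exists2 s : R, 0 < s & positive (s%:C *: ounit - y).
  apply: positive_order; rewrite ostarN; congr (- _).
  by have := positive_star (pd 0); rewrite scale0r ostar0 !add0r.
have p0 a : positive (a *: d + ostar (a *: d)).
  apply: positive_archi => t t0; have st : 0 < s / t by rewrite divr_gt0.
  have := positiveD (pd ((s / t)%:C * a)) py.
  move=> /(positive_scale (ltW (divr_gt0 t0 s0))).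
  rewrite addrA addrAC addrK scalerDr scalerA -rmorphM divfK ?lt0r_neq0 //.
  rewrite -!scalerA [ostar (_%:C *: _)]ostarZ conjRC -scalerDr scalerA -rmorphM.
  have -> : t / s * (s / t) = 1.
    by rewrite mulrA divfK ?lt0r_neq0 // divff // lt0r_neq0.
  by rewrite scale1r addrC.
have e0 a : a *: d + ostar (a *: d) = 0.
  apply: positive_proper => //.
  by have := p0 (- a); rewrite scaleNr ostarN -opprD.
have := e0 1; rewrite scale1r => /eqP; rewrite addrC addr_eq0 => /eqP dN.
have := e0 'i; rewrite ostarZ conjCi dN scaleNr scalerN opprK -scalerDr => /eqP.
rewrite scaler_eq0 (negPf (neq0Ci _)) /= -mulr2n -scaler_nat scaler_eq0.
by rewrite pnatr_eq0 => /eqP.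
Qed.

End StarMul.

(** * The limit product *)

Section LimitProduct.
Variable R : realType.
Local Notation C := R[i].
Variable E : finOpSystemType R.

(** * Limits along a free ultrafilter in the order norm *)

Section UltraLimit.
Variable U : set_system nat.
Hypothesis UU : UltraFilter U.
Hypothesis Uoo : forall N : nat, U [set n | (N <= n)%N].

Let PU : ProperFilter U. Proof. exact: ultra_proper. Qed.

Definition ulim (u : nat -> E) (y : E) :=
  forall e : R, 0 < e -> U [set n | norm_le e (u n - y)].

Lemma ulim_unique u y z : ulim u y -> ulim u z -> y = z.
Proof.
move=> uy uz; apply/eqP; rewrite -subr_eq0; apply/eqP/norm_le_eq0 => e e0.
have e2 : 0 < e / 2 by rewrite divr_gt0.
have [n [/= yn zn]] := filter_ex (filterI (uy _ e2) (uz _ e2)).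
rewrite -(subrKA (u n)) addrC [e]splitr; apply: norm_leD => //.
by rewrite -opprB; apply: norm_leN.
Qed.

Lemma ulimD u v y z : ulim u y -> ulim v z -> ulim (fun n => u n + v n) (y + z).
Proof.
move=> uy vz e e0; have e2 : 0 < e / 2 by rewrite divr_gt0.
apply: filterS (filterI (uy _ e2) (vz _ e2)) => n [/= yn zn].
by rewrite [e]splitr opprD addrACA; apply: norm_leD.
Qed.

Lemma ulimZ (a : C) u y : ulim u y -> ulim (fun n => a *: u n) (a *: y).
Proof.
move=> uy e e0; have [s s0 sP] := norm_leZ E a.
have es : 0 < e / s by rewrite divr_gt0.
apply: filterS (uy _ es) => n /= yn.
rewrite -scalerBr -[e](divfK (lt0r_neq0 s0)) mulrC; apply: sP => //.
exact: ltW.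
Qed.

Lemma ulim_star u y : ulim u y -> ulim (fun n => ostar (u n)) (ostar y).
Proof.
move=> uy e e0; apply: filterS (uy _ e0) => n /= yn.
by rewrite -ostarB; apply: norm_le_star.
Qed.

Lemma ulim_unit_map (omega : {scalar E}) x :
  ulim (fun n => x + (n.+1%:R^-1)%:C *: unit_map E omega x) x.
Proof.
move=> e e0; have [t t0 tP] := norm_le_ex (unit_map E omega x).
apply: filterS (Uoo (Num.trunc (e / t)^-1)) => n /= hn.
rewrite addrAC subrr add0r.
apply: norm_leW (norm_le_scale _ tP); last by rewrite invr_ge0.
rewrite -ler_pdivlMr // -[leRHS]invrK lef_pV2 ?posrE ?invr_gt0 ?divr_gt0 //.
by apply: le_trans (ltW (truncnS_gt _)) _; rewrite ler_nat ltnS.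
Qed.

Lemma ulim_mpos k (X : nat -> 'M[E]_k) (Y : 'M[E]_k) :
  (forall n, mpos (X n)) -> (forall i j, ulim (fun n => X n i j) (Y i j)) ->
  mpos Y.
Proof.
move=> pX XY.
have sY : mxstar ostar Y = Y.
  apply/matrixP => i j; rewrite mxE; apply: ulim_unique (XY i j).
  have : ulim (fun n => ostar (X n j i)) (ostar (Y j i)) by exact: ulim_star.
  congr (ulim _ _); apply: funext => n.
  by have /matrixP/(_ i j) := mpos_star (pX n); rewrite mxE.
apply: ounit_archi => e e0.
(* An error matrix with entries of norm at most e/(k+1) lies above -k e/(k+1); dividing by k + 1
   also covers k = 0 and leaves the surplus e/(k+1). *)
have ek : 0 < e / k.+1%:R by rewrite divr_gt0.
have near : U [set n | forall i j, norm_le (e / k.+1%:R) (X n i j - Y i j)].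
  by apply: filter_forall => i; apply: filter_forall => j; apply: XY.
have [n /= hn] := filter_ex near.
have -> : Y = X n + (Y - X n) by rewrite subrKC.
have hk : mpos (((k%:R * (e / k.+1%:R))%:C *: ounit)%:M + (Y - X n)).
  apply: mpos_norm_le => [|i j].
    apply/matrixP => i j; rewrite !mxE ostarB.
    move: sY (mpos_star (pX n)) => /matrixP/(_ i j) + /matrixP/(_ i j).
    by rewrite !mxE => -> ->.
  by rewrite !mxE -opprB; apply: norm_leN.
rewrite addrCA; apply: mposD (pX n) _.
have -> : e = e / k.+1%:R + k%:R * (e / k.+1%:R).
  by rewrite mulr_natl -mulrS -[RHS]mulr_natr divfK // pnatr_eq0.
rewrite splitunit -addrA; apply: mposD hk; apply: mpos_unit; exact: ltW.
Qed.

End UltraLimit.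

(* The identity of E, up to e omega 1, factors through a C*-algebra; as the
   first factor need not be unital, the product is twisted so that its value
   at 1 becomes the unit. *)
Record approx_factor (omega : {scalar E}) (e : R) := ApproxFactor {
  af_sys : opSystemType R;
  af_in : {linear E -> af_sys};
  af_out : {linear af_sys -> E};
  af_mul : af_sys -> af_sys -> af_sys;
  af_in_cp : completely_positive af_in;
  af_out_cp : completely_positive af_out;
  af_outK : forall x, af_out (af_in x) = x + e%:C *: unit_map E omega x;
  af_mulP : star_mul (af_in ounit) af_mul
}.

Variables (omega : {scalar E}).
Hypothesis omega1 : omega ounit = 1.
Variable F : forall n : nat, approx_factor omega n.+1%:R^-1.

Local Notation A n := (af_sys (F n)).
Local Notation Th n := (af_in (F n)).
Local Notation Ps n := (af_out (F n)).
Local Notation mul n := (@af_mul _ _ (F n)).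
Local Notation h n := (Th n ounit).
Implicit Types (b c : forall n, A n).

Let seq_ext b c : (forall n, b n = c n) -> b = c.
Proof. exact: functional_extensionality_dep. Qed.

Let mulP n : star_mul (h n) (mul n) := @af_mulP _ _ (F n).

Let Th_star n x : Th n (ostar x) = ostar (Th n x).
Proof. exact: cp_star_preserving (@af_in_cp _ _ (F n)) x. Qed.

Let Ps_star n x : Ps n (ostar x) = ostar (Ps n x).
Proof. exact: cp_star_preserving (@af_out_cp _ _ (F n)) x. Qed.

Let map_mx22 (V W : opSystemType R) (f : {linear V -> W}) p q r s :
  map_mx f (mx22 p q r s) = mx22 (f p) (f q) (f r) (f s).
Proof. by apply/matrixP => i j; rewrite !mxE; do 2 case: (_ == 0). Qed.

Let h_pos n : positive (h n).
Proof.
have := @af_in_cp _ _ (F n) _ _ (mpos_unit E 1 ler01); congr mpos.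
by apply/matrixP => i j; rewrite !mxE !ord1 eqxx scale1r.
Qed.

Let Ps_h n : Ps n (h n) = (1 + n.+1%:R^-1)%:C *: ounit.
Proof. by rewrite af_outK /unit_map omega1 scale1r rmorphD scalerDl scale1r. Qed.

(** Boundedness is relative to h n, the unit of the twisted product: Ps n maps h n to (1 + 1/(n+1))
    1, whereas no uniform comparison of h n with the order unit of [A n] is available. *)
Definition bounded_seq b := exists2 t : R, 0 <= t & forall n,
  mpos (mx22 (t%:C *: h n) (b n) (ostar (b n)) (t%:C *: h n)).

Let bounded_ext b c : (forall n, c n = b n) -> bounded_seq b -> bounded_seq c.
Proof. by move=> /seq_ext ->. Qed.

Lemma bounded_in x : bounded_seq (fun n => Th n x).
Proof.
have [t t0 tP] := norm_le_ex x; exists t; first exact: ltW.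
move=> n; have := @af_in_cp _ _ (F n) _ _ tP.
by rewrite map_mx22 linearZ Th_star.
Qed.

Lemma bounded_star b : bounded_seq b -> bounded_seq (fun n => ostar (b n)).
Proof.
move=> [t t0 tP]; exists t => // n.
have := mpos_compress (\matrix_(i < 2, j < 2) (i != j)%:R) (tP n); congr mpos.
apply/matrixP => i j; rewrite mxcompress22 !mxE ostarK.
by case: (ord2P i) => ->; case: (ord2P j) => -> /=;
    rewrite !conjC_nat ?(mulr0, mul0r, mulr1, scale0r, scale1r, addr0, add0r).
Qed.

Let diag_h n (s t : R) : 0 <= s -> 0 <= t ->
  mpos (mx22 (s%:C *: h n) 0 0 (t%:C *: h n)).
Proof. by move=> s0 t0; apply: mx22_diag_mpos; apply: positive_scale. Qed.

Lemma boundedD b c : bounded_seq b -> bounded_seq c ->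
  bounded_seq (fun n => b n + c n).
Proof.
move=> [s s0 sP] [t t0 tP]; exists (s + t); first exact: addr_ge0.
by move=> n; have := mposD (sP n) (tP n); rewrite mx22D -scalerDl -ostarD -rmorphD.
Qed.

Lemma boundedZ (a : C) b : bounded_seq b -> bounded_seq (fun n => a *: b n).
Proof.
move=> [t t0 tP].
have [r rE] : exists r : R, r%:C = a^* * a.
  have : a^* * a \is Num.real by rewrite ger0_real // mulrC mul_conjC_ge0.
  by move=> /complex_realP [r ->]; exists r.
have r0 : 0 <= r by rewrite -lecR rE mulrC mul_conjC_ge0.
exists (r * t + t); first by rewrite addr_ge0 ?mulr_ge0.
move=> n; have := mposD (mx22_diag 1 a (tP n)) (diag_h n (mulr_ge0 r0 t0) t0).
rewrite mx22D; congr mpos.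
rewrite rmorph1 !mul1r !mulr1 -rE scale1r ostarZ !addr0.
by rewrite scalerA -!scalerDl -rmorphM -!rmorphD [t + _]addrC.
Qed.

(** The rescaled matrix (h, b; b^*, s^2 h) has Schur complement s^2 h - b^* h^-1 b for the twisted
    product. *)
Let bounded_sqr b s : 0 < s ->
  (forall n, mpos (mx22 (s%:C *: h n) (b n) (ostar (b n)) (s%:C *: h n))) ->
  forall n, positive ((s ^+ 2)%:C *: h n - mul n (ostar (b n)) (b n)).
Proof.
move=> s0 sP n; have := mx22_diag 1 (s%:C) (sP n).
have si : 0 <= s^-1 by rewrite invr_ge0 ltW.
move=> /(mpos_scale si).
have -> : map_mx ( *:%R (s^-1)%:C) (mx22 ((1^* * 1) *: (s%:C *: h n))
   ((1^* * s%:C) *: b n) ((s%:C^* * 1) *: ostar (b n)) ((s%:C^* * s%:C) *: (s%:C *: h n)))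
   = mx22 (h n) (b n) (ostar (b n)) ((s ^+ 2)%:C *: h n).
  have sV : (s^-1)%:C * s%:C = 1 by rewrite -rmorphM mulVf ?lt0r_neq0.
  apply/matrixP => i j; rewrite !mxE rmorph1 conjRC !mul1r mulr1 !scalerA.
  by case: (i == 0); case: (j == 0);
    rewrite ?mul1r scalerA ?mulrA sV ?mul1r ?scale1r // expr2 rmorphM.
exact: (star_mul_schur (mulP n)).
Qed.

(** The product of b and c is the off-diagonal entry of the Gram matrix of b^* and c, whose corners
    are bounded by [bounded_sqr]. *)
Lemma bounded_mul b c : bounded_seq b -> bounded_seq c ->
  bounded_seq (fun n => mul n (b n) (c n)).
Proof.
move=> /bounded_star [s s0 sP] [t t0 tP].
(* [bounded_sqr] divides by its constant, so r is enlarged to r + 1 > 0. *)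
have bnd (r : R) d (r0 : 0 <= r) :
   (forall n, mpos (mx22 (r%:C *: h n) (d n) (ostar (d n)) (r%:C *: h n))) ->
   (forall n, positive (((r + 1) ^+ 2)%:C *: h n - mul n (ostar (d n)) (d n))).
  move=> dP; apply: bounded_sqr; first by rewrite ltr_wpDl.
  move=> n; have := mposD (dP n) (diag_h n ler01 ler01).
  by rewrite mx22D !addr0 -scalerDl -rmorphD.
have sq x : 0 <= (x + 1 : R) ^+ 2 by exact: sqr_ge0.
exists ((s + 1) ^+ 2 + (t + 1) ^+ 2) => [|n]; first by rewrite addr_ge0.
have := mposD (star_mul_gram2 (mulP n) (ostar (b n)) (c n) (h_pos n))
  (mx22_diag_mpos (bnd _ _ s0 sP n) (bnd _ _ t0 tP n)).
rewrite mx22D !subrKC !addr0 ostarK (star_mul_star (mulP n)).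
move=> /mposD /(_ (diag_h n (sq t) (sq s))); rewrite mx22D !addr0.
by rewrite -!scalerDl -!rmorphD [X in mx22 _ _ _ (X%:C *: _)]addrC.
Qed.

Lemma bounded_out b : bounded_seq b ->
  exists2 M : R, 0 <= M & forall n, norm_le M (Ps n (b n)).
Proof.
(* The factor 2 bounds 1 + 1/(n+1), the value of Ps n at h n. *)
move=> [t t0 tP]; exists (t * 2) => [|n]; first by rewrite mulr_ge0.
have := @af_out_cp _ _ (F n) _ _ (tP n).
rewrite map_mx22 linearZ /= Ps_h Ps_star scalerA -rmorphM.
apply: norm_leW; rewrite ler_wpM2l //.
by rewrite -[2]/(1 + 1) lerD2l invf_le1 ?ler1n ?ltr0n.
Qed.

Variable U : set_system nat.
Hypothesis UU : UltraFilter U.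
Hypothesis Uoo : forall N : nat, U [set n | (N <= n)%N].

(** The value 0 only makes the function total: for bounded sequences the limit exists by
    [ulim_exists]. *)
Definition lim_out b : E :=
  if pselect (exists y, ulim U (fun n => Ps n (b n)) y) is left h
  then projT1 (cid h) else 0.

Lemma lim_outP b : bounded_seq b -> ulim U (fun n => Ps n (b n)) (lim_out b).
Proof.
move=> /bounded_out [M M0 bM]; rewrite /lim_out; case: pselect => [h|[]].
  exact: projT2 (cid h).
exact: ulim_exists bM.
Qed.

Lemma lim_out_eq b y : bounded_seq b -> ulim U (fun n => Ps n (b n)) y ->
  lim_out b = y.
Proof. by move=> /lim_outP bb by_; exact: ulim_unique bb by_. Qed.

Lemma lim_outD b c : bounded_seq b -> bounded_seq c ->
  lim_out (fun n => b n + c n) = lim_out b + lim_out c.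
Proof.
move=> bb bc; apply: lim_out_eq; first exact: boundedD.
under eq_fun do rewrite linearD.
exact: ulimD (lim_outP bb) (lim_outP bc).
Qed.

Lemma lim_outZ a b : bounded_seq b ->
  lim_out (fun n => a *: b n) = a *: lim_out b.
Proof.
move=> bb; apply: lim_out_eq; first exact: boundedZ.
under eq_fun do rewrite linearZ.
exact: ulimZ (lim_outP bb).
Qed.

Lemma lim_out_star b : bounded_seq b ->
  lim_out (fun n => ostar (b n)) = ostar (lim_out b).
Proof.
move=> bb; apply: lim_out_eq; first exact: bounded_star.
under eq_fun do rewrite Ps_star.
exact: ulim_star (lim_outP bb).
Qed.

Lemma lim_out_in x : lim_out (fun n => Th n x) = x.
Proof.
apply: lim_out_eq; first exact: bounded_in.
by under eq_fun do rewrite af_outK; exact: ulim_unit_map.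
Qed.

Lemma bounded0 : bounded_seq (fun n => 0).
Proof.
have [t t0 tP] := bounded_in 0; exists t => // n.
by have := tP n; rewrite linear0.
Qed.

Lemma bounded_sum (I : eqType) (r : seq I) (G : I -> forall n, A n) :
  (forall i, bounded_seq (G i)) -> bounded_seq (fun n => \sum_(i <- r) G i n).
Proof.
move=> bG; elim: r => [|i r IH].
  by apply: bounded_ext bounded0 => n; rewrite big_nil.
by apply: bounded_ext (boundedD (bG i) IH) => n; rewrite big_cons.
Qed.

Lemma lim_out_sum (I : eqType) (r : seq I) (G : I -> forall n, A n) :
  (forall i, bounded_seq (G i)) ->
  lim_out (fun n => \sum_(i <- r) G i n) = \sum_(i <- r) lim_out (G i).
Proof.
move=> bG; elim: r => [|i r IH].
  rewrite big_nil -[RHS]lim_out_in; congr lim_out.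
  by apply: seq_ext => n; rewrite big_nil linear0.
rewrite big_cons -IH -lim_outD //; last exact: bounded_sum.
by congr lim_out; apply: seq_ext => n; rewrite big_cons.
Qed.

Lemma lim_out_mpos k (X : forall n, 'M[A n]_k) :
  (forall i j, bounded_seq (fun n => X n i j)) -> (forall n, mpos (X n)) ->
  mpos (\matrix_(i, j) lim_out (fun n => X n i j)).
Proof.
move=> bX pX; apply: (@ulim_mpos U UU k (fun n => map_mx (Ps n) (X n))).
  by move=> n; apply: af_out_cp.
move=> i j; rewrite mxE; under eq_fun do rewrite mxE.
exact: lim_outP.
Qed.

Definition lim_mul x y : E := lim_out (fun n => mul n (Th n x) (Th n y)).

Let bin := bounded_in.
Let bmul := bounded_mul.

Lemma lim_mul_linear x : linear (lim_mul x).
Proof.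
move=> a y z; have bxy := bmul (bin x) (bin y); have bxz := bmul (bin x) (bin z).
rewrite /lim_mul -(lim_outZ a bxy) -(lim_outD (boundedZ a bxy) bxz).
by congr lim_out; apply: seq_ext => n; rewrite linearP (star_mul_linear (mulP n)).
Qed.

Lemma lim_mul_star x y : ostar (lim_mul x y) = lim_mul (ostar y) (ostar x).
Proof.
rewrite /lim_mul -lim_out_star; last exact: bmul.
congr lim_out; apply: seq_ext => n.
by rewrite (star_mul_star (mulP n)) !Th_star.
Qed.

Lemma lim_mul1 : left_id ounit lim_mul.
Proof.
move=> x; rewrite -[RHS]lim_out_in; congr lim_out.
by apply: seq_ext => n; rewrite (star_mul1l (mulP n)).
Qed.

(* A 2x2 matrix over E is pushed forward to A_n and compressed there. *)
Lemma lim_mul_schur y z : mpos (mx22 ounit y (ostar y) z) ->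
  positive (z - lim_mul (ostar y) y).
Proof.
move=> p.
have bX : bounded_seq (fun n => Th n z - mul n (Th n (ostar y)) (Th n y)).
  apply: boundedD; first exact: bin.
  by apply: bounded_ext (boundedZ (-1) (bmul (bin (ostar y)) (bin y))) => n;
    rewrite scaleN1r.
pose X n : 'M[A n]_1 := (Th n z - mul n (Th n (ostar y)) (Th n y))%:M.
have E11 n (a : A n) (i j : 'I_1) : a%:M i j = a by rewrite !ord1 mxE eqxx.
have : mpos (\matrix_(i, j) lim_out (fun n => X n i j)).
  apply: lim_out_mpos => [i j|n].
  - by apply: bounded_ext bX => n; rewrite E11.
  have := @af_in_cp _ _ (F n) _ _ p.
  by rewrite map_mx22 /X Th_star; exact: (star_mul_schur (mulP n)).
rewrite mpos1E mxE; congr positive.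
transitivity (lim_out (fun n => Th n z + (-1) *: mul n (Th n (ostar y)) (Th n y))).
  by congr lim_out; apply: seq_ext => n; rewrite E11 scaleN1r.
rewrite lim_outD ?lim_out_in ?lim_outZ ?scaleN1r //; try exact: bmul.
by apply: boundedZ; exact: bmul.
Qed.

(** Kadison-Schwarz for lim Ps: the Gram matrix of h and b is (h, b; b^*, b^* h^-1 b), and since Ps
    h tends to 1 its limit has upper corner 1, so that [lim_mul_schur] applies. *)
Lemma lim_out_sqr b : bounded_seq b ->
  positive (lim_out (fun n => mul n (ostar (b n)) (b n)) -
            lim_mul (ostar (lim_out b)) (lim_out b)).
Proof.
move=> bb; apply: lim_mul_schur.
pose X n := mx22 (h n) (b n) (ostar (b n)) (mul n (ostar (b n)) (b n)).
have bs := bounded_star bb.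
have : mpos (\matrix_(i, j) lim_out (fun n => X n i j)).
  apply: lim_out_mpos => [i j|n]; last first.
    have := star_mul_gram2 (mulP n) (h n) (b n) (h_pos n).
    by rewrite (star_mul_unit_star (mulP n)) !(star_mul1l (mulP n)) (star_mul1r (mulP n)).
  case: (ord2P i) => ->; case: (ord2P j) => ->.
  + by apply: bounded_ext (bin ounit) => n; rewrite mxE.
  + by apply: bounded_ext bb => n; rewrite mxE.
  + by apply: bounded_ext bs => n; rewrite mxE.
  + by apply: bounded_ext (bmul bs bb) => n; rewrite mxE.
congr mpos; apply/matrixP => i j; rewrite !mxE -lim_out_star //.
by case: (ord2P i) => ->; case: (ord2P j) => ->;
   rewrite /= -?[RHS](lim_out_in ounit); congr lim_out;
   apply: seq_ext => n; rewrite mxE.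
Qed.

(* The form lim_out (b^* b) - (lim_out b)^* (lim_out b) is positive and
   vanishes at the sequence Th x, so by Cauchy-Schwarz it vanishes against it. *)
Lemma lim_out_mull x c : bounded_seq c ->
  lim_out (fun n => mul n (Th n x) (c n)) = lim_mul x (lim_out c).
Proof.
move=> bc; apply/eqP; rewrite -subr_eq0; apply/eqP.
set p := lim_out c; set y := ostar x.
pose D := lim_out (fun n => mul n (ostar (c n)) (c n)) - lim_mul (ostar p) p.
(* At the sequence a^* Th y + c the form of [lim_out_sqr] has no term in |a|^2, because lim Ps (Th x
   h^-1 Th y) is by definition the product of x and y. What is left is a d + (a d)^* + D, with d the
   difference to be shown zero. *)
apply: (@form_corner_eq0 _ _ _ D) => a.
have bs := bounded_star bc.
have bb : bounded_seq (fun n => a^* *: Th n y + c n).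
  by apply: boundedD => //; apply: boundedZ; exact: bin.
have pE : lim_out (fun n => a^* *: Th n y + c n) = a^* *: y + p.
  by rewrite (lim_outD (boundedZ _ (bin y)) bc) lim_outZ ?lim_out_in //; exact: bin.
have := lim_out_sqr bb; rewrite pE; congr positive.
have -> : (fun n => mul n (ostar (a^* *: Th n y + c n)) (a^* *: Th n y + c n)) =
    (fun n => (a * a^*) *: mul n (Th n x) (Th n y) + a *: mul n (Th n x) (c n) +
              (a^* *: mul n (ostar (c n)) (Th n y) + mul n (ostar (c n)) (c n))).
  apply: seq_ext => n.
  rewrite ostarD ostarZ conjCK -Th_star ostarK.
  rewrite (star_mulDl (mulP n)) !(star_mulDr (mulP n)) !(star_mulZl (mulP n)).
  by rewrite !(star_mulZr (mulP n)) scalerA.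
have bxy := bmul (bin x) (bin y); have bxc := bmul (bin x) bc.
have bcy := bmul bs (bin y); have bcc := bmul bs bc.
rewrite (lim_outD (boundedD (boundedZ (a * a^*) bxy) (boundedZ a bxc))
  (boundedD (boundedZ a^* bcy) bcc)).
rewrite (lim_outD (boundedZ (a * a^*) bxy) (boundedZ a bxc)).
rewrite (lim_outD (boundedZ a^* bcy) bcc) !lim_outZ // -/(lim_mul x y).
have mD z u v : lim_mul z (u + v) = lim_mul z u + lim_mul z v.
  by have := lim_mul_linear z 1 u v; rewrite !scale1r.
have mZ z e u : lim_mul z (e *: u) = e *: lim_mul z u.
  have m0 : lim_mul z 0 = 0.
    by apply: (addrI (lim_mul z 0)); rewrite -mD !addr0.
  by have := lim_mul_linear z e u 0; rewrite m0 !addr0.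
have mD' z u v : lim_mul (u + v) z = lim_mul u z + lim_mul v z.
  by apply: (inv_inj (@ostarK _ E)); rewrite ostarD !lim_mul_star ostarD mD.
have mZ' z e u : lim_mul (e *: u) z = e *: lim_mul u z.
  by apply: (inv_inj (@ostarK _ E)); rewrite ostarZ !lim_mul_star ostarZ mZ.
have -> : lim_out (fun n => mul n (ostar (c n)) (Th n y)) =
    ostar (lim_out (fun n => mul n (Th n x) (c n))).
  rewrite -lim_out_star //; congr lim_out.
  apply: seq_ext => n.
  by rewrite (star_mul_star (mulP n)) Th_star.
have -> : lim_mul (ostar (a^* *: y + p)) (a^* *: y + p) =
    (a * a^*) *: lim_mul x y + a *: lim_mul x p +
    (a^* *: ostar (lim_mul x p) + lim_mul (ostar p) p).
  rewrite ostarD ostarZ conjCK ostarK mD' !mZ' !mD !mZ scalerDr scalerA.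
  by rewrite lim_mul_star.
rewrite ostarZ ostarB scalerBr [a^* *: (_ - _)]scalerBr /D.
have sub (a1 a2 a3 a4 b2 b3 b4 : E) : a1 + a2 + (a3 + a4) -
    (a1 + b2 + (b3 + b4)) = a2 - b2 + (a3 - b3) + (a4 - b4).
  rewrite opprD addrACA !opprD [X in X + _]addrACA subrr add0r.
  by rewrite [X in _ + X]addrACA addrA.
exact: sub.
Qed.

Lemma lim_out_mulr x c : bounded_seq c ->
  lim_out (fun n => mul n (c n) (Th n x)) = lim_mul (lim_out c) x.
Proof.
move=> bc; apply: (inv_inj (@ostarK _ E)).
rewrite lim_mul_star -(lim_out_star bc) -(lim_out_mull _ (bounded_star bc)).
rewrite -lim_out_star; last exact: bmul.
by congr lim_out; apply: seq_ext => n; rewrite (star_mul_star (mulP n)) Th_star.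
Qed.

(** Moving the outer factor inside the limit turns both bracketings into the limit of the triple
    product in [A n]. *)
Lemma lim_mulA : associative lim_mul.
Proof.
move=> x y z; rewrite -lim_out_mull; last exact: bmul.
rewrite -lim_out_mulr; last exact: bmul.
by congr lim_out; apply: seq_ext => n; rewrite (star_mulA (mulP n)).
Qed.

Lemma lim_mul_mpos n k (X : 'M[E]_n) (W : 'M[E]_(n, k)) : mpos X ->
  mpos (\matrix_(i, j) \sum_p \sum_q
    lim_mul (lim_mul (ostar (W p i)) (X p q)) (W q j)).
Proof.
move=> pX; pose G i j p q := fun l =>
  mul l (mul l (Th l (ostar (W p i))) (Th l (X p q))) (Th l (W q j)).
have bG i j p q : bounded_seq (G i j p q) by apply: bmul (bmul _ _) _.
pose Y l : 'M[A l]_k := \matrix_(i, j) \sum_p \sum_q G i j p q l.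
have bGs i j p : bounded_seq (fun l => \sum_q G i j p q l).
  exact: bounded_sum.
have bY i j : bounded_seq (fun l => Y l i j).
  apply: bounded_ext (bounded_sum (index_enum _) (bGs i j)) => l.
  by rewrite mxE.
have : mpos (\matrix_(i, j) lim_out (fun l => Y l i j)).
  apply: lim_out_mpos => // l.
  have := star_mul_mpos (mulP l) (map_mx (Th l) W) (@af_in_cp _ _ (F l) _ _ pX).
  congr mpos; apply/matrixP => i j; rewrite !mxE; apply: eq_bigr => p _.
  by apply: eq_bigr => q _; rewrite /G !mxE Th_star.
congr mpos; apply/matrixP => i j; rewrite !mxE.
transitivity (lim_out (fun l => \sum_p \sum_q G i j p q l)).
  by congr lim_out; apply: seq_ext => l; rewrite mxE.
rewrite lim_out_sum //; apply: eq_bigr => p _.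
rewrite lim_out_sum //; apply: eq_bigr => q _.
rewrite lim_out_mulr; last exact: bmul.
by rewrite -/(lim_mul _ _).
Qed.

Lemma lim_mulP : star_mul ounit lim_mul.
Proof.
split; [exact: lim_mul_linear | exact: lim_mulA | exact: lim_mul1
  | exact: lim_mul_star | exact: lim_mul_mpos].
Qed.

End LimitProduct.

Lemma star_mul_exists (R : realType) (E : finOpSystemType R)
    (omega : {scalar E}) : omega ounit = 1 ->
  (forall e : R, 0 < e -> inhabited (approx_factor omega e)) ->
  exists m : E -> E -> E, star_mul ounit m.
Proof.
move=> omega1 H.
have [U [UU Uoo]] := free_ultrafilter.
have F (n : nat) : approx_factor omega n.+1%:R^-1.
  by apply: inhabited_witness; apply: H; rewrite invr_gt0.
exists (lim_mul F U); exact: lim_mulP.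
Qed.

(** * Wedderburn decomposition *)

Section Wedderburn.
Variable R : realType.
Local Notation C := R[i].
Variables (E : finOpSystemType R) (m : E -> E -> E).
Hypothesis mP : star_mul ounit m.
Local Notation "x ** y" := (m x y) (at level 40, left associativity).
Implicit Types (x y z v e : E) (V W : {vspace E}).

Let mA : associative m. Proof. exact: star_mulA mP. Qed.
Let m1 : left_id ounit m. Proof. exact: star_mul1l mP. Qed.
Let mr1 : right_id ounit m. Proof. exact: star_mul1r mP. Qed.
Let mstar x y : ostar (x ** y) = ostar y ** ostar x.
Proof. exact: star_mul_star mP x y. Qed.
Let mDr x y z : x ** (y + z) = x ** y + x ** z. Proof. exact: star_mulDr mP x y z. Qed.
Let mDl x y z : (y + z) ** x = y ** x + z ** x. Proof. exact: star_mulDl mP x y z. Qed.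
Let mZr a x y : x ** (a *: y) = a *: (x ** y). Proof. exact: star_mulZr mP a x y. Qed.
Let mZl a x y : (a *: y) ** x = a *: (y ** x). Proof. exact: star_mulZl mP a x y. Qed.
Let mBr x y z : x ** (y - z) = x ** y - x ** z. Proof. exact: star_mulBr mP x y z. Qed.
Let mBl x y z : (y - z) ** x = y ** x - z ** x. Proof. exact: star_mulBl mP x y z. Qed.
Let m0r x : x ** 0 = 0. Proof. exact: star_mul0r mP x. Qed.
Let m0l x : 0 ** x = 0. Proof. exact: star_mul0l mP x. Qed.

Let one_pos : positive (ounit : E).
Proof. by rewrite -[ounit]scale1r; apply: positive_unit; exact: ler01. Qed.

Let sqr_pos x : positive (ostar x ** x).
Proof. exact: (star_mul_positive mP x one_pos). Qed.

(** The Gram matrix of 1 and x has lower corner x^* x = 0, and a positive matrix with a zero corner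
    has zero off-diagonal entries. *)
Lemma star_mul_eq0 x : ostar x ** x = 0 -> x = 0.
Proof.
move=> xx0; apply: (@form_corner_eq0 _ _ _ ounit) => a.
have := star_mul_gram2 mP ounit x one_pos.
rewrite xx0 ostar_unit !m1 mr1 => /(mx22_form 1 a).
congr positive; rewrite rmorph1 !mul1r mulr1 scale1r scaler0 addr0 ostarZ.
by rewrite -addrA addrC.
Qed.

Definition left_ideal V := forall x v, v \in V -> x ** v \in V.

Lemma left_ideal_min V : left_ideal V -> V != 0%VS ->
  exists W, [/\ (W <= V)%VS, left_ideal W, W != 0%VS &
    forall W', (W' <= W)%VS -> left_ideal W' -> W' != 0%VS -> W' = W].
Proof.
have [n] := ubnP (\dim V); elim: n V => // n IH V Vn VI V0.
have [h|] := pselect (forall W', (W' <= V)%VS -> left_ideal W' -> W' != 0%VS -> W' = V).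
  by exists V; split.
move=> /existsNP[W /not_implyP[WV /not_implyP[WI /not_implyP[W0 WnV]]]].
have dW : (\dim W < \dim V)%N.
  rewrite ltn_neqAle dimvS // andbT; apply/eqP => d.
  by apply: WnV; apply/eqP; rewrite eqEdim WV d leqnn.
have [W' [W'W W'I W'0 W'P]] := IH W (leq_trans dW Vn) WI W0.
by exists W'; split=> //; apply: subv_trans WV.
Qed.

Lemma stable_eigenvector V (f : {linear E -> E}) : V != 0%VS ->
  (forall v, v \in V -> f v \in V) ->
  exists2 v, v \in V & v != 0 /\ exists a : C, f v = a *: v.
Proof.
move=> V0 fV; pose X := vbasis V; pose n := \dim V.
have n0 : (0 < n)%N by rewrite lt0n dimv_eq0.
pose A : 'M[C]_n := \matrix_(i, j) coord X j (f X`_i).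
have [a /eigenvalueP[u uA u0]] := eigenvalue_closed A n0.
have XV (i : 'I_n) : X`_i \in V by apply: vbasis_mem; rewrite mem_nth ?size_tuple.
exists (\sum_i u 0 i *: X`_i).
  by apply: memv_suml => i _; rewrite memvZ.
split.
  apply: contra u0 => /eqP /freeP h; apply/eqP/rowP => i; rewrite mxE.
  by apply: h; exact: basis_free (vbasisP V).
exists a; rewrite linear_sum scaler_sumr.
under eq_bigr => i _ do
  rewrite linearZ /= (coord_vbasis (fV _ (XV i))) scaler_sumr.
rewrite exchange_big; apply: eq_bigr => j _ /=.
have /matrixP/(_ 0 j) := uA; rewrite !mxE scalerA => <-.
by rewrite scaler_suml; apply: eq_bigr => i _; rewrite mxE scalerA.
Qed.

Definition rmul b : E -> E := fun x => x ** b.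
Fact rmul_linear b : linear (rmul b).
Proof. by move=> a x y; rewrite /rmul mDl mZl. Qed.
HB.instance Definition _ b := GRing.isLinear.Build C E E *:%R (rmul b) (rmul_linear b).

(** Schur's lemma: right multiplication by b commutes with left multiplications, so an eigenspace in
    W is again a left ideal and fills W. *)
Lemma left_ideal_schur W b : left_ideal W -> W != 0%VS ->
    (forall W', (W' <= W)%VS -> left_ideal W' -> W' != 0%VS -> W' = W) ->
  b \in W -> exists a : C, forall v, v \in W -> v ** b = a *: v.
Proof.
move=> WI W0 Wmin bW.
have [|v vW [v0 [a va]]] := @stable_eigenvector W (rmul b) W0.
  by move=> v _; apply: WI.
pose K := (W :&: lker (linfun (rmul b) - a *: \1%VF))%VS.
have KP w : (w \in K) = (w \in W) && (w ** b == a *: w).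
  rewrite memv_cap memv_ker !lfun_simp. by rewrite /= subr_eq0.
have KW : K = W.
  apply: Wmin; first exact: capvSl.
    move=> x w; rewrite !KP => /andP[wW /eqP wb].
    by rewrite WI // -mA wb mZr eqxx.
  apply: contraNneq v0 => K0; have : v \in K by rewrite KP vW; apply/eqP.
  by rewrite K0 memv0.
by exists a => w; rewrite -{1}KW KP => /andP[_ /eqP].
Qed.

(** For a nonzero x in W, h = x^* x acts on W from the right by a scalar l; h^2 = l h is
    self-adjoint and nonzero, so l is real and nonzero, and e = h / l is a projection and a right
    unit of W. *)
Lemma left_ideal_proj V : left_ideal V -> V != 0%VS ->
  exists W e, [/\ (W <= V)%VS, left_ideal W, [/\ e \in W, e != 0 & positive e],
    (forall v, v \in W -> v ** e = v) &
    forall x y, x \in W -> y \in W -> exists a : C, ostar y ** x = a *: e].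
Proof.
move=> /left_ideal_min h /h {h} [W [WV WI W0 Wmin]].
have schur b := @left_ideal_schur W b WI W0 Wmin.
pose x := vpick W; have x0 : x != 0 by rewrite vpick0.
have xW : x \in W := memv_pick W.
pose h := ostar x ** x.
have hW : h \in W by apply: WI.
have h0 : h != 0 by apply: contraNneq x0 => /star_mul_eq0 /eqP.
have sh : ostar h = h by rewrite /h mstar ostarK.
have [l lP] := schur h hW.
have l0 : l != 0.
  apply: contraNneq h0 => l0; apply/eqP/star_mul_eq0.
  by rewrite sh lP // l0 scale0r.
have ls : l^* = l.
  have : ostar (h ** h) = h ** h by rewrite mstar sh.
  rewrite lP // ostarZ sh => /eqP; rewrite -subr_eq0 -scalerBl scaler_eq0.
  by rewrite (negPf h0) orbF subr_eq0 => /eqP.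
pose e := l^-1 *: h.
have eW : e \in W by rewrite memvZ.
have se : ostar e = e.
  by rewrite ostarZ sh conj_Creal // rpredV; apply/CrealP.
have ve v : v \in W -> v ** e = v.
  by move=> vW; rewrite mZr lP // scalerA mulVf // scale1r.
exists W, e; split=> //.
  split=> //; first by rewrite scaler_eq0 invr_eq0 negb_or l0.
  by rewrite -[e]ve // -{1}se; exact: (star_mul_positive mP e one_pos).
move=> y z yW zW.
(* Schur's lemma for z^* y, at the vector e, gives e z^* y = a e, and e z^* = (z e)^* = z^*. *)
have [a aP] := schur (ostar z ** y) (WI _ _ yW); exists a.
by rewrite -aP // mA -{1}(ve _ zW) mstar se.
Qed.

Variable omega : {scalar E}.
Hypothesis omega_ge0 : forall x, positive x -> 0 <= omega x.
Hypothesis omega_faithful : faithful omega.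

(** The inner product on a minimal left ideal: the scalar a in y^* x = a e. Reading it off by omega
    keeps the positivity of omega at hand for matrices of such coefficients. *)
Definition coef e y x : C := omega (ostar y ** x) / omega e.

Lemma coefE e y x (a : C) : positive e -> e != 0 ->
  ostar y ** x = a *: e -> coef e y x = a.
Proof.
move=> pe e0 h; rewrite /coef h linearZ /= mulfK //.
by rewrite gt_eqF // omega_faithful.
Qed.

(** * Orthonormal bases of a minimal left ideal *)

Section OrthonormalBasis.
Variables (W : {vspace E}) (e : E).
Hypotheses (WI : left_ideal W) (eW : e \in W) (e0 : e != 0) (pe : positive e).
Hypothesis We : forall v, v \in W -> v ** e = v.
Hypothesis WW : forall x y, x \in W -> y \in W ->
  exists a : C, ostar y ** x = a *: e.

Lemma coefP x y : x \in W -> y \in W -> ostar y ** x = coef e y x *: e.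
Proof. by move=> xW yW; have [a h] := WW xW yW; rewrite (coefE pe e0 h). Qed.

Definition orthonormal k (x : 'I_k -> E) :=
  (forall i, x i \in W) /\
  (forall i j, ostar (x i) ** x j = (i == j)%:R *: e).

Lemma orthonormal_leq_dim k (x : 'I_k -> E) : orthonormal x -> (k <= \dim W)%N.
Proof.
move=> [xW xx]; pose X := [tuple x i | i < k].
have XE (i : 'I_k) : X`_i = x i by rewrite -tnth_nth tnth_mktuple.
have fX : free X.
  apply/freeP => c cX j; have := congr1 (m (ostar (x j))) cX.
  rewrite (star_mul_sumr mP) m0r (bigD1 j) //= big1 => [|i ij].
    rewrite mZr XE xx eqxx scale1r addr0.
    by move=> /eqP; rewrite scaler_eq0 (negPf e0) orbF => /eqP.
  rewrite mZr XE xx.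
  by rewrite eq_sym (negPf ij) scale0r scaler0.
have -> : k = size X by rewrite size_tuple.
rewrite -(eqP fX); apply: dimvS; apply/span_subvP => v /mapP[i _ ->]; exact: xW.
Qed.

(** One step of Gram-Schmidt: r is the component of v orthogonal to the x_i; its inner product with
    itself is positive by faithfulness, and its square root normalizes r. *)
Lemma orthonormal_extend k (x : 'I_k -> E) v : orthonormal x -> v \in W ->
  v <> \sum_i coef e (x i) v *: x i -> exists x' : 'I_k.+1 -> E, orthonormal x'.
Proof.
move=> [xW xx] vW nv; pose r := v - \sum_i coef e (x i) v *: x i.
have rW : r \in W by rewrite rpredB // memv_suml // => i _; rewrite memvZ.
have r0 : r != 0 by rewrite subr_eq0; apply/eqP.
have xr i : ostar (x i) ** r = 0.
  rewrite mBr (star_mul_sumr mP) (bigD1 i) //= big1 => [|j ji].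
    by rewrite mZr xx eqxx scale1r addr0 coefP // subrr.
  by rewrite mZr xx eq_sym (negPf ji) scale0r scaler0.
have rx i : ostar r ** x i = 0 by rewrite -[x i]ostarK -mstar xr ostar0.
have c0 : 0 < coef e r r.
  rewrite divr_gt0 ?omega_faithful //.
  by apply: contraNneq r0 => /star_mul_eq0 /eqP.
pose s := sqrtC (coef e r r); have s0 : 0 < s by rewrite sqrtC_gt0.
exists (fun i => if unlift ord0 i is Some j then x j else s^-1 *: r).
split=> [i|i j]; first by case: unliftP => // _; exact: memvZ.
case: (unliftP ord0 i) => [i' ->|->]; case: (unliftP ord0 j) => [j' ->|->].
- by rewrite (inj_eq lift_inj) xx.
- by rewrite mZr xr scaler0 scale0r.
- by rewrite ostarZ mZl rx scaler0 scale0r.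
rewrite ostarZ mZl mZr coefP // !scalerA eqxx; congr (_ *: _).
rewrite conj_Creal ?rpredV ?gtr0_real // -[coef _ _ _]sqrtCK -/s expr2.
by rewrite mulrACA mulVf ?gt_eqF // mul1r.
Qed.

Lemma orthonormal_basis : exists k (x : 'I_k -> E), orthonormal x /\
  forall v, v \in W -> v = \sum_i coef e (x i) v *: x i.
Proof.
(* The fuel n bounds the number of vectors still to be adjoined, as the length never exceeds dim
   W. *)
have ext (n : nat) : forall k (x : 'I_k -> E), orthonormal x ->
    (\dim W <= k + n)%N ->
    exists k (x : 'I_k -> E), orthonormal x /\
      forall v, v \in W -> v = \sum_i coef e (x i) v *: x i.
  elim: n => [|n IH] k x xO kn;
    (have [h|] := pselect (forall v, v \in W -> v = \sum_i coef e (x i) v *: x i);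
      first by exists k, x);
    move=> /existsNP[v /not_implyP[vW /(orthonormal_extend xO vW)[x' x'O]]].
    by have := leq_trans (orthonormal_leq_dim x'O) kn; rewrite addn0 ltnn.
  by apply: (IH _ x' x'O); rewrite addSnnS.
apply: (ext (\dim W) 0%N (fun i => 0)); last by rewrite add0n.
by split=> [[]|[]].
Qed.

End OrthonormalBasis.

Record block := Block {
  block_size : nat;
  block_vec : 'I_block_size -> E;
  block_proj : E
}.
Arguments block_vec : clear implicits.

Definition block_unit (B : block) : E :=
  \sum_a block_vec B a ** ostar (block_vec B a).

Record is_block (B : block) : Prop := IsBlock {
  block_size_gt0 : (0 < block_size B)%N;
  block_proj_pos : positive (block_proj B);
  block_proj_neq0 : block_proj B != 0;
  block_ortho : forall a b,
    ostar (block_vec B a) ** block_vec B b = (a == b)%:R *: block_proj B;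
  block_vec_proj : forall a, block_vec B a ** block_proj B = block_vec B a;
  block_expand : forall y, y ** block_unit B = \sum_b \sum_a
    coef (block_proj B) (block_vec B b) (y ** block_vec B a) *:
      (block_vec B b ** ostar (block_vec B a));
  block_unit_vec : forall a, block_unit B ** block_vec B a = block_vec B a;
  block_central : forall y, block_unit B ** y = y ** block_unit B
}.

Definition central_proj p :=
  [/\ forall y, p ** y = y ** p, ostar p = p & p ** p = p].

Fact corner_subproof p :
  {V : {vspace E} | forall v, (v \in V) = (v ** p == v)}.
Proof.
exists (lker (linfun (rmul p) - \1%VF)) => v.
by rewrite memv_ker !lfun_simp /= subr_eq0.
Qed.

Definition corner p : {vspace E} := sval (corner_subproof p).

Lemma cornerP p v : (v \in corner p) = (v ** p == v).
Proof. exact: (svalP (corner_subproof p)). Qed.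

Lemma corner_left_ideal p : left_ideal (corner p).
Proof. by move=> x v; rewrite !cornerP -mA => /eqP ->. Qed.

Lemma block_unit_star B : ostar (block_unit B) = block_unit B.
Proof.
by rewrite ostar_sum; apply: eq_bigr => a _; rewrite mstar ostarK.
Qed.

Lemma block_unit_central_proj B : is_block B -> central_proj (block_unit B).
Proof.
move=> BP; split; [exact: block_central | exact: block_unit_star |].
rewrite {2 3}/block_unit (star_mul_sumr mP); apply: eq_bigr => a _.
by rewrite mA block_unit_vec.
Qed.

Lemma block_exists p : central_proj p -> p != 0 ->
  exists B, [/\ is_block B, p ** block_unit B = block_unit B & block_unit B != 0].
Proof.
move=> [pc ps pp] p0.
have V0 : corner p != 0%VS.
  apply: contraNneq p0 => V0; have : p \in corner p by rewrite cornerP pp.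
  by rewrite V0 memv0.
have [W [e [WV WI [eW e0 pe] We WW]]] := left_ideal_proj (@corner_left_ideal p) V0.
have [k [x [[xW xx] xE]]] := orthonormal_basis e0 pe WW.
pose B := Block x e; pose c := block_unit B.
have cv v : v \in W -> c ** v = v.
  move=> vW; rewrite (star_mul_suml mP) [RHS]xE //; apply: eq_bigr => a _.
  by rewrite -mA (coefP e0 pe WW) // mZr We.
(* y c is a sum of terms (y x_a) x_a^* with y x_a in W, where c acts as 1. Adjoints then give c y =
   c y c = y c, so c is central. *)
have cyc y : c ** (y ** c) = y ** c.
  rewrite [y ** c](star_mul_sumr mP) (star_mul_sumr mP); apply: eq_bigr => a _.
  by rewrite [y ** _]mA mA cv // WI.
have sc : ostar c = c := block_unit_star B.
have cc y : c ** y = y ** c.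
  have := congr1 ostar (cyc (ostar y)).
  by rewrite !mstar sc ostarK -mA cyc => <-.
have k0 : (0 < k)%N.
  case: (posnP k) => // k0; exfalso; move: e0.
  rewrite (xE e eW) big1 ?eqxx // => i _.
  by have := ltn_ord i; rewrite [X in (_ < X)%N]k0.
have e_c : c ** e = e by exact: cv.
exists B; split.
- split=> //= [a|y|a]; [exact: We | | exact: cv].
  rewrite -/c (star_mul_sumr mP) [RHS]exchange_big; apply: eq_bigr => a _ /=.
  rewrite mA [y ** _ in LHS]xE; last exact: WI.
  by rewrite (star_mul_suml mP); apply: eq_bigr => b _; rewrite mZl.
- rewrite -/c /c /block_unit (star_mul_sumr mP); apply: eq_bigr => a _.
  rewrite mA pc; have := subvP WV _ (xW a); rewrite cornerP => /eqP ->.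
  by [].
- by apply: contraNneq e0 => c0; rewrite -e_c /c c0 m0l.
Qed.

(** Splitting a block unit c off p leaves the central projection p - c, whose corner is smaller: it
    is contained in that of p and misses c. *)
Lemma block_decomposition p : central_proj p ->
  exists l : seq block, (forall B, List.In B l -> is_block B) /\
    \sum_(B <- l) block_unit B = p.
Proof.
have [n] := ubnP (\dim (corner p)); elim: n p => // n IH p pn pP.
have [->|p0] := eqVneq p 0; first by exists [::]; rewrite big_nil.
have [B [BP pB B0]] := block_exists pP p0.
have [cc sc c2] := block_unit_central_proj BP; have [pc ps pp] := pP.
set c := block_unit B in cc sc c2 pB B0.
have Bp : c ** p = c by rewrite -pc.
have p'P : central_proj (p - c).
  split=> [y||]; first by rewrite mBl mBr pc cc.
    by rewrite ostarB ps sc.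
  by rewrite mBl !mBr pp pB Bp c2 subrr subr0.
have sub : (corner (p - c) <= corner p)%VS.
  apply/subvP => v; rewrite (cornerP (p - c)) (cornerP p) => /eqP vE.
  by rewrite -vE -mA mBl pp Bp.
have lt_dim : (\dim (corner (p - c)%R) < \dim (corner p))%N.
  rewrite ltn_neqAle dimvS // andbT; apply: contra B0 => /eqP d.
  have /eqP VV : corner (p - c) == corner p by rewrite eqEdim sub d leqnn.
  have : c \in corner p by rewrite cornerP Bp.
  by rewrite -VV cornerP mBr Bp c2 subrr eq_sym.
have [|l [lP lE]] := IH (p - c) _ p'P; first exact: leq_trans lt_dim pn.
exists (B :: l); split=> [B' [<-|/lP]|] //.
by rewrite big_cons lE addrC subrK.
Qed.


Lemma positive_sum_eq0 (I : finType) (F : I -> E) :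
  (forall i, positive (F i)) -> \sum_i F i = 0 -> forall i, F i = 0.
Proof.
move=> pF F0 i; apply: positive_proper => //.
suff <- : \sum_(j | j != i) F j = - F i by apply: positive_sum.
by apply/eqP; rewrite -addr_eq0 addrC; move: F0; rewrite (bigD1 i) //= => ->.
Qed.

Lemma wedderburn : exists (n : nat) (k : 'I_n -> nat),
  (forall j, (0 < k j)%N) /\
  unital_complete_order_iso E (dirsum (fun j => 'M[C]_(k j) : opSystemType R)).
Proof.
have one_cp : central_proj ounit.
  by split=> [y||]; rewrite ?m1 ?mr1 // ostar_unit.
have [l [lP lE]] := block_decomposition one_cp.
pose B (j : 'I_(size l)) := tnth (in_tuple l) j.
have BP j : is_block (B j).
  apply: lP; rewrite /B (tnth_nth (B j)) /=; move: (B j) => B1.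
  elim: l {B lE} j => [[]|B0 l IH] //= [[|j] jl] /=; first by left.
  by right; exact: (IH (Ordinal (jl : (j < size l)%N))).
have BE : \sum_j block_unit (B j) = ounit.
  by rewrite -lE [RHS]big_tnth.
pose x j a := block_vec (B j) a; pose e j := block_proj (B j).
pose c j := block_unit (B j).
(* Each c_i c_q is a projection, hence positive. Multiplying the sum of all c_q by c_i gives c_i =
   c_i c_i, so the terms with q != i are positive with sum 0 and vanish. *)
have BB i j : i != j -> c i ** c j = 0.
  move=> ij; have [ci si ii] := block_unit_central_proj (BP i).
  have [cj sj jj] := block_unit_central_proj (BP j).
  have pos q : positive (c i ** c q).
    have [cq sq qq] := block_unit_central_proj (BP q).
    suff -> : c i ** c q = ostar (c i ** c q) ** (c i ** c q) by [].
    rewrite mstar si sq -mA [c i ** (_ ** _)]mA ii mA -[c q ** c i]ci.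
    by rewrite -mA qq.
  pose F q := if q == i then 0 else c i ** c q.
  have -> : c i ** c j = F j by rewrite /F eq_sym (negPf ij).
  apply: positive_sum_eq0 => [q|].
    by rewrite /F; case: eqP => // _; exact: positive0.
  have : c i ** \sum_q c q = c i by rewrite BE mr1.
  rewrite (star_mul_sumr mP) (bigD1 i) //= ii -[RHS]addr0 => /addrI h.
  rewrite (bigD1 i) //= {1}/F eqxx add0r -[RHS]h; apply: eq_bigr => q /negPf qi.
  by rewrite /F qi.
have xx0 i j a b : i != j -> ostar (x i a) ** x j b = 0.
  move=> ij; rewrite /x -(block_unit_vec (BP i) a) -(block_unit_vec (BP j) b).
  rewrite mstar block_unit_star -mA [block_unit _ ** (_ ** _)]mA.
  by rewrite [block_unit _ ** block_unit _]BB // m0l m0r.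
(* The matrix of left multiplication by y on the j-th left ideal, in its orthonormal basis. *)
pose fm y j : 'M[C]_(block_size (B j)) :=
  \matrix_(a, b) coef (e j) (x j a) (y ** x j b).
pose D := dirsum (fun j => 'M[C]_(block_size (B j)) : opSystemType R).
pose f y : D := dirsum_of
  (V := fun j => 'M[C]_(block_size (B j)) : opSystemType R) (fm y).
pose Y j : 'M[E]_(block_size (B j)) := \matrix_(a, b) (x j a ** ostar (x j b)).
pose g (A : D) : E := \sum_j choi (Y j) (dirsum_proj j A).
have fE y j : dirsum_proj j (f y) = fm y j by rewrite /dirsum_proj ffunE.
have coef_lin j a (s : C) y z : coef (e j) (x j a) (s *: y + z) =
    s * coef (e j) (x j a) y + coef (e j) (x j a) z.
  by rewrite /coef mDr mZr linearP /= mulrDl mulrA.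
have f_lin : linear f.
  move=> s y z; apply: dirsumP => j; rewrite !ffunE; apply/matrixP => a b.
  by rewrite !mxE mDl mZl coef_lin.
have g_lin : linear g.
  move=> s y z; rewrite /g scaler_sumr -big_split; apply: eq_bigr => j _.
  by rewrite !linearP.
have coef_x i a b : coef (e i) (x i a) (x i b) = (a == b)%:R.
  apply: coefE; [exact: block_proj_pos | exact: block_proj_neq0 |].
  exact: block_ortho.
exists (size l), (fun j => block_size (B j)); split.
  by move=> j; exact: block_size_gt0.
exists (HB.pack f (GRing.isLinear.Build C E D *:%R f f_lin) : {linear E -> D}).
exists (HB.pack g (GRing.isLinear.Build C D E *:%R g g_lin) : {linear D -> E}).
split=> /=.
- move=> y; rewrite /g -[RHS]mr1 -BE (star_mul_sumr mP); apply: eq_bigr => j _.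
  rewrite (block_expand (BP j)) fE /choi; apply: eq_bigr => a _.
  by apply: eq_bigr => b _; rewrite !mxE.
- move=> A; apply: dirsumP => i; rewrite ffunE; apply/matrixP => a b; rewrite mxE.
  have -> : g A ** x i b = \sum_p dirsum_proj i A p b *: x i p.
    rewrite /g (star_mul_suml mP) (bigD1 i) //= big1 ?addr0 => [|j ji]; last first.
      rewrite /choi (star_mul_suml mP) big1 // => p _.
      rewrite (star_mul_suml mP) big1 // => q _.
      by rewrite mxE mZl -mA xx0 // m0r scaler0.
    rewrite /choi (star_mul_suml mP); apply: eq_bigr => p _.
    rewrite (star_mul_suml mP) (bigD1 b) //= big1 ?addr0 => [|q /negPf qb].
      rewrite mxE mZl -mA (block_ortho (BP i)) eqxx scale1r.
      by rewrite (block_vec_proj (BP i)).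
    by rewrite mxE mZl -mA (block_ortho (BP i)) qb scale0r m0r scaler0.
  apply: coefE; [exact: block_proj_pos | exact: block_proj_neq0 |].
  rewrite (star_mul_sumr mP) (bigD1 a) //= big1 ?addr0 => [|p /negPf pa].
    by rewrite mZr (block_ortho (BP i)) eqxx scale1r.
  by rewrite mZr (block_ortho (BP i)) eq_sym pa scale0r scaler0.
- apply: dirsumP => i; rewrite !ffunE; apply/matrixP => a b.
  by rewrite mxE m1 coef_x mxE.
- move=> n X pX j; rewrite matrix_mposE => v.
  (* The quadratic form of f X at v is omega (w^* X w) / omega e_j, with w_p = sum_a v_p(a) x_a. *)
  pose w : 'M[E]_(n, 1) := \col_p \sum_a v p a 0 *: x j a.
  have := star_mul_mpos mP w pX; rewrite mpos1E mxE => /omega_ge0 w0.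
  have := divr_ge0 w0 (omega_ge0 (block_proj_pos (BP j))); congr (0 <= _).
  rewrite linear_sum mulr_suml; apply: eq_bigr => p _.
  rewrite linear_sum mulr_suml; apply: eq_bigr => q _.
  have -> : map_mx (dirsum_proj j) (map_mx f X) p q = fm (X p q) j by rewrite !mxE fE.
  rewrite !mxE (star_mul_sumr mP) linear_sum mulr_suml; apply: eq_bigr => b _.
  rewrite !mxE mulr_suml ostar_sum mZr !(star_mul_suml mP) linearZ /= linear_sum.
  rewrite mulr_sumr mulr_suml; apply: eq_bigr => a _.
  rewrite !mxE ostarZ !mZl linearZ /= /coef -mA; ring.
- move=> n X pX; have -> : map_mx g X =
      \sum_j map_mx (choi (Y j)) (map_mx (dirsum_proj j) X).
    by apply/matrixP => p q; rewrite summxE !mxE; apply: eq_bigr => j _; rewrite !mxE.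
  apply: mpos_sum => j _; apply: choi_cp; last first.
    have dX : dirsum_mpos X := pX.
    exact: dX.
  (* [Y j] is the Gram matrix of the elements x_a^*. *)
  have := star_mul_gram mP (fun a => ostar (x j a)) one_pos; congr mpos.
  by apply/matrixP => a b; rewrite !mxE ostarK.
Qed.

End Wedderburn.

(** * Eventually scalar sequences of matrices *)

Section MatrixStarMul.
Variable R : realType.
Local Notation C := R[i].

(** The form of W^* X W at v is the form of X at W v. *)
Lemma matrix_mpos_conj k n l (X : 'M['M[C]_k]_n) (W : 'M['M[C]_k]_(n, l)) :
  mpos X ->
  mpos (\matrix_(i, j) \sum_p \sum_q ((W p i)^t* *m X p q *m W q j)).
Proof.
rewrite !matrix_mposE => pX v; have := pX (fun p => \sum_i W p i *m v i).
congr (0 <= _).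
transitivity (\sum_p \sum_q \sum_i \sum_j
    (((v i)^t* *m (W p i)^t* *m X p q *m W q j *m v j) 0 0)).
  apply: eq_bigr => p _; apply: eq_bigr => q _.
  have -> : (\sum_i W p i *m v i)^t* = \sum_i (W p i *m v i)^t*.
    apply/matrixP => a b; rewrite !mxE !summxE rmorph_sum.
    by apply: eq_bigr => i _; rewrite [in RHS]mxE [in RHS]mxE.
  rewrite !mulmx_suml summxE; apply: eq_bigr => i _.
  rewrite mulmx_sumr summxE; apply: eq_bigr => j _.
  by rewrite trmx_mul map_mxM !mulmxA.
under eq_bigr => p _ do rewrite exchange_big /=.
rewrite exchange_big; apply: eq_bigr => i _ /=.
under eq_bigr => p _ do rewrite exchange_big /=.
rewrite exchange_big; apply: eq_bigr => j _ /=.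
rewrite mxE mulmx_sumr mulmx_suml summxE; apply: eq_bigr => p _.
rewrite mulmx_sumr mulmx_suml summxE; apply: eq_bigr => q _.
by rewrite !mulmxA.
Qed.

Lemma matrix_positiveE k (A : 'M[C]_k) :
  positive A <-> forall v : 'cV[C]_k, 0 <= (v^t* *m A *m v) 0 0.
Proof.
have A11 : (A%:M : 'M['M[C]_k]_1) 0 0 = A by rewrite mxE eqxx.
rewrite /positive matrix_mposE; split=> pA v.
  by have := pA (fun _ => v); rewrite !big_ord1 A11.
by rewrite !big_ord1 A11; exact: pA.
Qed.

(** A row u in the kernel satisfies u A u^* + t |u|^2 = 0 with both terms nonnegative. *)
Lemma matrix_positive_unit k (A : 'M[C]_k) (t : R) : 0 < t -> positive A ->
  A + (t%:C)%:M \in unitmx.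
Proof.
move=> t0 /matrix_positiveE pA.
rewrite -row_free_unit -kermx_eq0; apply: contraT => /rowV0Pn[u].
move=> /sub_kermxP uA u0.
have := pA (u^t*); rewrite trmxCK => h.
have uu : (u *m u^t*) 0 0 = \sum_j `|u 0 j| ^+ 2.
  by rewrite mxE; apply: eq_bigr => j _; rewrite !mxE -normCK.
have : (u *m (A + (t%:C)%:M) *m u^t*) 0 0 = 0 by rewrite uA mul0mx mxE.
rewrite mulmxDr mulmxDl mxE mul_mx_scalar -scalemxAl [X in _ + X]mxE uu => /eqP.
rewrite paddr_eq0 //; last first.
  apply: mulr_ge0; first by rewrite ler0c ltW.
  by apply: sumr_ge0 => j _; rewrite exprn_ge0.
case/andP => _; rewrite mulf_eq0 eq_complex /= (gt_eqF t0) /= => /eqP /psumr_eq0P s0.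
case/eqP: u0; apply/rowP => j; rewrite mxE; apply/eqP.
by rewrite -normr_eq0 -sqrf_eq0 s0 // => i _; rewrite exprn_ge0.
Qed.

End MatrixStarMul.

Section BlockSystem.
Variables (R : realType) (k : nat -> nat).
Local Notation C := R[i].

(* Sequences of matrices that are eventually a scalar; the block at [None]
   holds this scalar. *)
Definition block_dim (o : option nat) : nat := if o is Some i then k i else 1.

Record blocks := Blocks {
  block_at :> forall o, 'M[C]_(block_dim o);
  block_at_eventually : exists N, forall i, (N <= i)%N ->
    block_at (Some i) = (block_at None 0 0)%:M
}.

HB.instance Definition _ := gen_eqMixin blocks.
HB.instance Definition _ := gen_choiceMixin blocks.

Implicit Types (x y z : blocks) (o : option nat).

Lemma blocksP x y : (forall o, x o = y o) -> x = y.
Proof.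
case: x y => [x Px] [y Py] /= xy.
have {}xy : x = y by exact: functional_extensionality_dep.
by rewrite -{}xy in Py *; congr Blocks; exact: Prop_irrelevance.
Qed.

Lemma blocks_bound (I : finType) (F : I -> blocks) : exists N, forall i j,
  (N <= j)%N -> F i (Some j) = (F i None 0 0)%:M.
Proof.
have [N NP] := choice (fun i => block_at_eventually (F i)).
exists (\max_i N i)%N => i j Nj; apply: NP.
by apply: leq_trans Nj; exact: leq_bigmax.
Qed.

Lemma blocks_bound2 x y : exists N, forall j, (N <= j)%N ->
  x (Some j) = (x None 0 0)%:M /\ y (Some j) = (y None 0 0)%:M.
Proof.
have [N NP] := blocks_bound (fun b : bool => if b then x else y).
by exists N => j Nj; have := NP true j Nj; have := NP false j Nj.
Qed.

Fact blocks_zero_subproof : exists N, forall i, (N <= i)%N ->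
  (0 : 'M[C]_(k i)) = ((0 : 'M[C]_1) 0 0)%:M.
Proof. by exists 0%N => i _; rewrite mxE raddf0. Qed.
Definition blocks_zero := @Blocks (fun o => 0) blocks_zero_subproof.

Fact blocks_unit_subproof : exists N, forall i, (N <= i)%N ->
  (1%:M : 'M[C]_(k i)) = ((1%:M : 'M[C]_1) 0 0)%:M.
Proof. by exists 0%N => i _; rewrite mxE. Qed.
Definition blocks_unit := @Blocks (fun o => 1%:M) blocks_unit_subproof.

Fact blocks_add_subproof x y : exists N, forall i, (N <= i)%N ->
  x (Some i) + y (Some i) = ((x None + y None) 0 0)%:M.
Proof.
have [N NP] := blocks_bound2 x y; exists N => i /NP [-> ->].
by rewrite mxE raddfD.
Qed.
Definition blocks_add x y := @Blocks (fun o => x o + y o) (blocks_add_subproof x y).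

Fact blocks_scale_subproof (a : C) x : exists N, forall i, (N <= i)%N ->
  a *: x (Some i) = ((a *: x None) 0 0)%:M.
Proof.
have [N NP] := block_at_eventually x; exists N => i /NP ->.
by rewrite mxE scale_scalar_mx.
Qed.
Definition blocks_scale a x := @Blocks (fun o => a *: x o) (blocks_scale_subproof a x).

Fact blocks_opp_subproof x : exists N, forall i, (N <= i)%N ->
  - x (Some i) = ((- x None) 0 0)%:M.
Proof.
have [N NP] := block_at_eventually x; exists N => i /NP ->.
by rewrite mxE raddfN.
Qed.
Definition blocks_opp x := @Blocks (fun o => - x o) (blocks_opp_subproof x).

Fact blocks_star_subproof x : exists N, forall i, (N <= i)%N ->
  (x (Some i))^t* = ((x None)^t* 0 0)%:M.
Proof.
have [N NP] := block_at_eventually x; exists N => i /NP ->.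
by rewrite !mxE tr_scalar_mx map_scalar_mx.
Qed.
Definition blocks_star x := @Blocks (fun o => (x o)^t*) (blocks_star_subproof x).

Fact blocks_mul_subproof x y : exists N, forall i, (N <= i)%N ->
  x (Some i) *m y (Some i) = ((x None *m y None) 0 0)%:M.
Proof.
have [N NP] := blocks_bound2 x y; exists N => i /NP [-> ->].
by rewrite mxE big_ord1 -scalar_mxM.
Qed.
Definition blocks_mul x y := @Blocks (fun o => x o *m y o) (blocks_mul_subproof x y).

Fact blocks_inv_subproof x : exists N, forall i, (N <= i)%N ->
  invmx (x (Some i)) = ((invmx (x None)) 0 0)%:M.
Proof.
have [N NP] := block_at_eventually x; exists N => i /NP ->.
have -> : invmx (x None) = ((x None 0 0)^-1)%:M.
  by rewrite {1}[x None]mx11_scalar invmx_scalar.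
by rewrite invmx_scalar [_%:M 0 0]mxE eqxx.
Qed.
Definition blocks_inv x := @Blocks (fun o => invmx (x o)) (blocks_inv_subproof x).

Fact blocks_addA : associative blocks_add.
Proof. by move=> x y z; apply: blocksP => o; rewrite /= addrA. Qed.
Fact blocks_addC : commutative blocks_add.
Proof. by move=> x y; apply: blocksP => o; rewrite /= addrC. Qed.
Fact blocks_add0 : left_id blocks_zero blocks_add.
Proof. by move=> x; apply: blocksP => o; rewrite /= add0r. Qed.
Fact blocks_addN : left_inverse blocks_zero blocks_opp blocks_add.
Proof. by move=> x; apply: blocksP => o; rewrite /= addNr. Qed.

HB.instance Definition _ := GRing.isZmodule.Build blocks
  blocks_addA blocks_addC blocks_add0 blocks_addN.

Fact blocks_scaleA a b x :
  blocks_scale a (blocks_scale b x) = blocks_scale (a * b) x.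
Proof. by apply: blocksP => o; rewrite /= scalerA. Qed.
Fact blocks_scale1 : left_id 1 blocks_scale.
Proof. by move=> x; apply: blocksP => o; rewrite /= scale1r. Qed.
Fact blocks_scaleDr : right_distributive blocks_scale +%R.
Proof. by move=> a x y; apply: blocksP => o; rewrite /= scalerDr. Qed.
Fact blocks_scaleDl x : {morph blocks_scale^~ x : a b / a + b >-> a + b}.
Proof. by move=> a b; apply: blocksP => o; rewrite /= scalerDl. Qed.

HB.instance Definition _ := GRing.Zmodule_isLmodule.Build C blocks
  blocks_scaleA blocks_scale1 blocks_scaleDr blocks_scaleDl.

Definition block_pr o x : 'M[C]_(block_dim o) := x o.

Fact block_pr_linear o : linear (block_pr o).
Proof. by []. Qed.

HB.instance Definition _ o := GRing.isLinear.Build C blocks 'M[C]_(block_dim o) *:%R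
  (block_pr o) (block_pr_linear o).

Definition blocks_mpos n (X : 'M[blocks]_n) : Prop :=
  forall o, mpos (map_mx (block_pr o) X).

Lemma blocks_mxP n (X Y : 'M[blocks]_n) :
  (forall o, map_mx (block_pr o) X = map_mx (block_pr o) Y) -> X = Y.
Proof.
move=> E; apply/matrixP => i j; apply: blocksP => o.
by have /matrixP/(_ i j) := E o; rewrite !mxE.
Qed.

Lemma block_pr_mxstar o n (X : 'M[blocks]_n) :
  map_mx (block_pr o) (mxstar blocks_star X) = mxstar ostar (map_mx (block_pr o) X).
Proof. by apply/matrixP => i j; rewrite !mxE. Qed.

Lemma block_pr_compress o m n (A : 'M[C]_(n, m)) (X : 'M[blocks]_n) :
  map_mx (block_pr o) (mxcompress A X) = mxcompress A (map_mx (block_pr o) X).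
Proof.
apply/matrixP => i j; rewrite !mxE linear_sum; apply: eq_bigr => p _.
by rewrite linear_sum; apply: eq_bigr => q _; rewrite linearZ !mxE.
Qed.

Lemma block_pr_unit o n (a : C) :
  map_mx (block_pr o) ((a *: blocks_unit)%:M : 'M[blocks]_n) = (a *: ounit)%:M.
Proof. by apply/matrixP => i j; rewrite !mxE linearMn linearZ. Qed.

Fact blocks_starD : {morph blocks_star : x y / x + y}.
Proof. by move=> x y; apply: blocksP => o; exact: matrix_starD. Qed.
Fact blocks_starZ a x : blocks_star (a *: x) = a^* *: blocks_star x.
Proof. by apply: blocksP => o; exact: matrix_starZ. Qed.
Fact blocks_starK : involutive blocks_star.
Proof. by move=> x; apply: blocksP => o; exact: matrix_starK. Qed.
Fact blocks_star_unit : blocks_star blocks_unit = blocks_unit.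
Proof. by apply: blocksP => o; exact: matrix_star_unit. Qed.

Fact blocks_mpos_star n (X : 'M[blocks]_n) : blocks_mpos X -> mxstar blocks_star X = X.
Proof.
by move=> pX; apply: blocks_mxP => o; rewrite block_pr_mxstar; exact: mpos_star (pX o).
Qed.

Fact blocks_mposD n (X Y : 'M[blocks]_n) :
  blocks_mpos X -> blocks_mpos Y -> blocks_mpos (X + Y).
Proof. by move=> pX pY o; rewrite map_mxD; exact: mposD (pX o) (pY o). Qed.

Fact blocks_mpos_compress m n (A : 'M[C]_(n, m)) (X : 'M[blocks]_n) :
  blocks_mpos X -> blocks_mpos (mxcompress A X).
Proof. by move=> pX o; rewrite block_pr_compress; exact: mpos_compress (pX o). Qed.

Fact blocks_mpos_proper n (X : 'M[blocks]_n) :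
  blocks_mpos X -> blocks_mpos (- X) -> X = 0.
Proof.
move=> pX nX; apply: blocks_mxP => o; rewrite map_mx0.
by apply: mpos_proper (pX o) _; rewrite -map_mxN; exact: nX.
Qed.

(** The embedding of scalars into M_l, written as a Choi map so that its complete positivity carries
    bounds on the tail over to late blocks. *)
Lemma choi_unit11 l (A : 'M[C]_1) :
  choi (ounit%:M : 'M['M[C]_l]_1) A = (A 0 0)%:M.
Proof. by rewrite /choi !big_ord1 mxE eqxx -scalemx1. Qed.

Fact blocks_unit_order n (X : 'M[blocks]_n) : mxstar blocks_star X = X ->
  exists2 t : R, 0 < t & blocks_mpos ((t%:C *: blocks_unit)%:M + X).
Proof.
move=> sX.
have bound o : exists t : R, 0 < t /\
    mpos ((t%:C *: ounit)%:M + map_mx (block_pr o) X).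
  have [|t t0 pt] := @ounit_order _ _ _ (map_mx (block_pr o) X).
    by rewrite -block_pr_mxstar sX.
  by exists t.
have [t tP] := choice bound.
have t0 o : 0 <= t o by case: (tP o) => /ltW.
have [N NP] := blocks_bound (fun p : 'I_n * 'I_n => X p.1 p.2).
(* Finitely many bounds suffice: beyond N every block is the image of the block at [None] under a
   unital completely positive map. *)
exists (t None + \sum_(i < N) t (Some (i : nat))).
  by apply: ltr_wpDr; [apply: sumr_ge0 | case: (tP None)].
move=> o; rewrite map_mxD block_pr_unit.
case: o => [i|]; last first.
  rewrite addrC splitunit addrA; apply: mposD; last exact/mpos_unit/sumr_ge0.
  by rewrite addrC; case: (tP None).
have [Ni|iN] := leqP N i.
  rewrite splitunit addrAC; apply: mposD; last exact/mpos_unit/sumr_ge0.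
  have U1 : mpos (ounit%:M : 'M['M[C]_(k i)]_1).
    have := mpos_unit ('M[C]_(k i) : opSystemType R) 1 ler01; congr mpos.
    by rewrite [_%:C]rmorph1 scale1r.
  have [_ /(choi_cp U1)] := tP None.
  rewrite map_mxD; congr mpos; congr (_ + _); apply/matrixP => p q.
    rewrite !mxE /= choi_unit11 !matrix_ounitE; case: (p == q).
      by rewrite !mulr1n !mxE eqxx mulr1 scalemx1.
    by rewrite !mulr0n mxE raddf0.
  by rewrite !mxE /= choi_unit11 /block_pr (NP (p, q)).
rewrite (bigD1 (Ordinal iN)) //= addrCA splitunit addrAC.
apply: mposD; first by case: (tP (Some i)).
by apply: mpos_unit; rewrite addr_ge0 ?sumr_ge0.
Qed.

Fact blocks_unit_archi n (X : 'M[blocks]_n) :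
  (forall e : R, 0 < e -> blocks_mpos ((e%:C *: blocks_unit)%:M + X)) ->
  blocks_mpos X.
Proof.
move=> pX o; apply: ounit_archi => e e0.
by have := pX e e0 o; rewrite map_mxD block_pr_unit.
Qed.

HB.instance Definition _ := isOpSystem.Build R blocks
  blocks_starD blocks_starZ blocks_starK blocks_star_unit
  blocks_mpos_star blocks_mposD blocks_mpos_compress
  blocks_mpos_proper blocks_unit_order blocks_unit_archi.

(* The product twisted by the inverse of h, for which h is the unit. *)
Definition blocks_tmul h x y := blocks_mul (blocks_mul x (blocks_inv h)) y.

Lemma blocks_star_mul h (t : R) : 0 < t -> positive (h - t%:C *: ounit) ->
  star_mul h (blocks_tmul h).
Proof.
move=> t0 ph.
have uh o : h o \in unitmx.
  have p : positive (h o - (t%:C)%:M).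
    have pM : blocks_mpos ((h - t%:C *: ounit)%:M : 'M[blocks]_1) := ph.
    have := pM o; congr mpos; apply/matrixP => i j.
    by rewrite !mxE !ord1 eqxx !mulr1n /block_pr /= scalemx1.
  by have := matrix_positive_unit t0 p; rewrite subrK.
have sh : ostar h = h.
  have := positive_star ph; rewrite ostarB ostarZ conjRC ostar_unit.
  exact: addIr.
have sg o : (invmx (h o))^t* = invmx (h o).
  have sho : (h o)^t* = h o by rewrite -[in RHS]sh.
  by rewrite trmx_inv map_invmx sho.
split.
- move=> x a y z; apply: blocksP => o /=.
  by rewrite mulmxDr -scalemxAr.
- by move=> x y z; apply: blocksP => o /=; rewrite !mulmxA.
- by move=> x; apply: blocksP => o /=; rewrite mulmxV // mul1mx.
- move=> x y; apply: blocksP => o /=.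
  by rewrite !trmx_mul !map_mxM sg !mulmxA.
move=> n l X W pX o.
have pX' : blocks_mpos X := pX.
(* The twisted product gives W^* h^-1 X h^-1 W, the conjugation of X by h^-1 W. *)
have := matrix_mpos_conj (map_mx (fun x => invmx (h o) *m x o) W) (pX' o).
congr mpos; apply/matrixP => i j; rewrite !mxE linear_sum; apply: eq_bigr => p _.
rewrite linear_sum; apply: eq_bigr => q _; rewrite !mxE /block_pr /=.
by rewrite trmx_mul map_mxM sg !mulmxA.
Qed.

End BlockSystem.

(** * Operator systems as quotients of sequence systems *)

Section BlockQuotient.
Variables (R : realType) (k : nat -> nat) (E : opSystemType R).
Local Notation C := R[i].
Local Notation S := (blocks R k).

Variable Q : forall i, 'M[E]_(k i).
Hypothesis Q_mpos : forall i, mpos (Q i).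
Hypothesis Q_sum : forall N, positive (ounit - \sum_(i < N) choi (Q i) ounit).

(** With scalar tail l this is l 1 + sum_(i<N) choi (Q i) (x_i - l 1), arranged so that every
    summand is visibly completely positive in x. *)
Definition blocks_out_at N (x : S) : E :=
  \sum_(i < N) choi (Q i) (x (Some (i : nat))) +
  choi ((ounit - \sum_(i < N) choi (Q i) ounit)%:M : 'M_1) (x None).

Lemma choi11 (y : E) (A : 'M[C]_1) : choi (y%:M : 'M_1) A = A 0 0 *: y.
Proof. by rewrite /choi !big_ord1 mxE eqxx. Qed.

Lemma blocks_out_at_linear N : linear (blocks_out_at N).
Proof.
move=> a x y; rewrite /blocks_out_at linearP scalerDr addrACA; congr (_ + _).
rewrite scaler_sumr -big_split; apply: eq_bigr => i _.
by rewrite linearP.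
Qed.

HB.instance Definition _ N := GRing.isLinear.Build C S E *:%R
  (blocks_out_at N) (blocks_out_at_linear N).

Lemma blocks_out_at_cp N : completely_positive (blocks_out_at N).
Proof.
move=> n X pX.
have -> : map_mx (blocks_out_at N) X =
    \sum_(i < N) map_mx (choi (Q i)) (map_mx (block_pr (Some (i : nat))) X) +
    map_mx (choi ((ounit - \sum_(i < N) choi (Q i) ounit)%:M : 'M_1))
      (map_mx (block_pr None) X).
  apply/matrixP => p q; rewrite [LHS]mxE [RHS]mxE summxE !mxE; congr (_ + _).
  by apply: eq_bigr => i _; rewrite !mxE.
have pX' : blocks_mpos X := pX.
apply: mposD; last exact: choi_cp (Q_sum N) _ _ (pX' None).
by apply: mpos_sum => i _; exact: choi_cp (Q_mpos i) _ _ (pX' (Some (i : nat))).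
Qed.

(** A block that already equals the tail scalar l adds l choi (Q M) 1 to the sum and takes the same
    amount from the tail term. *)
Lemma blocks_out_at_stable N (x : S) :
  (forall i, (N <= i)%N -> x (Some i) = (x None 0 0)%:M) ->
  forall M, (N <= M)%N -> blocks_out_at M x = blocks_out_at N x.
Proof.
move=> xN M; elim: M => [|M IH]; first by rewrite leqn0 => /eqP ->.
rewrite leq_eqVlt => /orP[/eqP -> //|]; rewrite ltnS => NM.
rewrite -IH // /blocks_out_at !big_ord_recr /= !choi11 xN //.
have -> : choi (Q M) (x None 0 0)%:M = x None 0 0 *: choi (Q M) ounit.
  by rewrite -linearZ /= -scalemx1.
by rewrite opprD addrA scalerBr addrACA subrr addr0.
Qed.

Definition blocks_out (x : S) : E :=
  blocks_out_at (projT1 (cid (block_at_eventually x))) x.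

Lemma blocks_outE N (x : S) :
  (forall i, (N <= i)%N -> x (Some i) = (x None 0 0)%:M) ->
  blocks_out x = blocks_out_at N x.
Proof.
move=> xN; rewrite /blocks_out; case: cid => M /= xM.
have [MN|NM] := leqP M N; first by rewrite (blocks_out_at_stable xM MN).
by rewrite (blocks_out_at_stable xN (ltnW NM)).
Qed.

Lemma blocks_out_linear : linear blocks_out.
Proof.
move=> a x y.
have [N NP] := blocks_bound (fun i : 'I_3 => nth (a *: x + y) [:: x; y] i).
rewrite (blocks_outE (NP 2)) (blocks_outE (NP 0)) (blocks_outE (NP 1)).
by rewrite linearP.
Qed.

HB.instance Definition _ := GRing.isLinear.Build C S E *:%R
  blocks_out blocks_out_linear.

Lemma blocks_out_cp : completely_positive blocks_out.
Proof.
move=> n X /(@blocks_out_at_cp _ n).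
have [N NP] := blocks_bound (fun p : 'I_n * 'I_n => X p.1 p.2).
move=> /(_ N); congr mpos; apply/matrixP => i j; rewrite !mxE.
by rewrite (blocks_outE (NP (i, j))).
Qed.

Lemma blocks_out_unital : unital blocks_out.
Proof.
rewrite /unital (@blocks_outE 0%N); last by move=> i _; rewrite [in RHS]mxE.
by rewrite /blocks_out_at !big_ord0 add0r subr0 choi11 mxE scale1r.
Qed.

Fact block_unit_mx_subproof (i a b : nat) : exists N, forall j, (N <= j)%N ->
  \matrix_(p < k j, q < k j)
    ((j == i) && (p == a :> nat) && (q == b :> nat))%:R =
  ((0 : 'M[C]_1) 0 0)%:M :> 'M[C]_(k j).
Proof.
exists i.+1 => j ij; rewrite mxE raddf0; apply/matrixP => p q.
by rewrite !mxE gtn_eqF.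
Qed.

Definition block_unit_mx (i a b : nat) : S := @Blocks R k
  (fun o => if o is Some j then \matrix_(p < k j, q < k j)
     ((j == i) && (p == a :> nat) && (q == b :> nat))%:R else 0)
  (block_unit_mx_subproof i a b).

Lemma block_unit_mx_diag i (a b : 'I_(k i)) :
  block_unit_mx i a b (Some i) = delta_mx a b.
Proof. by apply/matrixP => p q; rewrite !mxE eqxx. Qed.

Lemma block_unit_mx_off i j (a b : 'I_(k i)) : j != i ->
  block_unit_mx i a b (Some j) = 0.
Proof. by move=> /negPf ji; apply/matrixP => p q; rewrite !mxE ji. Qed.

Lemma blocks_out_unit_mx i (a b : 'I_(k i)) :
  blocks_out (block_unit_mx i a b) = Q i a b.
Proof.
have x0 : block_unit_mx i a b None = 0 by [].
move: (block_unit_mx i a b) (block_unit_mx_diag a b)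
  (fun j => @block_unit_mx_off i j a b) x0 => x xd xo x0.
rewrite (@blocks_outE i.+1) => [|j ij]; last first.
  by rewrite xo ?gtn_eqF // x0 mxE raddf0.
rewrite /blocks_out_at choi11 x0 mxE scale0r addr0 big_ord_recr /=.
rewrite xd choi_delta big1 ?add0r // => j _.
by rewrite xo ?linear0 // ltn_eqF.
Qed.

Lemma block_unit_mx_mpos i :
  mpos (\matrix_(a, b < k i) block_unit_mx i a b : 'M[S]_(k i)).
Proof.
move=> o; case: o => [j|].
  have [->|ji] := eqVneq j i.
    have := @delta_mx_mpos R (k i); congr mpos.
    by apply/matrixP => a b; rewrite !mxE /block_pr block_unit_mx_diag.
  have := @mpos0 R ('M[C]_(k j) : opSystemType R) (k i); congr mpos.
  by apply/matrixP => a b; rewrite !mxE /block_pr block_unit_mx_off.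
have := @mpos0 R ('M[C]_1 : opSystemType R) (k i); congr mpos.
by apply/matrixP => a b; rewrite !mxE.
Qed.

Lemma blocks_out_lift i : exists P : 'M[S]_(k i),
  mpos P /\ map_mx blocks_out P = Q i.
Proof.
exists (\matrix_(a, b) block_unit_mx i a b); split.
  exact: block_unit_mx_mpos.
by apply/matrixP => a b; rewrite !mxE blocks_out_unit_mx.
Qed.

End BlockQuotient.

(* Psi maps a sequence x with scalar tail l to l + sum_i choi (c_i W_i) (x_i - l);
   it is positive because the scalars c_i make the traces of the c_i W_i sum up
   to at most 1. *)
Lemma blocks_quotient (R : realType) (E : opSystemType R) (k : nat -> nat)
    (W : forall i, 'M[E]_(k i)) : (forall i, mpos (W i)) ->
  exists Psi : {linear blocks R k -> E}, [/\ unital Psi, completely_positive Psi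
    & forall i, exists P, mpos P /\ map_mx Psi P = W i].
Proof.
move=> pW.
have trE i (c : R) : choi (map_mx ( *:%R c%:C) (W i)) ounit =
    c%:C *: choi (W i) ounit.
  rewrite /choi scaler_sumr; apply: eq_bigr => a _; rewrite scaler_sumr.
  by apply: eq_bigr => b _; rewrite [map_mx _ _ a b]mxE !scalerA mulrC.
have one_pos j : positive (ounit : 'M[R[i]]_j).
  by rewrite -[ounit]scale1r; apply: positive_unit; exact: ler01.
(* The weights 2^-(i+1) have partial sums 1 - 2^-N, below 1; c_i scales the order bound s of the
   trace of W_i down to the i-th weight. *)
have cex i : exists c : R, 0 < c /\
    positive ((2^-1 ^+ i.+1)%:C *: ounit - choi (map_mx ( *:%R c%:C) (W i)) ounit).
  have py : positive (choi (W i) ounit).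
    have := choi_cp (pW i) (one_pos (k i)); congr mpos.
    by apply/matrixP => p q; rewrite !mxE !ord1 eqxx.
  have [|s s0 ps] := @positive_order _ _ (- choi (W i) ounit).
    by rewrite ostarN (positive_star py).
  have c0 : 0 < 2^-1 ^+ i.+1 / s by rewrite divr_gt0 ?exprn_gt0 ?invr_gt0.
  exists (2^-1 ^+ i.+1 / s); split=> //; rewrite trE.
  have := positive_scale (ltW c0) ps; congr positive.
  by rewrite scalerDr scalerN scalerA -rmorphM /= divfK ?lt0r_neq0.
have [c cP] := choice cex.
pose Q i := map_mx ( *:%R (c i)%:C) (W i).
have Q_mpos i : mpos (Q i) by apply: mpos_scale (pW i); case: (cP i) => /ltW.
have Q_sum N : positive (ounit - \sum_(i < N) choi (Q i) ounit).
  have s1 : 1 - 2^-1 ^+ N = \sum_(i < N) 2^-1 ^+ i.+1 :> R.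
    elim: N => [|N IH]; first by rewrite big_ord0 expr0 subrr.
    by rewrite big_ord_recr /= -IH exprS; lra.
  have p1 : positive (\sum_(i < N) ((2^-1 ^+ i.+1)%:C *: ounit - choi (Q i) ounit)).
    by apply: positive_sum => i _; case: (cP i).
  have := positiveD p1 (positive_unit E (exprn_ge0 N _ : 0 <= 2^-1 ^+ N)).
  rewrite invr_ge0 ler0n => /(_ isT); congr positive.
  rewrite sumrB -scaler_suml -rmorph_sum /= -s1 addrAC -scalerDl -rmorphD.
  by rewrite subrK rmorph1 scale1r.
exists (blocks_out Q); split; first exact: blocks_out_unital.
  exact: blocks_out_cp.
move=> i; have [P [pP PE]] := blocks_out_lift Q i.
have [c0 _] := cP i.
exists (map_mx ( *:%R ((c i)^-1)%:C) P); split.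
  by apply: mpos_scale pP; rewrite invr_ge0 ltW.
apply/matrixP => a b; rewrite !mxE linearZ /=.
have /matrixP/(_ a b) := PE; rewrite !mxE => ->.
by rewrite scalerA -rmorphM /= mulVf ?lt0r_neq0 // [_%:C]rmorph1 scale1r.
Qed.

(** * Density of rational matrices *)

Lemma scale_half (F : numFieldType) (V : lmodType F) (v : V) :
  2^-1 *: (v + v) = v.
Proof.
by rewrite -mulr2n -[v *+ 2]scaler_nat scalerA mulVf ?pnatr_eq0 // scale1r.
Qed.

Section RationalMatrices.
Variables (R : realType) (E : finOpSystemType R).
Local Notation C := R[i].
Local Notation d := (\dim {:E}).+1.

(** The extra generator 1 at index 0 lets integer multiples of the order unit be added within the
    rational coefficients. *)
Definition gen (l : 'I_d) : E :=
  if unlift ord0 l is Some j then (vbasis {:E})`_j else ounit.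

Lemma gen_span (y : E) : exists z : 'I_d -> C, y = \sum_l z l *: gen l.
Proof.
exists (fun l => if unlift ord0 l is Some j then coord (vbasis {:E}) j y else 0).
rewrite big_ord_recl unlift_none scale0r add0r {1}(coord_vbasis (memvf y)).
by apply: eq_bigr => j _; rewrite /gen liftK.
Qed.

Definition rat_complex (r : rat * rat) : C := (ratr r.1)%:C + 'i%C * (ratr r.2)%:C.

Lemma rat_complex_dense (z : C) (e : R) : 0 < e -> exists r,
  `|complex.Re (rat_complex r - z)| <= e /\ `|complex.Im (rat_complex r - z)| <= e.
Proof.
move=> e0.
have dense (x : R) : exists q : rat, `|ratr q - x| <= e.
  have [|q] := @rat_in_itvoo R (x - e) (x + e); first by lra.
  rewrite in_itv /= => /andP[q1 q2]; exists q.
  by rewrite ler_norml; apply/andP; split; lra.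
have [p pz] := dense (complex.Re z); have [q qz] := dense (complex.Im z).
exists (p, q); case: z pz qz => a b /= pz qz; rewrite /rat_complex /=.
by rewrite !(mul0r, mul1r, mulr0, subr0, addr0, add0r).
Qed.

Local Notation code := {n : nat & 'M['rV[rat * rat]_d]_n}.

Definition rat_mx (t : code) : 'M[E]_(tag t) :=
  \matrix_(a, b) \sum_l rat_complex (tagged t a b 0 l) *: gen l.

(** Self-adjointness is built in, so that arbitrary rational coefficients close enough to those of a
    strictly positive matrix give a positive one. *)
Definition rat_sa_mx (t : code) : 'M[E]_(tag t) :=
  rat_mx t + mxstar ostar (rat_mx t).

Definition code_of (i : nat) : code :=
  odflt (Tagged (fun n => 'M['rV[rat * rat]_d]_n) (const_mx 0 : 'M_0)) (unpickle i).

(** So that every natural number indexes a block with a positive matrix, matrices that are not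
    positive are replaced by 0, and numbers that encode nothing stand for the empty matrix. *)
Lemma rat_cover : exists (k : nat -> nat) (Psi : {linear blocks R k -> E}),
  [/\ unital Psi, completely_positive Psi
    & forall t : code, mpos (rat_sa_mx t) ->
      exists P, mpos P /\ map_mx Psi P = rat_sa_mx t].
Proof.
pose W t : 'M[E]_(tag t) := if `[< mpos (rat_sa_mx t) >] then rat_sa_mx t else 0.
have pW i : mpos (W (code_of i)).
  by rewrite /W; case: asboolP => // _; exact: mpos0.
have [Psi [Psi1 Psi_cp PsiP]] := blocks_quotient pW.
exists (fun i => tag (code_of i)), Psi; split=> // t pt.
have := PsiP (pickle t); have -> : code_of (pickle t) = t by rewrite /code_of pickleK.
by rewrite /W asboolT.
Qed.

Lemma norm_le_complex (V : opSystemType R) (y : V) : exists2 T : R, 0 < T &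
  forall (e : R) (z : C), 0 <= e -> `|complex.Re z| <= e -> `|complex.Im z| <= e ->
    norm_le (e * T) (z *: y).
Proof.
have [s s0 sP] := norm_le_ex y; have [t t0 tP] := norm_le_ex ('i%C *: y).
have real_scale (u e r : R) (v : V) : 0 < u -> `|r| <= e -> norm_le u v ->
    norm_le (e * u) (r%:C *: v).
  move=> u0 re uv; apply: (@norm_leW _ _ (`|r| * u)); first by rewrite ler_wpM2r // ltW.
  have [r0|r0] := leP 0 r; first by rewrite ger0_norm //; exact: norm_le_scale.
  rewrite ltr0_norm // -[r in X in norm_le _ X]opprK rmorphN scaleNr.
  by apply/norm_leN/norm_le_scale => //; rewrite oppr_ge0 ltW.
exists (s + t); first exact: addr_gt0.
move=> e z e0 re im; rewrite [z in X in norm_le _ X]complexE scalerDl mulrDr.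
apply: norm_leD; first exact: (real_scale _ _ _ _ s0 re sP).
by rewrite ['i%C * _]mulrC -scalerA; exact: (real_scale _ _ _ _ t0 im tP).
Qed.

(** The constant depends on n and h but not on the coefficients. It is used for the generators of E
    and for their images in S, to control one perturbation in both systems. *)
Lemma small_combination_mpos (V : opSystemType R) n (h : 'I_d -> V) :
  exists2 T : R, 0 < T & forall (e : R) (Z : 'I_n -> 'I_n -> 'I_d -> C), 0 <= e ->
    (forall a b l, `|complex.Re (Z a b l)| <= e /\ `|complex.Im (Z a b l)| <= e) ->
    let H := \matrix_(a, b) \sum_l Z a b l *: h l in
    mpos (((e * T)%:C *: ounit)%:M + (H + mxstar ostar H)).
Proof.
have [T TP] := choice (fun l => let: ex_intro2 T T0 TP := norm_le_complex (h l) in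
   ex_intro _ T (conj T0 TP)).
pose s := \sum_l T l; have s0 : 0 <= s by apply: sumr_ge0 => l _; case: (TP l) => /ltW.
(* The summand 1 keeps the constant positive when n = 0. *)
exists (n%:R * (s + s) + 1); first by rewrite ltr_wpDl // mulr_ge0 // addr_ge0.
move=> e Z e0 ZP H.
have Hn a b : norm_le (e * s) (H a b).
  rewrite mxE mulr_sumr; apply: norm_le_sum => l.
  by have [_ h'] := TP l; have [re im] := ZP a b l; exact: h'.
have p : mpos (((n%:R * (e * s + e * s))%:C *: ounit)%:M + (H + mxstar ostar H)).
  apply: mpos_norm_le => [|a b].
    by apply/matrixP => a b; rewrite !mxE ostarD ostarK addrC.
  by rewrite !mxE; apply: norm_leD; [have := Hn a b; rewrite mxE
    |apply: norm_le_star; have := Hn b a; rewrite mxE].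
have -> : e * (n%:R * (s + s) + 1) = e + n%:R * (e * s + e * s) by ring.
by rewrite splitunit -addrA; apply: mposD p; exact: mpos_unit.
Qed.

End RationalMatrices.

(** * Surjectivity of the cover, a self-adjoint section, and approximate lifts of positive
    matrices *)

Section Cover.
Variables (R : realType) (E : finOpSystemType R).
Local Notation C := R[i].
Local Notation d := (\dim {:E}).+1.
Variables (k : nat -> nat) (Psi : {linear blocks R k -> E}).
Local Notation S := (blocks R k).
Hypotheses (Psi1 : unital Psi) (Psi_cp : completely_positive Psi).
Hypothesis PsiP : forall t : {n : nat & 'M['rV[rat * rat]_d]_n},
  mpos (rat_sa_mx t) -> exists P, mpos P /\ map_mx Psi P = rat_sa_mx t.

Let Psi_star x : Psi (ostar x) = ostar (Psi x).
Proof. exact: cp_star_preserving Psi_cp x. Qed.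

(** A self-adjoint element becomes positive after adding a large integer multiple of 1, hence has a
    preimage by [PsiP]; as Psi is unital, the multiple can then be removed. *)
Let gen_image (r : rat * rat) (j : 'I_(\dim {:E})) : exists x, Psi x =
  rat_complex R r *: (vbasis {:E})`_j + ostar (rat_complex R r *: (vbasis {:E})`_j).
Proof.
set y := _ *: _; have [t t0 py] : exists2 t : R, 0 < t &
    positive (t%:C *: ounit + (y + ostar y)).
  by apply: positive_order; rewrite ostarD ostarK addrC.
pose m := Num.trunc t.
pose v : 'rV[rat * rat]_d := \row_(l < d)
  if unlift (ord0 : 'I_d) l is Some j' then if j' == j then r else 0 else (m.+1%:R, 0).
pose c := Tagged (fun n => 'M['rV[rat * rat]_d]_n) (const_mx v : 'M_1).
have rat0 : rat_complex R 0 = 0.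
  by rewrite /rat_complex /= !rmorph0 mulr0 addr0.
have ratm : rat_complex R (m.+1%:R, 0) = m.+1%:R.
  by rewrite /rat_complex /= ratr_nat rmorph_nat !rmorph0 mulr0 addr0.
have cE : rat_mx c 0 0 = m.+1%:R *: ounit + y.
  rewrite mxE big_ord_recl !mxE unlift_none ratm /gen unlift_none; congr (_ + _).
  rewrite (bigD1 j) //= !mxE liftK eqxx big1 ?addr0 // => l /negPf lj.
  by rewrite !mxE liftK lj rat0 scale0r.
have sE : rat_sa_mx c 0 0 = (m.+1%:R *+ 2) *: ounit + (y + ostar y).
  have -> : rat_sa_mx c 0 0 = rat_mx c 0 0 + ostar (rat_mx c 0 0).
    by rewrite /rat_sa_mx [LHS]mxE [X in _ + X]mxE.
  by rewrite cE ostarD ostarZ ostar_unit conjC_nat addrACA -scalerDl -mulr2n.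
have pc : mpos (rat_sa_mx c).
  rewrite mpos1E sE; have mt : 0 <= m.+1%:R *+ 2 - t.
    rewrite subr_ge0; apply: le_trans (ltW (truncnS_gt t)) _.
    by rewrite mulr2n lerDl.
  have := positiveD (positive_unit E mt) py; congr positive.
  by rewrite addrA -scalerDl -rmorphD subrK rmorphMn rmorph_nat.
have [P [_ /matrixP/(_ 0 0)]] := PsiP pc.
rewrite mxE sE => PE; exists (P 0 0 - (m.+1%:R *+ 2) *: ounit).
by rewrite linearB linearZ /= Psi1 PE addrAC subrr add0r.
Qed.

Lemma cover_onto y : exists x, Psi x = y.
Proof.
have basis_image (j : 'I_(\dim {:E})) : exists x, Psi x = (vbasis {:E})`_j.
  have [x1 x1E] := gen_image (1, 0) j; have [xi xiE] := gen_image (0, 1) j.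
  have r1 : rat_complex R (1, 0) = 1.
    by rewrite /rat_complex /= !rmorph1 !rmorph0 mulr0 addr0.
  have ri : rat_complex R (0, 1) = 'i%C.
    by rewrite /rat_complex /= !rmorph1 !rmorph0 mulr1 add0r.
  have ii : 'i%C * 'i%C = -1 :> C by rewrite -expr2 sqr_i.
  have ic : ('i%C : C)^* = - 'i%C by exact: conjCi.
  (* For a basis vector b, 2 b = [b + b^*] - i [i b - i b^*]. *)
  exists (2^-1 *: (x1 - 'i%C *: xi)).
  rewrite linearZ linearB linearZ /= x1E xiE r1 ri !ostarZ ic rmorph1 !scale1r.
  rewrite ['i%C *: (_ + _)]scalerDr !scalerA mulrN ii opprK scale1r scaleN1r opprD opprK.
  rewrite addrACA subrr addr0; exact: scale_half.
have [s sP] := choice basis_image.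
exists (\sum_(j < \dim {:E}) coord (vbasis {:E}) j y *: s j).
rewrite linear_sum [RHS](coord_vbasis (memvf y)); apply: eq_bigr => j _.
by rewrite linearZ /= sP.
Qed.

(** A linear section defined on a basis is averaged with its adjoint; the result is still a section
    because Psi preserves the involution. *)
Lemma cover_section : exists sigma : {linear E -> S},
  star_preserving sigma /\ forall y, Psi (sigma y) = y.
Proof.
have [s sP] := choice (fun j : 'I_(\dim {:E}) => cover_onto (vbasis {:E})`_j).
pose sg0 y := \sum_(j < \dim {:E}) coord (vbasis {:E}) j y *: s j.
have sg0P y : Psi (sg0 y) = y.
  rewrite linear_sum [RHS](coord_vbasis (memvf y)); apply: eq_bigr => j _.
  by rewrite linearZ /= sP.
have sg0_lin : linear sg0.
  move=> a y z; rewrite /sg0 scaler_sumr -big_split; apply: eq_bigr => j _.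
  by rewrite linearP scalerDl scalerA.
have half_conj : (2^-1 : C)^* = 2^-1 by rewrite conj_Creal // rpredV realn.
pose sg y := 2^-1 *: (sg0 y + ostar (sg0 (ostar y))).
have sg_lin : linear sg.
  move=> a y z; rewrite /sg ostarD ostarZ !sg0_lin ostarD ostarZ conjCK.
  by rewrite addrACA -scalerDr [LHS]scalerDr !scalerA [a * _]mulrC.
exists (HB.pack sg (GRing.isLinear.Build C E S *:%R sg sg_lin) : {linear E -> S}).
split=> y /=; rewrite /sg.
  by rewrite ostarZ half_conj ostarD !ostarK addrC.
rewrite linearZ linearD /= Psi_star !sg0P ostarK.
exact: scale_half.
Qed.

(** X + e/2 is Y + Y^* for some Y; rational coefficients near those of Y produce an error H, small
    in E and with small image under sigma. With HH = H + H^*, the rational matrix X + e/2 + HH is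
    positive and has a positive lift P0; then P = P0 - e/2 - sigma HH maps to X, and e + P = P0 +
    [e/2 - sigma HH] is positive. *)
Lemma cover_lift (sigma : {linear E -> S}) n (X : 'M[E]_n) (e : R) :
  star_preserving sigma -> (forall y, Psi (sigma y) = y) -> mpos X -> 0 < e ->
  exists P : 'M[S]_n, map_mx Psi P = X /\ mpos ((e%:C *: ounit)%:M + P).
Proof.
move=> sg_star sgP pX e0.
have [T1 T10 T1P] := @small_combination_mpos R E E n (@gen R E).
have [T2 T20 T2P] := @small_combination_mpos R E S n (fun l => sigma (gen l)).
(* This makes both eta T1, the error in E, and eta T2, the error in S, at most e/2. *)
pose eta := (e / 2) / (T1 + T2).
have T0 : 0 < T1 + T2 by exact: addr_gt0.
have eta0 : 0 < eta by rewrite !divr_gt0.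
have e2 : 0 <= e / 2 by rewrite divr_ge0 ?ltW.
have eT1 : 0 <= e / 2 - eta * T1.
  by rewrite subr_ge0 /eta mulrAC ler_pdivrMr // ler_wpM2l // lerDl ltW.
have eT2 : 0 <= e / 2 - eta * T2.
  by rewrite subr_ge0 /eta mulrAC ler_pdivrMr // ler_wpM2l // lerDr ltW.
pose Y : 'M[E]_n := map_mx ( *:%R 2^-1) (X + ((e / 2)%:C *: ounit)%:M).
have half_conj : (2^-1 : C)^* = 2^-1 by rewrite conj_Creal // rpredV realn.
have YY : Y + mxstar ostar Y = X + ((e / 2)%:C *: ounit)%:M.
  have /mpos_star/matrixP sX := mposD pX (mpos_unit E n e2).
  apply/matrixP => a b; rewrite /Y [LHS]mxE [X in _ + X = _]mxE ![map_mx _ _ _ _]mxE.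
  rewrite ostarZ half_conj; have := sX a b; rewrite [LHS]mxE => ->.
  by rewrite -scalerDr scale_half.
have [z zP] := choice (fun ab : 'I_n * 'I_n => gen_span (Y ab.1 ab.2)).
have [q qP] := choice (fun abl : 'I_n * 'I_n * 'I_d =>
  rat_complex_dense (z abl.1 abl.2) eta0).
pose t := Tagged (fun n => 'M['rV[rat * rat]_d]_n)
  (\matrix_(a, b) \row_l q (a, b, l) : 'M_n).
pose Z a b l := rat_complex R (q (a, b, l)) - z (a, b) l.
have ZP a b l := qP (a, b, l).
pose H : 'M[E]_n := \matrix_(a, b) \sum_l Z a b l *: gen l.
have tE : rat_mx t = Y + H.
  have YE a b : Y a b = _ := zP (a, b).
  apply/matrixP => a b; rewrite [LHS]mxE [RHS]mxE YE [H a b]mxE -big_split.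
  by apply: eq_bigr => l _; rewrite !mxE /= -scalerDl subrKC.
have tsE : rat_sa_mx t = X + ((e / 2)%:C *: ounit)%:M + (H + mxstar ostar H).
  have sYH : mxstar ostar (Y + H) = mxstar ostar Y + mxstar ostar H.
    by apply/matrixP => a b; rewrite [LHS]mxE [RHS]mxE ![mxstar _ _ _ _]mxE -ostarD mxE.
  by rewrite -YY /rat_sa_mx tE sYH addrACA.
pose HH := H + mxstar ostar H.
have pt : mpos (rat_sa_mx t).
  rewrite tsE -addrA; apply: mposD pX _.
  have := mposD (mpos_unit E n eT1) (T1P _ _ (ltW eta0) ZP); congr mpos.
  by rewrite addrA -splitunit subrK.
have [P0 [pP0 P0E]] := PsiP pt.
exists (P0 - ((e / 2)%:C *: ounit)%:M - map_mx sigma HH); split.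
  rewrite !map_mxB P0E (map_unit_mx _ _ Psi1) tsE.
  have -> : map_mx Psi (map_mx sigma HH) = HH.
    by apply/matrixP => a b; rewrite ![map_mx _ _ _ _]mxE sgP.
  by rewrite addrAC addrK addrK.
have ZNP a b l : `|complex.Re (- Z a b l)| <= eta /\ `|complex.Im (- Z a b l)| <= eta.
  by have := ZP a b l; rewrite -/(Z a b l); case: (Z a b l) => u v /=; rewrite !normrN.
have p2 := mposD (mpos_unit S n eT2) (T2P _ _ (ltW eta0) ZNP).
have := mposD pP0 p2; congr mpos.
have -> : \matrix_(a, b) \sum_l - Z a b l *: sigma (gen l) = - map_mx sigma H :> 'M[S]_n.
  apply/matrixP => a b; rewrite !mxE linear_sum -sumrN; apply: eq_bigr => l _.
  by rewrite linearZ scaleNr.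
have -> : - map_mx sigma H + mxstar ostar (- map_mx sigma H) = - map_mx sigma HH.
  have sgH (G : 'M[E]_n) :
      mxstar ostar (- map_mx sigma G) = - map_mx sigma (mxstar ostar G).
    by apply/matrixP => a b; rewrite !mxE ostarN sg_star.
  by rewrite /HH map_mxD opprD sgH.
have -> : (e%:C *: ounit)%:M =
    ((e / 2)%:C *: ounit)%:M + ((e / 2)%:C *: ounit)%:M :> 'M[S]_n.
  by rewrite -splitunit -splitr.
rewrite [_ + (_ - map_mx sigma HH)]addrA.
rewrite -(splitunit n (e / 2 - eta * T2) (eta * T2)) subrK.
rewrite addrA [RHS]addrA.
by congr (_ - _); rewrite (addrC P0 (- _)) addrA addrK addrC.
Qed.

End Cover.

(** * Approximate factorization *)

Lemma unit_map_cp (R : realType) (E S : opSystemType R) (omega : {scalar E})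
    (t : R) : 0 <= t -> (forall x, positive x -> 0 <= omega x) ->
  completely_positive (fun x => t%:C *: unit_map S omega x).
Proof.
move=> t0 omega_ge0 n X pX.
have pA (v : 'cV[R[i]]_n) : 0 <= (v^t* *m map_mx omega X *m v) 0 0.
  by rewrite functional_form omega_ge0 // -mpos1E; exact: mpos_compress.
have := mpos_scale t0 (psd_unit_mpos S pA); congr mpos.
by apply/matrixP => i j; rewrite !mxE.
Qed.

Lemma approx_factor_exists (R : realType) (E : finOpSystemType R)
    (omega : {scalar E}) : state omega ->
  (forall (S : opSystemType R) (J : kernel S) (eps : R)
      (phi : {linear E -> quotient_sys J}),
    0 < eps -> completely_positive phi ->
    exists lift : {linear E -> S},
      [/\ star_preserving lift,
          forall x, quotient_map J (lift x) = phi x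
        & completely_positive
            (fun x => lift x + eps%:C *: unit_map S omega x)]) ->
  forall e : R, 0 < e -> inhabited (approx_factor omega e).
Proof.
move=> [omega1 omega_ge0] lifting e e0.
have [k [Psi [Psi1 Psi_cp PsiP]]] := rat_cover E.
have [sigma [sg_star sgP]] := cover_section Psi1 Psi_cp PsiP.
have kerP : exists (T : opSystemType R) (psi : {linear blocks R k -> T}),
    [/\ unital psi, completely_positive psi
      & forall x, (x \in [pred x | Psi x == 0]) = (psi x == 0)].
  by exists E, Psi; split.
pose J := Kernel kerP.
(* phi is the inverse of the map S/J -> E induced by Psi; its complete positivity amounts to lifting
   positive matrices up to every t > 0. *)
pose phi : {linear E -> quotient_sys J} := quotient_map J \o sigma.
have phi_cp : completely_positive phi.
  move=> n X pX.
  have -> : map_mx phi X = map_mx (quotient_map J) (map_mx sigma X).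
    by apply/matrixP => i j; rewrite !mxE.
  apply/quotient_mposE => t t0.
  have [P [PE pP]] := cover_lift Psi1 PsiP sg_star sgP pX t0.
  exists (P - map_mx sigma X); last by rewrite subrKC.
  move=> i j; rewrite inE /= !mxE linearB /= sgP subr_eq0.
  by have /matrixP/(_ i j) := PE; rewrite !mxE => ->.
have e2 : 0 < e / 2 by rewrite divr_gt0.
(* Half of e goes to the lifting; the other half, added in [th], gives Th 1 >= e/2 and so an
   invertible h. *)
have [lift [_ liftP lift_cp]] := lifting _ J _ phi e2 phi_cp.
have PsiL x : Psi (lift x) = x.
  have /quotient_mapP := liftP x; rewrite inE /= linearB /= sgP subr_eq0.
  by move/eqP.
pose S : opSystemType R := blocks R k.
pose th x : S := lift x + e%:C *: unit_map S omega x.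
have th_lin : linear th.
  move=> a x y; rewrite /th /unit_map !linearP /= scalerDl !scalerDr addrACA.
  congr (_ + _); congr (_ + _).
  by rewrite !scalerA mulrCA mulrA.
pose Th : {linear E -> S} := HB.pack th (GRing.isLinear.Build R[i] E S *:%R th th_lin).
have thE x : th x = lift x + (e / 2)%:C *: unit_map S omega x +
    (e / 2)%:C *: unit_map S omega x.
  by rewrite -addrA -scalerDl -rmorphD -splitr.
have Th_cp : completely_positive Th.
  move=> n X pX; have := mposD (lift_cp _ _ pX) (unit_map_cp S (ltW e2) omega_ge0 pX).
  by congr mpos; apply/matrixP => i j; rewrite !mxE /= thE.
have h_pos : positive (Th ounit - (e / 2)%:C *: ounit).
  rewrite /= thE {2}/unit_map omega1 scale1r addrK.
  have one : mpos (ounit%:M : 'M[E]_1).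
    by have := mpos_unit E 1 ler01; rewrite [_%:C]rmorph1 scale1r.
  have := lift_cp _ _ one; congr mpos.
  by apply/matrixP => i j; rewrite !mxE !ord1 eqxx.
constructor; apply: (@ApproxFactor R E omega e S Th Psi
  (blocks_tmul (Th ounit)) Th_cp Psi_cp).
  by move=> x; rewrite linearD linearZ /= PsiL /unit_map linearZ /= Psi1.
exact: blocks_star_mul e2 h_pos.
Qed.

Theorem corollary5p5 (R : realType) (E : finOpSystemType R)
    (omega : {scalar E}) (omega_state : state omega)
    (omega_faithful : faithful omega) :
  (forall (S : opSystemType R) (J : kernel S) (eps : R)
      (phi : {linear E -> quotient_sys J}),
    0 < eps -> completely_positive phi ->
    exists lift : {linear E -> S},
      [/\ star_preserving lift,
          forall x, quotient_map J (lift x) = phi x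
        & completely_positive
            (fun x => lift x + eps%:C *: unit_map S omega x)])
  <->
  (exists (n : nat) (k : 'I_n -> nat),
    (forall j, (0 < k j)%N) /\
    unital_complete_order_iso E
      (dirsum (fun j => 'M[R[i]]_(k j) : opSystemType R))).
Proof.
split=> [lifting|[n [k [_ [f [g [fK gK _ f_cp g_cp]]]]]] S J eps phi].
  have [m mP] := star_mul_exists (proj1 omega_state)
    (approx_factor_exists omega_state lifting).
  exact (wedderburn mP (proj2 omega_state) omega_faithful).
exact: (dirsum_lifting omega_faithful fK gK f_cp g_cp).
Qed.
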